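(* Fix $0<\theta_0<\infty$ and $0\le s,t<\infty$. Let $\theta_1=s/t$ (with $\theta_1=\theta_0$ if $s\wedge t=0$) and $\theta_{n+1}=(n\bar X_n+s)/(n+t)$ for $n\ge1$, where $\bar X_n=\frac1n\sum_{i=1}^nX_i$. Let $$\Lambda_n=\prod_{i=1}^n\left[X_i^{\theta_i-\theta_0}\,\Gamma(\theta_0)/\Gamma(\theta_i)\right],\qquad \tau_b=\min\{n\ge1:\Lambda_n\ge e^b\}$$ ($\tau_b=\infty$ if no such $n$ exists). Then there exists a probability measure $G$ on $(0,\infty)$ (depending on $\theta_0,s,t$) such that the test of $H_0:\theta=\theta_0$ versus $H_1:\theta\ne\theta_0$ that rejects $H_0$ if and only if $\tau_b<\infty$ has significance level $$\alpha=P_{\theta_0}(\tau_b<\infty)=(1+o(1))\,\gamma\,e^{-b},\qquad \gamma=\int\eta(y)\,dG(y),$$ where $o(1)\to0$ as $b\to\infty$. Moreover the test has power one, i.e. $P_\theta(\tau_b<\infty)=1$ for every $\theta\neq\theta_0$.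
   Context: Gamma$(\theta,1)$ has density $f_\theta(x)=x^{\theta-1}e^{-x}/\Gamma(\theta)$, $x>0$. Under $P_\theta$ (expectation $E_\theta$) the observations $X_1,X_2,\ldots$ are i.i.d. Gamma$(\theta,1)$, $\theta>0$. For $\theta\neq\theta_0$, $$\eta(\theta)=\lim_{b\to\infty}E_\theta\exp\left\{-\left[\sum_{i=1}^{M_b}\log\frac{f_\theta(Z_i)}{f_{\theta_0}(Z_i)}-b\right]\right\},$$ where $Z_1,Z_2,\ldots$ are i.i.d. Gamma$(\theta,1)$ and $M_b=\min\{n\ge1:\sum_{i=1}^n\log(f_\theta(Z_i)/f_{\theta_0}(Z_i))\ge b\}$. *)

(* Defs.v *)
From mathcomp Require Import all_boot all_order all_algebra.
From mathcomp Require Import all_classical all_reals all_analysis.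
Set Implicit Arguments.
Unset Strict Implicit.
Unset Printing Implicit Defensive.
Import Order.TTheory GRing.Theory Num.Theory.
Import numFieldNormedType.Exports.
Local Open Scope classical_set_scope.
Local Open Scope ring_scope.

(* Sequences are indexed from 0: [x i] is the (i+1)-st observation. *)

Definition Gamma_fun (R : realType) (theta : R) : R :=
  \int[lebesgue_measure]_(x in `]0, +oo[) (x `^ (theta - 1) * expR (- x)).

Definition gamma_pdf (R : realType) (theta x : R) : R :=
  if 0 < x then x `^ (theta - 1) * expR (- x) / Gamma_fun theta else 0.

Definition mutually_independent d (T : measurableType d) (R : realType)
    (P : probability T R) (X : nat -> {mfun T >-> R}) : Prop :=
  forall (J : seq nat) (A : nat -> set R), uniq J ->
    (forall i, measurable (A i)) ->
    P [set w | forall i, i \in J -> A i (X i w)] =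
    (\prod_(i <- J) P (X i @^-1` A i))%E.

Definition gamma_law d (T : measurableType d) (R : realType)
    (P : probability T R) (theta : R) (X : {mfun T >-> R}) : Prop :=
  forall A : set R, measurable A ->
    P (X @^-1` A) = (\int[lebesgue_measure]_(x in A) (gamma_pdf theta x)%:E)%E.

Definition iid_gamma d (T : measurableType d) (R : realType)
    (P : probability T R) (theta : R) (X : nat -> {mfun T >-> R}) : Prop :=
  mutually_independent P X /\ forall i, gamma_law P theta (X i).

(* min {n >= 1 : p n}, with [None] standing for infinity. *)
Definition first_time (p : pred nat) : option nat :=
  match pselect (exists n, (0 < n)%N && p n) with
  | left h => Some (ex_minn h)
  | right _ => None
  end.

Section Overshoot.
Variables (R : realType) (theta0 theta : R).

Definition log_lr (z : nat -> R) (n : nat) : R :=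
  \sum_(i < n) ln (gamma_pdf theta (z i) / gamma_pdf theta0 (z i)).

Definition crossing_time (b : R) (z : nat -> R) : option nat :=
  first_time (fun n => b <= log_lr z n).

(* The value 0 on {M_b = oo} is immaterial: this event is P_theta-null when
   theta != theta0. *)
Definition exp_overshoot (b : R) (z : nat -> R) : R :=
  if crossing_time b z is Some m then expR (- (log_lr z m - b)) else 0.

Definition mean_exp_overshoot d (T : measurableType d) (P : probability T R)
    (Z : nat -> {mfun T >-> R}) (b : R) : \bar R :=
  'E_P[fun w => exp_overshoot b (fun i => Z i w)].

End Overshoot.

(* Meaningful for theta > 0 and theta != theta0 only. *)
Definition eta (R : realType) (theta0 : R) d (T : measurableType d)
    (P : R -> probability T R) (Z : nat -> {mfun T >-> R}) (theta : R) : \bar R :=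
  lim (mean_exp_overshoot theta0 theta (P theta) Z b @[b --> +oo%R]).

Section SequentialTest.
Variables (R : realType) (theta0 s t : R).

(* [theta_hat x n] is theta_{n+1}; it depends on the first n
   observations only. *)
Definition theta_hat (x : nat -> R) (n : nat) : R :=
  if n == 0%N then (if Num.min s t == 0 then theta0 else s / t)
  else let xbar := n%:R^-1 * \sum_(i < n) x i in
       (n%:R * xbar + s) / (n%:R + t).

Definition Lambda (x : nat -> R) (n : nat) : R :=
  \prod_(i < n) (x i `^ (theta_hat x i - theta0)
                 * (Gamma_fun theta0 / Gamma_fun (theta_hat x i))).

Definition tau (b : R) (x : nat -> R) : option nat :=
  first_time (fun n => expR b <= Lambda x n).

End SequentialTest.

(* The event {tau_b < oo}, i.e. the rejection region. *)
Definition rejects (R : realType) (theta0 s t : R) d (T : measurableType d)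
    (X : nat -> {mfun T >-> R}) (b : R) : set T :=
  [set w | tau theta0 s t b (fun i => X i w) != None].

(* Main.v *)
(* Under the predictable law for which X_(n+1) is Gamma(theta_(n+1), 1) given the
   past, Lambda is the likelihood ratio with respect to P_(theta0); hence
   e^b P_(theta0)(tau_b < oo) is the mean under that law of e^(- overshoot).
   The estimates theta_n then form a martingale with increments of order 1/n.
   Laplace transforms near 0 and a fourth moment bound near theta0 show that it
   spends asymptotically no mass near these two points, while it hardly moves
   after a late time; so after a late time the log-likelihood walk is close to an
   i.i.d. walk with parameter theta_n, and its mean e^(- overshoot) is close to
   eta(theta_n).  The renewal limit eta itself exists because the value of the
   i.i.d. walk is asymptotically insensitive to shifts of the starting point: a
   shift is absorbed by rescaling finitely many observations, at a small cost in
   density ratios.  Local uniformity in theta makes eta continuous, so the limit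
   gamma exists and is an average of values of eta. *)

(* No probability space is built for the predictable law, and no limit of the estimates is
   constructed. That law is met only through values of stopped chains, defined by backward recursion
   over Gamma densities; a probability under it is bounded by exhibiting a superharmonic function.
   Two consequences shape the proof. The existence of the limit is a Cauchy argument that compares
   two far boundaries for one and the same chain. And the law of the limiting estimate is never
   identified: it is enough to trap [gamma] between two attained values of [eta], which is why
   strict inequalities have to survive limits and expectations. The observations enter only at the
   end, where independence identifies the rejection probability and the mean overshoot with values
   of chains. *)
From HB Require Import structures.
Require Import Defs.
From mathcomp Require Import all_boot all_order all_algebra.
From mathcomp Require Import all_classical all_reals all_analysis.
From mathcomp Require Import measurable_realfun.
From mathcomp Require Import ring lra.
Import Order.TTheory GRing.Theory Num.Theory.
Import numFieldNormedType.Exports.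
Local Open Scope classical_set_scope.
Local Open Scope ring_scope.
Set Implicit Arguments.
Unset Strict Implicit.
Unset Printing Implicit Defensive.

(** * The Gamma function and expectations under Gamma laws *)

Section GammaBasics.
Context {R : realType}.
Implicit Types (p z a b : R).
Local Notation mu := (@lebesgue_measure R).

(** The kernel z^p e^{-z}, written through [expR] and [ln] so that it is positive for every z and
    products of kernels add exponents. Its values at z <= 0 are never integrated. *)
Definition gker p z : R := expR (p * ln z - z).

Lemma gker_gt0 p z : 0 < gker p z. Proof. exact: expR_gt0. Qed.
Lemma gker_ge0 p z : 0 <= gker p z. Proof. exact: expR_ge0. Qed.

Lemma measurable_fun_gker d (T : measurableType d) (f g : T -> R) :
  measurable_fun setT f -> measurable_fun setT g ->
  measurable_fun setT (fun t => gker (f t) (g t)).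
Proof.
move=> mf mg; apply: measurableT_comp; first exact: measurable_expR.
apply: measurable_funB => //; apply: measurable_funM => //.
by apply: measurableT_comp => //; exact: measurable_ln.
Qed.

Lemma measurable_gker p : measurable_fun [set: R] (gker p).
Proof. exact: measurable_fun_gker. Qed.

Lemma emeasurable_gker p (D : set (measurableTypeR R)) :
  measurable_fun D (fun z => (gker p z)%:E).
Proof.
by apply/measurable_EFinP; apply: measurable_funTS; exact: measurable_gker.
Qed.

Lemma gkerD p q z : gker (p + q) z = expR (q * ln z) * gker p z.
Proof. by rewrite /gker -expRD; congr expR; rewrite mulrDl; ring. Qed.

Lemma gkerS p z : 0 < z -> gker (p + 1) z = z * gker p z.
Proof. by move=> z0; rewrite gkerD mul1r lnK. Qed.

Lemma ln_le_sub1 z : 0 < z -> ln z <= z - 1.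
Proof.
move=> z0; rewrite [X in ln X](_ : z = 1 + (z - 1)); last by ring.
by apply: le_ln1Dx; lra.
Qed.

(** The concave [ln] lies below its tangent at 2 (p + 1), and that slope leaves half of the
    exponential decay. *)
Lemma gker_le p z : 0 <= p -> 0 < z ->
  gker p z <= expR (p * ln (2 * (p + 1))) * expR (- (2^-1 * z)).
Proof.
move=> p0 z0; rewrite /gker -expRD ler_expR.
have q0 : 0 < 2 * (p + 1) by lra.
have := @ln_le_sub1 (z / (2 * (p + 1))) (divr_gt0 z0 q0).
rewrite ln_div ?posrE// lerBlDr => h.
have {}h : ln z <= z / (2 * (p + 1)) + ln (2 * (p + 1)) by lra.
have := ler_wpM2l p0 h; rewrite mulrDr.
have : p * (z / (2 * (p + 1))) <= 2^-1 * z.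
  by rewrite mulrA ler_pdivrMr//; nra.
lra.
Qed.

(** Kept in the extended reals: [gint_recP] is proved before [gint (p - 1)] is known to be
    finite. *)
Definition gint p : \bar R := (\int[mu]_(z in `]0%R, +oo[) (gker p z)%:E)%E.

Lemma gint_ge0 p : (0 <= gint p)%E.
Proof. by apply: integral_ge0 => z _; rewrite lee_fin gker_ge0. Qed.

Lemma integrable_exp_half :
  mu.-integrable `]0%R, +oo[ (fun z => (expR (- (2^-1 * z)))%:E).
Proof.
have h : 0 < 2^-1 :> R by rewrite invr_gt0.
have : mu.-integrable `]0%R, +oo[ (EFin \o exponential_pdf (2^-1 : R)).
  exact: (integrableS _ _ _ (integrable_exponential_pdf h)).
move=> i; have := @integrableZl _ _ _ mu _ (measurable_itv _) 2 _ i.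
apply: eq_integrable; first exact: measurable_itv.
move=> z; rewrite inE/= in_itv/= andbT => z0.
rewrite exponential_pdfE ?ltW// -EFinM; congr EFin.
by rewrite mulrA mulfV// mul1r mulNr.
Qed.

Lemma integrable_gker_ge0 p : 0 <= p ->
  mu.-integrable `]0%R, +oo[ (fun z => (gker p z)%:E).
Proof.
move=> p0; apply: (@le_integrable _ _ _ mu _ (measurable_itv _) _
  (fun z => (expR (p * ln (2 * (p + 1))))%:E * (expR (- (2^-1 * z)))%:E)%E).
- exact: emeasurable_gker.
- move=> z; rewrite /= in_itv/= andbT => z0.
  rewrite lee_fin !ger0_norm ?gker_ge0 ?mulr_ge0 ?expR_ge0//.
  exact: gker_le.
- by apply: integrableZl => //; exact: integrable_exp_half.
Qed.

Lemma is_derive_gker p z : 0 < z ->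
  is_derive z 1 (gker p) (p * gker (p - 1) z - gker p z).
Proof.
move=> z0; have dl := is_derive1_ln z0.
have d1 : is_derive z 1 (fun z => p * ln z - z) (p * z^-1 - 1).
  by apply: is_deriveB.
have := is_derive1_comp (is_derive_expR _) d1.
rewrite (_ : _ * _ = p * gker (p - 1) z - gker p z) //.
rewrite mulrBr mulr1; congr (_ - _); rewrite -{1}(subrK 1 p) -/(gker _ _).
by rewrite gkerS// mulrCA; congr (_ * _); rewrite mulrC mulrA mulVf ?gt_eqF// mul1r.
Qed.

Lemma continuous_gker p z : 0 < z -> {for z, continuous (gker p)}.
Proof.
move=> z0; apply: differentiable_continuous; apply/derivable1_diffP.
by have [] := is_derive_gker p z0.
Qed.

Lemma gker_FTC p a b : 0 < a -> a < b ->
  (\int[mu]_(z in `[a, b]) (p * gker (p - 1) z - gker p z)%:E =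
   (gker p b)%:E - (gker p a)%:E)%E.
Proof.
move=> a0 ab; apply: continuous_FTC2 => //.
- apply: continuous_in_subspaceT => z; rewrite inE/= in_itv/= => /andP[az _].
  have z0 : 0 < z by exact: lt_le_trans az.
  apply: cvgB; last exact: continuous_gker.
  by apply: cvgM; [exact: cvg_cst|exact: continuous_gker].
- split.
  + move=> z; rewrite in_itv/= => /andP[az _].
    by have [] := is_derive_gker p (lt_trans a0 az).
  + by apply: cvg_at_right_filter; exact: continuous_gker.
  + by apply: cvg_at_left_filter; apply: continuous_gker; exact: lt_trans ab.
- move=> z; rewrite in_itv/= => /andP[az _].
  by rewrite derive1E; have [_ ->] := is_derive_gker p (lt_trans a0 az).
Qed.

Lemma integrable_gker_itv p a b : 0 < a ->
  mu.-integrable `[a, b] (fun z => (gker p z)%:E).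
Proof.
move=> a0; apply: (@continuous_compact_integrable _ (gker p)).
  exact: segment_compact.
apply: continuous_in_subspaceT => z; rewrite inE/= in_itv/= => /andP[az _].
by apply: continuous_gker; exact: lt_le_trans az.
Qed.

(** The shift by two keeps the left end strictly below the right end, as [gker_FTC] requires. *)
Let I n : set R := `[n.+2%:R^-1, n.+2%:R]%classic.

Let gker_cvg p :
  (\int[mu]_(z in I n) (gker p z)%:E @[n --> \oo] --> gint p)%E.
Proof.
rewrite /gint (_ : [set` `]0, +oo[] = \bigcup_n I n); last first.
  apply/seteqP; split => [z|z [n _]]; rewrite /I /= !in_itv/= ?andbT; last first.
    by move=> /andP[+ _]; apply: lt_le_trans; rewrite invr_gt0 ltr0n.
  move=> z0; pose m := Num.bound (Num.max z z^-1).
  have hm : Num.max z z^-1 < m%:R.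
    by apply: archi_boundP; rewrite le_max (ltW z0).
  exists m => //=; rewrite in_itv/=.
  have hz : Num.max z z^-1 <= m.+2%:R.
    by rewrite (le_trans (ltW hm))// ler_nat -addn2 leq_addr.
  move: hz; rewrite ge_max => /andP[h1 h2].
  by rewrite h1 andbT -[z]invrK lef_pV2// posrE ?invr_gt0// ltr0n.
apply: ge0_nondecreasing_set_cvg_integral.
- move=> n m nm; apply/subsetPset => z; rewrite /I/= !in_itv/= => /andP[h1 h2].
  rewrite (le_trans h2) ?ler_nat ?ltnS// andbT (le_trans _ h1)//.
  by rewrite lef_pV2 ?posrE ?ltr0n// ler_nat !ltnS.
- by move=> n; exact: measurable_itv.
- by move=> n; exact: emeasurable_gker.
- by move=> n z _; rewrite lee_fin gker_ge0.
Qed.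

Let gker_rec p n :
  (p%:E * \int[mu]_(z in I n) (gker (p - 1) z)%:E
   = \int[mu]_(z in I n) (gker p z)%:E
     + ((gker p n.+2%:R)%:E - (gker p n.+2%:R^-1)%:E))%E.
Proof.
have n0 : (0 < n.+2%:R :> R) by rewrite ltr0n.
have nV : (0 < n.+2%:R^-1 :> R) by rewrite invr_gt0.
have nn : (n.+2%:R^-1 < n.+2%:R :> R).
  by rewrite -[X in X < _]mul1r ltr_pdivrMr// -natrM ltr1n.
rewrite -gker_FTC//.
have i1 := integrable_gker_itv (p - 1) n.+2%:R nV.
have i2 := integrable_gker_itv p n.+2%:R nV.
under [X in _ = (_ + X)%E]eq_integral do rewrite EFinB EFinM.
rewrite integralB//; last by apply: integrableZl => //; exact: measurable_itv.
rewrite integralZl// [RHS]addeC subeK//.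
by apply: integrable_fin_num => //; exact: measurable_itv.
Qed.

Let gker_bdry0 p : 0 < p -> gker p n.+2%:R^-1 @[n --> \oo] --> (0 : R).
Proof.
move=> p0; apply: (@squeeze_cvgr _ _ _ _ (cst 0) (fun n => n.+2%:R^-1 `^ p)).
- near=> n; rewrite gker_ge0/= /powR gt_eqF ?invr_gt0 ?ltr0n// ler_expR.
  by rewrite gerBl invr_ge0 ler0n.
- exact: cvg_cst.
- have /cvg_at_rightP := powR_cvg0 p0; apply; split.
    by move=> n; rewrite invr_gt0 ltr0n.
  by have := @cvg_harmonic R; rewrite -(cvg_shiftS).
Unshelve. all: by end_near. Qed.

Let gker_bdryy p : 0 <= p -> gker p n.+2%:R @[n --> \oo] --> (0 : R).
Proof.
move=> p0; have [d ->] : exists d : R, 0 = d * 0 by exists 0; rewrite mul0r.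
apply: (@squeeze_cvgr _ _ _ _ (cst (d * 0))
  (fun n => expR (p * ln (2 * (p + 1))) * expR (- (2^-1 * n.+2%:R)))).
- near=> n; rewrite mulr0 gker_ge0/=; apply: gker_le => //.
- exact: cvg_cst.
- rewrite mulr0 -(mulr0 (expR (p * ln (2 * (p + 1))))).
  apply: cvgM; first exact: cvg_cst.
  apply: (@cvg_comp _ _ _ (fun n => 2^-1 * n.+2%:R) (fun x => expR (- x)) _ +oo).
    apply/cvgryPge => A; near=> n.
    have hn : A * 2 <= n%:R by near: n; exact: nbhs_infty_ger.
    by have -> : n.+2%:R = n%:R + 2%:R :> R; [rewrite -natrD addn2|lra].
  exact: cvgr_expR.
Unshelve. all: by end_near. Qed.

(** Integration by parts on [I n]; both boundary terms vanish in the limit. *)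
Lemma gint_recP p : 0 < p -> (p%:E * gint (p - 1) = gint p)%E.
Proof.
move=> p0; have pfin : gint p \is a fin_num.
  by apply: integrable_fin_num (integrable_gker_ge0 (ltW p0)) => //.
have h1 : (p%:E * \int[mu]_(z in I n) (gker (p - 1) z)%:E @[n --> \oo]
    --> p%:E * gint (p - 1))%E by apply: cvgeZl => //; exact: gker_cvg.
apply: (cvg_unique _ h1) => //.
have e : gint p = (gint p + (0%:E - 0%:E))%E by rewrite sube0 adde0.
rewrite [X in [set x | _] X]e /=.
under eq_fun do rewrite gker_rec.
apply: cvgeD; first by rewrite fin_num_adde_defr.
  exact: gker_cvg.
under eq_fun do rewrite -EFinB.
rewrite -EFinD; apply: cvg_EFin; first by apply: nearW.
by apply: cvgB; [exact: (gker_bdryy (ltW p0))|exact: gker_bdry0].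
Qed.

(** For -1 < p < 0 the singularity at 0 is not estimated: the recursion transfers finiteness from p
    + 1. *)
Lemma gint_fin p : -1 < p -> gint p \is a fin_num.
Proof.
move=> p1; have p0 : 0 < p + 1 by lra.
have := gint_recP p0; rewrite addrK => e.
have : gint (p + 1) \is a fin_num.
  by apply: integrable_fin_num (integrable_gker_ge0 (ltW p0)) => //.
rewrite -e; case: (gint p) (gint_ge0 p) => //.
by rewrite gt0_muley// lte_fin.
Qed.

Lemma integrable_gker p : -1 < p ->
  mu.-integrable `]0%R, +oo[ (fun z => (gker p z)%:E).
Proof.
move=> p1; apply/integrableP; split; first exact: emeasurable_gker.
under eq_integral do rewrite gee0_abs ?lee_fin ?gker_ge0//.
by have := gint_fin p1; rewrite ge0_fin_numE ?gint_ge0.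
Qed.

Local Notation Gam := (@Gamma_fun R).

Lemma gker_powR p z : 0 < z -> z `^ p * expR (- z) = gker p z.
Proof. by move=> z0; rewrite /powR gt_eqF// -expRD. Qed.

Lemma GammaE p : 0 < p -> (Gam p)%:E = gint (p - 1).
Proof.
move=> p0; rewrite /Gamma_fun /Rintegral.
rewrite (_ : integral _ _ _ = gint (p - 1)); last first.
  apply: eq_integral => z.
  by rewrite inE/= in_itv/= andbT => z0; rewrite gker_powR.
by rewrite fineK//; apply: gint_fin; lra.
Qed.

Lemma Gamma_rec p : 0 < p -> Gam (p + 1) = p * Gam p.
Proof.
move=> p0; apply: EFin_inj; rewrite EFinM !GammaE//; last lra.
by rewrite gint_recP// addrK.
Qed.

Lemma Gamma_gt0 p : 0 < p -> 0 < Gam p.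
Proof.
move=> p0; rewrite -lte_fin GammaE//.
(* Only the part over [1, 2] is kept, where the kernel has an explicit constant lower bound. *)
apply: (@lt_le_trans _ _ (\int[mu]_(z in `[1%R, 2%R])
   (cst (expR (- `|p - 1| * ln 2 - 2))%:E z))%E).
  rewrite integral_cst//= lebesgue_measure_itv/= lte_fin ltr1n/=.
  by rewrite -EFinB -EFinM lte_fin mulr_gt0 ?expR_gt0//; lra.
apply: (@le_trans _ _ (\int[mu]_(z in `[1%R, 2%R]) (gker (p - 1) z)%:E)%E).
  apply: ge0_le_integral => //.
  - by move=> z _; rewrite lee_fin expR_ge0.
  - exact: emeasurable_gker.
  - move=> z /=; rewrite in_itv/= => /andP[z1 z2]; rewrite lee_fin ler_expR.
    have l0 : 0 <= ln z by rewrite ln_ge0.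
    have l2 : ln z <= ln 2 by rewrite ler_ln ?posrE//; lra.
    have h : - `|p - 1| * ln 2 <= (p - 1) * ln z; last lra.
    rewrite mulNr lerNl -mulNr (le_trans (ler_norm _))// normrM normrN.
    by rewrite (ger0_norm l0) ler_wpM2l.
apply: ge0_subset_integral => //.
- exact: emeasurable_gker.
- by move=> z _; rewrite lee_fin gker_ge0.
- move=> z /=; rewrite !in_itv/= andbT => /andP[z1 _]; lra.
Qed.

End GammaBasics.

Definition scal (R : realType) (l : R) (z : measurableTypeR R) : measurableTypeR R := l * z.

Lemma measurable_scal (R : realType) (l : R) : measurable_fun setT (@scal R l).
Proof. exact: mulrl_measurable. Qed.

Section Scaling.
Context {R : realType}.
Local Notation mu := (@lebesgue_measure R).

(** By uniqueness on intervals this is the Lebesgue measure again, which yields linear substitution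
    for all nonnegative measurable integrands. *)
Let scaled (l : {posnum R}) : {measure set (measurableTypeR R) -> \bar R} :=
  mscale (NngNum (ltW [gt0 of l%:num]))
    (measure_function_pushforward__canonical__measure_function_Measure
      mu (@measurable_scal R l%:num)).

Lemma lebesgue_measure_scal (l : {posnum R}) (A : set (measurableTypeR R)) :
  measurable A -> mu A = scaled l A.
Proof.
apply: lebesgue_measure_unique => _ [[a b] _ <-].
rewrite /scaled/= /mscale/= /pushforward/=.
rewrite (_ : _ @^-1` _ = `]a / l%:num, b / l%:num]%classic); last first.
  apply/seteqP; split => z; rewrite /scal/= !in_itv/=.
    by rewrite ltr_pdivrMr// ler_pdivlMr// mulrC.
  by rewrite ltr_pdivrMr// ler_pdivlMr// mulrC.
rewrite !lebesgue_measure_itv/= !lte_fin ltr_pM2r ?invr_gt0//.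
case: ifPn => ab; last by rewrite mule0.
by rewrite -!EFinB -EFinM -mulrBl mulrC divfK.
Qed.

Lemma integral_scal (l : R) (f : R -> \bar R) : 0 < l ->
  measurable_fun [set: R] f -> (forall z, 0 <= f z)%E ->
  (\int[mu]_(z in `]0%R, +oo[) f z
   = l%:E * \int[mu]_(z in `]0%R, +oo[) f (l * z)%R)%E.
Proof.
move=> l0 mf f0.
rewrite (eq_measure_integral (scaled (PosNum l0))); last first.
  by move=> A mA _; exact: lebesgue_measure_scal.
rewrite ge0_integral_mscale//=; last first.
  exact: measurable_funTS.
rewrite ge0_integral_pushforward//; [|exact: measurable_scal|exact: measurable_funTS].
congr (_ * _)%E.
rewrite (_ : _ @^-1` _ = `]0%R, +oo[%classic) //.
apply/seteqP; split => z; rewrite /scal/= !in_itv/= !andbT.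
  by rewrite pmulr_rgt0.
by rewrite pmulr_rgt0.
Qed.

End Scaling.

(** Normalising constants in logarithmic form: ratios of densities then reduce to a [ring] identity
    under [expR]. *)
HB.lock Definition lgam (R : realType) (p : R) : R := ln (Gamma_fun p).

Section Expectation.
Context {R : realType}.
Local Notation mu := (@lebesgue_measure R).
Local Notation Gam := (@Gamma_fun R).
Local Notation pos := (`]0%R, +oo[%classic : set (measurableTypeR R)).

Implicit Types (p q k c v w z : R) (f g : R -> R) (F G : R -> \bar R).

Lemma mpos : measurable pos. Proof. exact: measurable_itv. Qed.

Lemma posRE z : pos z = (0 < z). Proof. by rewrite /= in_itv/= andbT. Qed.

Lemma measurable_prodTypeR d (T : measurableType d) (F : T * R -> \bar R) :
  measurable_fun setT F ->
  measurable_fun (setT : set (T * measurableTypeR R)) F.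
Proof. exact. Qed.

Lemma measurable_int_pos d (T : measurableType d) (F : T * R -> \bar R) :
  measurable_fun setT F -> (forall u, 0 <= F u)%E ->
  measurable_fun setT (fun x => \int[mu]_(z in pos) F (x, z))%E.
Proof.
move=> /measurable_prodTypeR mF F0.
pose G (u : T * measurableTypeR R) := if (0 : R) < u.2 then F u else 0%E.
have mG : measurable_fun setT G.
  apply: measurable_fun_ifT => //.
  exact: measurable_fun_ltr.
have G0 u : (0 <= G u)%E by rewrite /G; case: ifP.
have := @measurable_fun_fubini_tonelli_F _ _ _ _ _ mu G mG G0.
congr (measurable_fun _ _); apply/funext => x.
rewrite /fubini_F [RHS]integral_mkcond; apply: eq_integral => z _.
rewrite /G /patch /=; case: ifPn => z0; case: ifPn => //.
  by rewrite notin_setE posRE z0.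
by rewrite inE posRE (negbTE z0).
Qed.

Lemma Gamma_fineE p : Gam p = fine (gint (p - 1)).
Proof.
rewrite /Gamma_fun /Rintegral; congr fine.
apply: eq_integral => z; rewrite inE posRE => z0.
by rewrite gker_powR.
Qed.

Lemma measurable_Gamma : measurable_fun [set: R] Gam.
Proof.
rewrite (_ : Gam = fun p => fine (gint (p - 1))); last first.
  by apply/funext => p; exact: Gamma_fineE.
apply: measurableT_comp => //.
apply: (@measurable_int_pos _ R (fun u => (gker (u.1 - 1) u.2)%:E)).
  apply/measurable_EFinP; apply: measurable_fun_gker => //.
  exact: measurable_funB.
by move=> u; rewrite lee_fin gker_ge0.
Qed.

Lemma measurable_lgam : measurable_fun [set: R] (@lgam R).
Proof.
rewrite (_ : @lgam R = @ln R \o @Gamma_fun R); last by rewrite lgam.unlock.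
by apply: measurableT_comp; [exact: measurable_ln|exact: measurable_Gamma].
Qed.

Lemma lgamK p : 0 < p -> expR (lgam p) = Gam p.
Proof. by move=> p0; rewrite lgam.unlock lnK// posrE Gamma_gt0. Qed.

(** Positive on the whole line, so that density ratios need no case distinction; it agrees with
    [gamma_pdf] on the positive axis, the only set over which [Ex] integrates. *)
Definition gpdf p z : R := expR (- lgam p) * gker (p - 1) z.

Lemma gpdf_gt0 p z : 0 < gpdf p z.
Proof. by rewrite mulr_gt0 ?expR_gt0. Qed.

Lemma gpdf_ge0 p z : 0 <= gpdf p z. Proof. exact/ltW/gpdf_gt0. Qed.

Lemma gamma_pdfE p z : 0 < p -> 0 < z -> gamma_pdf p z = gpdf p z.
Proof.
by move=> p0 z0; rewrite /gamma_pdf z0 gker_powR// mulrC /gpdf expRN lgamK.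
Qed.

Lemma measurable_fun_lgam d (T : measurableType d) (f : T -> R) :
  measurable_fun setT f -> measurable_fun setT (fun t => lgam (f t)).
Proof. by move=> mf; apply: (measurableT_comp measurable_lgam). Qed.

Lemma measurable_fun_gpdf d (T : measurableType d) (f g : T -> R) :
  measurable_fun setT f -> measurable_fun setT g ->
  measurable_fun setT (fun t => gpdf (f t) (g t)).
Proof.
move=> mf mg; apply: measurable_funM.
  apply: measurableT_comp; first exact: measurable_expR.
  by apply: measurableT_comp => //; exact: measurable_fun_lgam.
apply: measurable_fun_gker => //; exact: measurable_funB.
Qed.

Lemma measurable_gpdf p : measurable_fun [set: R] (gpdf p).
Proof. exact: measurable_fun_gpdf. Qed.

(** Gamma expectations come in two forms: [Ex] for nonnegative extended functions, such as values of
    chains, and [isE] for real functions of any sign. *)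
Definition Ex p (F : R -> \bar R) : \bar R :=
  (\int[mu]_(z in pos) ((gpdf p z)%:E * F z))%E.

(** A relation rather than a function, so that integrability travels with the value and linear
    combinations of known means need no side conditions. *)
Definition isE p (g : R -> R) (v : R) :=
  mu.-integrable pos (fun z => (gpdf p z * g z)%:E) /\
  (\int[mu]_(z in pos) (gpdf p z * g z)%:E = v%:E)%E.

Lemma Ex_ge0 p F : (forall z, (0 < z)%R -> 0 <= F z)%E -> (0 <= Ex p F)%E.
Proof.
move=> F0; apply: integral_ge0 => z; rewrite posRE => z0.
by rewrite mule_ge0 ?F0// lee_fin gpdf_ge0.
Qed.

Lemma eq_Ex p F G : (forall z, 0 < z -> F z = G z) -> Ex p F = Ex p G.
Proof.
by move=> FG; apply: eq_integral => z; rewrite inE posRE => z0; rewrite FG.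
Qed.

Lemma le_Ex p F G : (forall z, (0 < z)%R -> 0 <= F z)%E ->
  (forall z, (0 < z)%R -> F z <= G z)%E -> (Ex p F <= Ex p G)%E.
Proof.
move=> F0 FG; have G0 z : 0 < z -> (0 <= G z)%E.
  by move=> z0; apply: (le_trans (F0 z z0)); exact: FG.
rewrite /Ex !(integral_mkcond pos) !ge0_integralTE; first last.
- by apply: erestrict_ge0 => z; rewrite posRE => z0; rewrite mule_ge0 ?F0 ?lee_fin ?gpdf_ge0.
- by apply: erestrict_ge0 => z; rewrite posRE => z0; rewrite mule_ge0 ?G0 ?lee_fin ?gpdf_ge0.
apply: le_ereal_sup => _ [h /= hF <-]; exists h => // z.
apply: (le_trans (hF z)); rewrite /patch; case: ifPn => //.
by rewrite inE posRE => z0; rewrite lee_wpmul2l ?FG// lee_fin gpdf_ge0.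
Qed.

Lemma emeasurable_gpdfM p (F : R -> \bar R) : measurable_fun [set: R] F ->
  measurable_fun pos (fun z => (gpdf p z)%:E * F z)%E.
Proof.
move=> mF; apply: emeasurable_funM; last exact: measurable_funTS.
by apply/measurable_EFinP; apply: measurable_funTS; exact: measurable_gpdf.
Qed.

Lemma ExD p F G : measurable_fun [set: R] F -> measurable_fun [set: R] G ->
  (forall z, (0 < z)%R -> 0 <= F z)%E -> (forall z, (0 < z)%R -> 0 <= G z)%E ->
  (Ex p (fun z => F z + G z) = Ex p F + Ex p G)%E.
Proof.
move=> mF mG F0 G0; rewrite /Ex -ge0_integralD//; first last.
- exact: emeasurable_gpdfM.
- by move=> z; rewrite posRE => z0; rewrite mule_ge0 ?G0 ?lee_fin ?gpdf_ge0.
- exact: emeasurable_gpdfM.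
- by move=> z; rewrite posRE => z0; rewrite mule_ge0 ?F0 ?lee_fin ?gpdf_ge0.
apply: eq_integral => z; rewrite inE posRE => z0.
by rewrite ge0_muleDr ?F0 ?G0.
Qed.

Lemma ExZ p (k : R) F : measurable_fun [set: R] F -> 0 <= k ->
  (forall z, (0 < z)%R -> 0 <= F z)%E ->
  (Ex p (fun z => k%:E * F z) = k%:E * Ex p F)%E.
Proof.
move=> mF k0 F0; rewrite /Ex -ge0_integralZl_EFin//; first last.
- exact: emeasurable_gpdfM.
- by move=> z; rewrite posRE => z0; rewrite mule_ge0 ?F0 ?lee_fin ?gpdf_ge0.
by apply: eq_integral => z _; rewrite muleCA.
Qed.

Lemma isE_Ex p g v : isE p g v -> Ex p (fun z => (g z)%:E) = v%:E.
Proof. by move=> [_ <-]; apply: eq_integral => z _; rewrite EFinM. Qed.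

Lemma integrable_pos_ext F G : (forall z, 0 < z -> F z = G z) ->
  mu.-integrable pos F -> mu.-integrable pos G.
Proof.
by move=> FG; apply: eq_integrable => // z; rewrite inE posRE; exact: FG.
Qed.

Lemma isE_ext p f g v : (forall z, 0 < z -> f z = g z) -> isE p f v -> isE p g v.
Proof.
move=> fg [fi fv]; split.
  by apply: integrable_pos_ext fi => z z0; rewrite fg.
by rewrite -fv; apply: eq_integral => z; rewrite inE posRE => z0; rewrite fg.
Qed.

Lemma isED p f g v w : isE p f v -> isE p g w ->
  isE p (fun z => f z + g z) (v + w).
Proof.
move=> [fi fv] [gi gw]; split.
  apply: integrable_pos_ext (integrableD _ fi gi) => //.
  by move=> z _ /=; rewrite -EFinD mulrDr.
rewrite EFinD -fv -gw -integralD//.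
by apply: eq_integral => z _; rewrite -EFinD mulrDr.
Qed.

Lemma isEZ p k f v : isE p f v -> isE p (fun z => k * f z) (k * v).
Proof.
move=> [fi fv]; split.
  apply: integrable_pos_ext (integrableZl _ k fi) => //.
  by move=> z _ /=; rewrite -EFinM mulrCA.
rewrite EFinM -fv -integralZl//.
by apply: eq_integral => z _; rewrite -EFinM mulrCA.
Qed.

Lemma isEN p f v : isE p f v -> isE p (fun z => - f z) (- v).
Proof.
by move=> /(isEZ (-1)); rewrite mulN1r; apply: isE_ext => z _; rewrite mulN1r.
Qed.

Lemma isEB p f g v w : isE p f v -> isE p g w ->
  isE p (fun z => f z - g z) (v - w).
Proof. by move=> fv gw; apply: isED => //; exact: isEN. Qed.

(** Multiplying the Gamma(p) density by z^q tilts it to an unnormalised Gamma(p + q) density.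
    Constants, moments and the exponential moments of [llr] all come from here. *)
Lemma isE_exp p q : 0 < p -> 0 < p + q ->
  isE p (fun z => expR (q * ln z)) (expR (lgam (p + q) - lgam p)).
Proof.
move=> p0 pq; have e z : ((expR (- lgam p))%:E * (gker (p + q - 1) z)%:E =
    (gpdf p z * expR (q * ln z))%:E)%E.
  rewrite -EFinM /gpdf -mulrA; congr (_ * _)%:E.
  by rewrite (addrAC p q) (gkerD (p - 1) q) mulrC.
have i : mu.-integrable pos (fun z => (gker (p + q - 1) z)%:E).
  by apply: integrable_gker; lra.
split.
  by apply: integrable_pos_ext (integrableZl _ (expR (- lgam p)) i).
rewrite addrC expRD (lgamK pq) EFinM (GammaE pq) -(integralZl mpos i).
by apply: eq_integral => z _; rewrite -e.
Qed.

Lemma isE_cst p c : 0 < p -> isE p (fun=> c) c.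
Proof.
move=> p0; have := @isE_exp p 0 p0; rewrite addr0 => /(_ p0).
rewrite subrr expR0 => /(isEZ c); rewrite mulr1.
by apply: isE_ext => z _; rewrite mul0r expR0 mulr1.
Qed.

Lemma Ex_cst p c : 0 < p -> (Ex p (fun=> c%:E) = c%:E)%E.
Proof. by move=> p0; exact: isE_Ex (isE_cst c p0). Qed.

Lemma isE_X p : 0 < p -> isE p (fun z => z) p.
Proof.
move=> p0; have := @isE_exp p 1 p0; rewrite expRD lgamK; last lra.
rewrite Gamma_rec// expRN lgamK// mulfK ?gt_eqF ?Gamma_gt0// => /(_ _)/isE_ext.
by apply=> [z z0|]; [rewrite mul1r lnK|lra].
Qed.

Lemma isE_pow p n : 0 < p ->
  isE p (fun z => z ^+ n) (\prod_(i < n) (p + i%:R)).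
Proof.
move=> p0; have := @isE_exp p n%:R p0; rewrite expRD.
have pn : 0 < p + n%:R by rewrite ltr_wpDr.
move=> /(_ pn); rewrite lgamK//.
suff -> : Gam (p + n%:R) = (\prod_(i < n) (p + i%:R)) * Gam p.
  rewrite expRN lgamK// mulfK ?gt_eqF ?Gamma_gt0// => /isE_ext.
  by apply => z z0; rewrite expRM_natl lnK.
elim: n {pn} => [|n ih]; first by rewrite big_ord0 addr0 mul1r.
rewrite big_ord_recr/= -addn1 natrD addrA Gamma_rec ?ih; last by rewrite ltr_wpDr.
by ring.
Qed.

End Expectation.

(** * Continuity in the parameter, convexity of log Gamma, and rescaling *)

Section GammaAnalysis.
Context {R : realType}.
Local Notation mu := (@lebesgue_measure R).
Local Notation pos := (`]0%R, +oo[%classic : set (measurableTypeR R)).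
Implicit Types (p q a b c k v w z : R) (f g : R -> R) (F G : R -> \bar R).

Lemma expR_interp a b p l : a <= p <= b -> expR (p * l) <= expR (a * l) + expR (b * l) :> R.
Proof.
move=> /andP[ap pb]; have [l0|l0] := leP 0 l.
  by rewrite -[leLHS]add0r lerD ?expR_ge0// ler_expR ler_wpM2r.
by rewrite -[leLHS]addr0 lerD ?expR_ge0// ler_expR ler_wnM2r// ltW.
Qed.

(** Gives a single integrable majorant for all parameters in [a, b]. *)
Lemma gker_interp a b p z : a <= p <= b -> gker p z <= gker a z + gker b z.
Proof.
by move=> h; rewrite /gker !expRD -mulrDl ler_wpM2r ?expR_ge0// expR_interp.
Qed.

Lemma cvg_gker (u : nat -> R) p z : u n @[n --> \oo] --> p ->
  gker (u n) z @[n --> \oo] --> gker p z.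
Proof.
move=> up; rewrite /gker; apply: continuous_cvg; first exact: continuous_expR.
by apply: cvgB; [apply: cvgM => //; exact: cvg_cst|exact: cvg_cst].
Qed.

Let Jint p F := (\int[mu]_(z in pos) ((gker (p - 1) z)%:E * F z))%E.

Let cvg_Jint (u : nat -> R) p (F_ : nat -> R -> \bar R) F z0 :
  0 < p -> u n @[n --> \oo] --> p ->
  (forall n, measurable_fun [set: R] (F_ n)) -> measurable_fun [set: R] F ->
  (forall n z, (0 < z)%R -> 0 <= F_ n z <= 1)%E ->
  (forall z, 0 < z -> z != z0 -> F_ n z @[n --> \oo] --> F z) ->
  Jint (u n) (F_ n) @[n --> \oo] --> Jint p F.
Proof.
move=> p0 up mF_ mF F01 cF.
(* From some index on, the parameters lie in [p / 2, 2 p]; the sequence is shifted by that index so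
   that one majorant serves all its terms. *)
have [N _ hN] : \forall n \near \oo, p / 2 <= u n <= p * 2.
  near=> n; apply/andP; split; near: n.
    by apply: (cvgr_ge p) => //; lra.
  by apply: (cvgr_le p) => //; lra.
have {}hN n : p / 2 <= u (n + N)%N <= p * 2 by apply: hN; rewrite /= leq_addl.
rewrite -(cvg_shiftn N).
have up' : u (n + N)%N @[n --> \oo] --> p by rewrite (cvg_shiftn N u).
have cF' z : 0 < z -> z != z0 -> F_ (n + N)%N z @[n --> \oo] --> F z.
  by move=> z1 z2; rewrite (cvg_shiftn N (fun n => F_ n z)); exact: cF.
have mgk q G : measurable_fun [set: R] G ->
    measurable_fun pos (fun z => (gker q z)%:E * G z)%E.
  by move=> mG; apply: emeasurable_funM; [exact: emeasurable_gker|exact: measurable_funTS].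
have ae1 : {ae mu, forall z, pos z ->
    ((gker (u (n + N)%N - 1) z)%:E * F_ (n + N)%N z)%E @[n --> \oo] -->
    ((gker (p - 1) z)%:E * F z)%E}.
  exists [set z0]; split => //; first by rewrite lebesgue_measure_set1.
  move=> z /=; apply: contra_notP => /eqP zz0; rewrite in_itv/= andbT => z1.
  apply: cvgeM; last exact: cF'.
    by rewrite /mule_def; case: (F z) => //; rewrite gt_eqF ?gker_gt0.
  by apply: cvg_EFin; [exact: nearW|apply: cvg_gker; apply: cvgB => //; exact: cvg_cst].
have ae2 : {ae mu, forall z, forall n, pos z ->
    `|(gker (u (n + N)%N - 1) z)%:E * F_ (n + N)%N z| <=
    (gker (p / 2 - 1) z)%:E + (gker (p * 2 - 1) z)%:E}%E.
  apply: aeW => z n; rewrite posRE => zp.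
  have /andP[h0 h1] := F01 (n + N)%N z zp.
  rewrite gee0_abs; last by rewrite mule_ge0// lee_fin gker_ge0.
  apply: (@le_trans _ _ (gker (u (n + N)%N - 1) z)%:E).
    by rewrite -[leRHS]mule1 lee_wpmul2l// lee_fin gker_ge0.
  by rewrite -EFinD lee_fin; apply: gker_interp; have := hN n; lra.
have ig : mu.-integrable pos
    (fun z => (gker (p / 2 - 1) z)%:E + (gker (p * 2 - 1) z)%:E)%E.
  by apply: integrableD => //; apply: integrable_gker; lra.
have [_ _ h] := dominated_convergence mpos
  (fun n => mgk (u (n + N)%N - 1) _ (mF_ (n + N)%N)) (mgk (p - 1) _ mF) ae1 ig ae2.
exact: h.
Unshelve. all: by end_near. Qed.

Lemma cvg_lgam (u : nat -> R) p : 0 < p -> u n @[n --> \oo] --> p ->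
  lgam (u n) @[n --> \oo] --> lgam p.
Proof.
move=> p0 up.
have h : gint (u n - 1) @[n --> \oo] --> gint (p - 1).
  have := @cvg_Jint u p (fun _ _ => 1%E) (cst 1%E) 0 p0 up.
  rewrite (_ : (fun n => Jint (u n) _) = (fun n => gint (u n - 1))).
    rewrite (_ : Jint p _ = gint (p - 1)); first by apply => // *; rewrite ?lee01 ?lexx//; exact: cvg_cst.
    by apply: eq_integral => z _; rewrite mule1.
  by apply/funext => n; apply: eq_integral => z _; rewrite mule1.
rewrite lgam.unlock; apply: continuous_cvg.
  by apply: continuous_ln; exact: Gamma_gt0.
rewrite Gamma_fineE (_ : (fun n => _) = fun n => fine (gint (u n - 1))); last first.
  by apply/funext => n; rewrite Gamma_fineE.
by apply: fine_cvg; rewrite fineK//; apply: gint_fin; lra.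
Qed.

Lemma continuous_lgam p : 0 < p -> {for p, continuous (@lgam R)}.
Proof.
move=> p0; apply/continuous_withinNx/cvgr_dnbhsP => u [_ up].
exact: cvg_lgam.
Qed.

Let ExJ p F : measurable_fun [set: R] F -> (forall z, (0 < z)%R -> 0 <= F z)%E ->
  Ex p F = ((expR (- lgam p))%:E * Jint p F)%E.
Proof.
move=> mF F0; rewrite /Ex /Jint -ge0_integralZl_EFin ?expR_ge0//.
- by apply: eq_integral => z _; rewrite muleA -EFinM.
- by move=> z; rewrite posRE => zp; rewrite mule_ge0 ?F0// lee_fin gker_ge0.
- by apply: emeasurable_funM; [exact: emeasurable_gker|exact: measurable_funTS].
Qed.

(** Dominated convergence with a moving law. Convergence may fail at one point [z0] because the
    payoff of a stopped walk jumps when an observation puts it exactly on the boundary. *)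
Lemma cvg_Ex (u : nat -> R) p (F_ : nat -> R -> \bar R) F z0 :
  0 < p -> u n @[n --> \oo] --> p ->
  (forall n, measurable_fun [set: R] (F_ n)) -> measurable_fun [set: R] F ->
  (forall n z, (0 < z)%R -> 0 <= F_ n z <= 1)%E ->
  (forall z, (0 < z)%R -> 0 <= F z)%E ->
  (forall z, 0 < z -> z != z0 -> F_ n z @[n --> \oo] --> F z) ->
  Ex (u n) (F_ n) @[n --> \oo] --> Ex p F.
Proof.
move=> p0 up mF_ mF F01 F0 cF; rewrite ExJ//.
rewrite (_ : (fun n => Ex _ _) = (fun n => (expR (- lgam (u n)))%:E * Jint (u n) (F_ n))%E); last first.
  by apply/funext => n; rewrite ExJ// => z zp; have /andP[] := F01 n z zp.
apply: cvgeM; last exact: cvg_Jint cF.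
  by rewrite /mule_def; case: (Jint p F) => //; rewrite gt_eqF ?expR_gt0.
apply: cvg_EFin; first exact: nearW.
apply: continuous_cvg; first exact: continuous_expR.
by apply: cvgN; exact: cvg_lgam.
Qed.

Lemma lgamS p : 0 < p -> lgam (p + 1) = ln p + lgam p.
Proof. by move=> p0; rewrite lgam.unlock Gamma_rec// lnM// posrE ?Gamma_gt0. Qed.

Let lgam_mid_le a b : 0 < a -> 0 < b ->
  lgam ((a + b) / 2) *+ 2 <= lgam a + lgam b.
Proof.
move=> a0 b0; set m := (a + b) / 2; have m0 : 0 < m by rewrite /m; lra.
(* AM-GM under the integral, with the weights that balance both sides *)
pose l := (lgam b - lgam a) / 2.
have i1 := @isE_exp R m (a - m) m0 ltac:(lra).
have i2 := @isE_exp R m (b - m) m0 ltac:(lra).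
have i := isED (isEZ (expR l) i1) (isEZ (expR (- l)) i2).
have : (Ex m (fun=> 2%:E) <= (expR l * expR (lgam (m + (a - m)) - lgam m) +
    expR (- l) * expR (lgam (m + (b - m)) - lgam m))%:E)%E.
  rewrite -(isE_Ex i); apply: le_Ex => z z0; first by rewrite lee_fin.
  rewrite lee_fin -!expRD (_ : (b - m) = - (a - m)); last by rewrite /m; field.
  have h (x : R) : 2 <= expR x + expR (- x).
    by have := expR_ge1Dx x; have := expR_ge1Dx (- x); lra.
  by have := h (l + (a - m) * ln z); rewrite opprD mulNr.
rewrite (Ex_cst _ m0) lee_fin -!expRD.
rewrite (_ : l + _ = (lgam a + lgam b) / 2 - lgam m); last first.
  by rewrite (addrC m) subrK /l; lra.
rewrite (_ : - l + _ = (lgam a + lgam b) / 2 - lgam m); last first.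
  by rewrite (addrC m) subrK /l; lra.
move=> h; have : 1 <= expR ((lgam a + lgam b) / 2 - lgam m) by lra.
by rewrite -[leLHS]expR0 ler_expR; lra.
Qed.

(* Shifting the arguments by one and using Gamma (x + 1) = x Gamma x turns the
   AM-GM gap of [a] and [b] into strictness. *)
Lemma lgam_mid_lt a b : 0 < a -> 0 < b -> a != b ->
  lgam ((a + b) / 2) *+ 2 < lgam a + lgam b.
Proof.
move=> a0 b0 ab; set m := (a + b) / 2; have m0 : 0 < m by rewrite /m; lra.
have := @lgam_mid_le (a + 1) (b + 1) ltac:(lra) ltac:(lra).
rewrite (_ : (a + 1 + (b + 1)) / 2 = m + 1); last by rewrite /m; lra.
rewrite !lgamS// mulrnDl => h.
have abm : a * b < m * m.
  rewrite -subr_gt0 (_ : _ - _ = ((a - b) / 2) ^+ 2); last by rewrite /m; field.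
  by rewrite exprn_even_gt0//= mulf_neq0 ?subr_eq0// invr_eq0.
have : ln (a * b) < ln (m * m) by rewrite ltr_ln // posrE mulr_gt0.
rewrite (lnM a0 b0) (lnM m0 m0) => h2; move: h; rewrite !mulr2n; lra.
Qed.

Lemma Ex_isE p g v : measurable_fun [set: R] g -> (forall z, 0 < z -> 0 <= g z) ->
  Ex p (fun z => (g z)%:E) = v%:E -> isE p g v.
Proof.
move=> mg g0 e; have e' : (\int[mu]_(z in pos) (gpdf p z * g z)%:E)%E = v%:E.
  by rewrite -e; apply: eq_integral => z _; rewrite EFinM.
split => //; apply/integrableP; split.
  apply: (@eq_measurable_fun _ _ _ _ _ (fun z => (gpdf p z)%:E * (g z)%:E)%E) => //.
  by apply: emeasurable_gpdfM; exact/measurable_EFinP.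
rewrite (_ : integral _ _ _ = v%:E) ?ltry// -e'; apply: eq_integral => z.
by rewrite inE posRE => z0; rewrite gee0_abs// lee_fin mulr_ge0 ?g0 ?gpdf_ge0.
Qed.

(* The density ratio of [expR (- e) * z] and [z] under Gamma(p, 1). *)
Definition scal_ratio p e z : R := expR (e * p - z * (expR e - 1)).

Lemma measurable_scal_ratio p e : measurable_fun [set: R] (scal_ratio p e).
Proof.
apply: measurableT_comp; first exact: measurable_expR.
by apply: measurable_funB => //; exact: measurable_funM.
Qed.

(** Rescaling one observation by [expR e] moves its log-likelihood ratio by (th - theta0) e, see
    [llr_scal], and the change of law is paid by [scal_ratio]. This is the mechanism behind
    [shift_comparison]. *)
Lemma Ex_scal p e F : measurable_fun [set: R] F -> (forall z, 0 <= F z)%E ->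
  Ex p F = Ex p (fun z => (scal_ratio p e z)%:E * F (expR e * z)%R)%E.
Proof.
move=> mF F0; rewrite /Ex.
have mf : measurable_fun [set: R] (fun z => (gpdf p z)%:E * F z)%E.
  by apply: emeasurable_funM => //; apply/measurable_EFinP; exact: measurable_gpdf.
have f0 z : (0 <= (gpdf p z)%:E * F z)%E by rewrite mule_ge0// lee_fin gpdf_ge0.
rewrite (integral_scal (expR_gt0 e) mf f0) -ge0_integralZl_EFin ?expR_ge0//; first last.
- apply: measurable_funTS; apply: (measurableT_comp mf).
  exact: measurable_funM.
apply: eq_integral => z; rewrite inE posRE => z0.
rewrite !muleA -!EFinM; congr (_%:E * _)%E.
rewrite /gpdf /gker /scal_ratio -!expRD lnM ?posrE ?expR_gt0// expRK.
by congr expR; ring.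
Qed.

Lemma isE_scal_ratio p e : 0 < p -> isE p (scal_ratio p e) 1.
Proof.
move=> p0; apply: Ex_isE; first exact: measurable_scal_ratio.
  by move=> z _; exact: expR_ge0.
have := @Ex_scal p e (cst 1%E) (@measurable_cst _ _ _ _ _ _) (fun=> lee01).
rewrite (Ex_cst _ p0) => ->.
by apply: eq_Ex => z _; rewrite mule1.
Qed.

(** The Laplace transform is read off from the fact that the density ratio for e = ln (1 + s) has
    mean 1. *)
Lemma isE_mgf p s : 0 < p -> 0 <= s ->
  isE p (fun z => expR (- (s * z))) (expR (- (p * ln (1 + s)))).
Proof.
move=> p0 s0; have s1 : 0 < 1 + s by lra.
have := isEZ (expR (- (p * ln (1 + s)))) (isE_scal_ratio (ln (1 + s)) p0).
rewrite mulr1; apply: isE_ext => z z0.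
rewrite /scal_ratio lnK ?posrE// -expRD; congr expR; ring.
Qed.

Lemma isE_scal_ratio2 p e : 0 < p -> 0 <= e ->
  isE p (fun z => scal_ratio p e z ^+ 2)
    (expR (p * (2 * e - ln (2 * expR e - 1)))).
Proof.
move=> p0 e0; have e1 : 1 <= expR e by rewrite -[leLHS]expR0 ler_expR.
have := isEZ (expR (2 * e * p)) (@isE_mgf p (2 * (expR e - 1)) p0 ltac:(lra)).
rewrite -expRD (_ : 1 + _ = 2 * expR e - 1); last by ring.
rewrite (_ : 2 * e * p - _ = p * (2 * e - ln (2 * expR e - 1))); last by ring.
apply: isE_ext => z z0; rewrite /scal_ratio -expRM_natl -expRD; congr expR.
by ring.
Qed.

Lemma scal_ratio_le p e z : 0 <= e -> 0 < z -> scal_ratio p e z <= expR (e * p).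
Proof.
move=> e0 z0; rewrite ler_expR gerBl mulr_ge0 ?(ltW z0)// subr_ge0.
by rewrite -[leLHS]expR0 ler_expR.
Qed.

End GammaAnalysis.

(** * The log-likelihood ratio and the stopped chain *)

Section LogLikelihood.
Context {R : realType}.
Variable theta0 : R.
Hypothesis theta0_gt0 : 0 < theta0.
Implicit Types (p q a b c k v w x y z th : R).

Definition llr th z : R := (th - theta0) * ln z + (lgam theta0 - lgam th).

Lemma measurable_fun_llr d (T : measurableType d) (f g : T -> R) :
  measurable_fun setT f -> measurable_fun setT g ->
  measurable_fun setT (fun t => llr (f t) (g t)).
Proof.
move=> mf mg; apply: measurable_funD.
  apply: measurable_funM; first exact: measurable_funB.
  by apply: measurableT_comp => //; exact: measurable_ln.
by apply: measurable_funB => //; exact: measurable_fun_lgam.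
Qed.

Lemma measurable_llr th : measurable_fun [set: R] (llr th).
Proof. exact: measurable_fun_llr. Qed.

Lemma gpdf_llr th z : gpdf th z * expR (- llr th z) = gpdf theta0 z.
Proof.
by rewrite /gpdf /gker /llr -!expRD; congr expR; ring.
Qed.

Lemma llr_scal th e z : 0 < z -> llr th (expR e * z) = llr th z + (th - theta0) * e.
Proof.
by move=> z0; rewrite /llr lnM ?posrE ?expR_gt0// expRK; ring.
Qed.

Definition llr_mgf p th c : R :=
  lgam (p + c * (th - theta0)) - lgam p + c * (lgam theta0 - lgam th).

Lemma isE_llr p th c : 0 < p -> 0 < p + c * (th - theta0) ->
  isE p (fun z => expR (c * llr th z)) (expR (llr_mgf p th c)).
Proof.
move=> p0 pc; rewrite /llr_mgf expRD mulrC.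
apply: isE_ext (isEZ (expR (c * (lgam theta0 - lgam th))) (isE_exp p0 pc)).
by move=> z _; rewrite /llr -expRD; congr expR; ring.
Qed.

Lemma cvg_llr_mgf (f g : R -> R) y c : 0 < y -> 0 < y + c * (y - theta0) ->
  f th @[th --> y] --> y -> g th @[th --> y] --> y ->
  llr_mgf (f th) (g th) c @[th --> y] --> llr_mgf y y c.
Proof.
move=> y0 yc fy gy; rewrite /llr_mgf.
have clg (u : R -> R) (l : R) : 0 < l -> u th @[th --> y] --> l ->
    lgam (u th) @[th --> y] --> lgam l.
  by move=> l0 ul; apply: continuous_cvg => //; exact: continuous_lgam.
apply: cvgD.
  apply: cvgB; last exact: clg.
  apply: clg => //; apply: cvgD => //; apply: cvgM; first exact: cvg_cst.
  by apply: cvgB => //; exact: cvg_cst.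
apply: cvgM; first exact: cvg_cst.
by apply: cvgB; [exact: cvg_cst|exact: clg].
Qed.

(** The exponent -1/2 moves the parameter y to the midpoint of y and theta0, so this is strict
    midpoint convexity of log Gamma: the Hellinger affinity of two distinct laws is below 1. *)
Lemma llr_mgf_half_lt0 y : 0 < y -> y != theta0 -> llr_mgf y y (- 2^-1) < 0.
Proof.
move=> y0 yt; rewrite /llr_mgf (_ : y + _ = (y + theta0) / 2); last by field.
by have := lgam_mid_lt y0 theta0_gt0 yt; rewrite mulr2n; lra.
Qed.

Lemma isE_le p (f g : R -> R) v w : (forall z, 0 < z -> f z <= g z) ->
  isE p f v -> isE p g w -> v <= w.
Proof.
move=> fg fv gw; have := isEB gw fv => -[_ h].
rewrite -subr_ge0 -lee_fin -h; apply: integral_ge0 => z; rewrite posRE => z0.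
by rewrite lee_fin mulr_ge0 ?gpdf_ge0// subr_ge0 fg.
Qed.

(** From 1 - llr/2 <= e^{-llr/2} one gets 1 + c llr >= 1 + 2 c (1 - e^{-llr/2}). The affinity bound
    thus yields a positive drift in exponential form, with no relative entropy to compute. *)
Lemma isE_llr_ge p th c v w : 0 < p -> 0 <= c ->
  isE p (fun z => expR (- 2^-1 * llr th z)) v ->
  isE p (fun z => expR (c * llr th z)) w -> 1 + 2 * c * (1 - v) <= w.
Proof.
move=> p0 c0 hv hw.
have h := isED (isE_cst (1 + 2 * c) p0) (isEZ (- (2 * c)) hv).
rewrite (_ : 1 + 2 * c * (1 - v) = 1 + 2 * c + - (2 * c) * v); last by ring.
apply: isE_le h hw => z z0; apply: le_trans (expR_ge1Dx _).
have := expR_ge1Dx (- 2^-1 * llr th z) => h.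
by have := ler_wpM2l c0 h; lra.
Qed.

(* [c] is small enough for the exponential moment of order [2 * c]. *)
Lemma llr_local y : 0 < y -> y != theta0 ->
  exists c rho B, [/\ 0 < c, 0 < rho, rho < 1, 0 < B &
   \forall th \near y, [/\ 0 < th,
     exists2 v, v <= rho & isE th (fun z => expR (- 2^-1 * llr th z)) v,
     exists2 v, v <= rho & isE y (fun z => expR (- 2^-1 * llr th z)) v,
     exists2 v, 1 + 2 * c * (1 - rho) <= v & isE th (fun z => expR (c * llr th z)) v &
     exists2 v, v <= B & isE th (fun z => expR (2 * c * llr th z)) v]].
Proof.
move=> y0 yt; pose c := y / (4 * (`|y - theta0| + y)).
have n0 : 0 < `|y - theta0| + y by rewrite ltr_wpDl.
have c0 : 0 < c by rewrite divr_gt0// mulr_gt0.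
have hc : 2 * c * `|y - theta0| <= y / 2.
  have : 2 * c * (`|y - theta0| + y) = y / 2 by rewrite /c; field; lra.
  by move <-; rewrite ler_wpM2l ?lerDl//; lra.
have yc k : 0 <= k <= 2 * c -> 0 < y + k * (y - theta0).
  move=> /andP[k0 k1]; have : `|k * (y - theta0)| <= y / 2.
    by rewrite normrM (ger0_norm k0) (le_trans _ hc)// ler_wpM2r.
  by rewrite ler_norml => /andP[h _]; lra.
have yh : 0 < y + (- 2^-1) * (y - theta0) by move: theta0_gt0; lra.
pose m := llr_mgf y y (- 2^-1).
have m0 : m < 0 by exact: llr_mgf_half_lt0.
(* Since m < m / 2 < 0, the strict bound at y survives in a neighbourhood; the [+ 1] in [B] plays
   the same part. Of the two bounds of order -1/2, the one under the moving law serves the adaptive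
   chain, and the one under the fixed law of y serves power one. *)
exists c, (expR (m / 2)), (expR (llr_mgf y y (2 * c) + 1)).
split; rewrite ?expR_gt0//; first by rewrite expR_lt1; lra.
have cy : th @[th --> y] --> y by exact: cvg_id.
have cc : y @[th --> y] --> y by exact: cvg_cst.
have lin k : th + k * (th - theta0) @[th --> y] --> y + k * (y - theta0).
  apply: cvgD => //; apply: cvgM; first exact: cvg_cst.
  by apply: cvgB => //; exact: cvg_cst.
have linc k : y + k * (th - theta0) @[th --> y] --> y + k * (y - theta0).
  apply: cvgD => //; apply: cvgM; first exact: cvg_cst.
  by apply: cvgB => //; exact: cvg_cst.
near=> th.
have th0 : 0 < th by near: th; exact: (cvgr_gt y cy).
have hv : isE th (fun z => expR (- 2^-1 * llr th z)) (expR (llr_mgf th th (- 2^-1))).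
  by apply: isE_llr => //; near: th; exact: (cvgr_gt _ (lin _)).
have hvm : expR (llr_mgf th th (- 2^-1)) <= expR (m / 2).
  rewrite ler_expR; near: th; apply: (cvgr_le m); last by lra.
  exact: (cvg_llr_mgf _ _ cy cy).
split => //.
- by exists (expR (llr_mgf th th (- 2^-1))).
- exists (expR (llr_mgf y th (- 2^-1))).
    rewrite ler_expR; near: th; apply: (cvgr_le m); last by lra.
    exact: (cvg_llr_mgf _ _ cc cy).
  by apply: isE_llr => //; near: th; exact: (cvgr_gt _ (linc _)).
- have hw : isE th (fun z => expR (c * llr th z)) (expR (llr_mgf th th c)).
    apply: isE_llr => //; near: th; apply: (cvgr_gt _ (lin _)).
    by apply: yc; lra.
  exists (expR (llr_mgf th th c)) => //.
  apply: le_trans (isE_llr_ge th0 (ltW c0) hv hw).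
  by rewrite lerD2l ler_wpM2l ?lerB//; lra.
- exists (expR (llr_mgf th th (2 * c))).
    rewrite ler_expR; near: th; apply: (cvgr_le (llr_mgf y y (2 * c))); last by lra.
    by apply: (cvg_llr_mgf _ _ cy cy) => //; apply: yc; lra.
  apply: isE_llr => //; near: th; apply: (cvgr_gt _ (lin _)).
  by apply: yc; lra.
Unshelve. all: by end_near. Qed.

End LogLikelihood.

(* The state is [(th, x)]: the current estimate and the distance that remains to
   the boundary, with [phi] the payoff on crossing it.  The observations follow
   Gamma(q th, 1): [q = id] is the predictable sampling law under which [Lambda]
   is the likelihood ratio, a constant [q] is an i.i.d. law, and [kap = 0] freezes
   the estimate. *)
Section StoppedChain.
Context {R : realType}.
Variable theta0 : R.
Variables (q : R -> R) (kap : nat -> R) (phi : R -> R).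
Implicit Types (m n : nat) (s : R * R) (x y z th : R).
Local Notation llr := (llr theta0).

Definition chain_step n s z : R * R :=
  (s.1 + kap n * (z - s.1), s.2 - llr s.1 z).

(** The distance is tested before the number of steps, and an exhausted count pays 0; the values
    therefore increase with m. The clock n selects the gain [kap n]. *)
Fixpoint value_upto m n s : \bar R :=
  if s.2 <= 0 then (phi s.2)%:E else
  if m is m'.+1 then Ex (q s.1) (fun z => value_upto m' n.+1 (chain_step n s z)) else 0%E.

Definition value n s : \bar R := limn (fun m => value_upto m n s).

Hypothesis mq : measurable_fun [set: R] q.
Hypothesis mphi : measurable_fun [set: R] phi.
Hypothesis phi_ge0 : forall x, x <= 0 -> 0 <= phi x.

Lemma value_upto_stop m n s : s.2 <= 0 -> value_upto m n s = (phi s.2)%:E.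
Proof. by case: m => [|m] /= ->. Qed.

Lemma value_upto_go m n s : 0 < s.2 ->
  value_upto m.+1 n s = Ex (q s.1) (fun z => value_upto m n.+1 (chain_step n s z)).
Proof. by move=> x0 /=; rewrite leNgt x0. Qed.

Lemma value_upto_go0 n s : 0 < s.2 -> value_upto 0 n s = 0%E.
Proof. by move=> x0 /=; rewrite leNgt x0. Qed.

Lemma value_upto_ge0 m n s : (0 <= value_upto m n s)%E.
Proof.
elim: m n s => [|m ih] n s; have [x0|x0] := leP s.2 0.
- by rewrite value_upto_stop// lee_fin phi_ge0.
- by rewrite value_upto_go0.
- by rewrite value_upto_stop// lee_fin phi_ge0.
- by rewrite value_upto_go//; apply: Ex_ge0 => z _; exact: ih.
Qed.

Lemma measurable_fun_step n d (T : measurableType d) (f : T -> R * R) (g : T -> R) :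
  measurable_fun setT f -> measurable_fun setT g ->
  measurable_fun setT (fun t => chain_step n (f t) (g t)).
Proof.
move=> mf mg.
have mf1 : measurable_fun setT (fun t => (f t).1) by exact: measurableT_comp.
have mf2 : measurable_fun setT (fun t => (f t).2) by exact: measurableT_comp.
apply: measurable_fun_pair => /=.
  apply: measurable_funD => //; apply: measurable_funM => //.
  exact: measurable_funB.
by apply: measurable_funB => //; exact: measurable_fun_llr.
Qed.

Lemma measurable_step n s : measurable_fun [set: R] (chain_step n s).
Proof. exact: measurable_fun_step. Qed.

Lemma measurable_value_upto m n : measurable_fun [set: R * R] (value_upto m n).
Proof.
have m2 : measurable_fun [set: R * R] (fun s : R * R => s.2) by exact: measurable_snd.
have m1 : measurable_fun [set: R * R] (fun s : R * R => s.1) by exact: measurable_fst.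
elim: m n => [|m ih] n.
  apply: measurable_fun_ifT => //; first exact: measurable_fun_ler.
  by apply/measurable_EFinP; exact: measurableT_comp.
apply: measurable_fun_ifT; first exact: measurable_fun_ler.
  by apply/measurable_EFinP; exact: measurableT_comp.
apply: (@measurable_int_pos R _ _ (fun u : (R * R) * R =>
  (gpdf (q u.1.1) u.2)%:E * value_upto m n.+1 (chain_step n u.1 u.2))%E); last first.
  by move=> u; rewrite mule_ge0 ?value_upto_ge0// lee_fin gpdf_ge0.
apply: emeasurable_funM.
  apply/measurable_EFinP; apply: measurable_fun_gpdf => //.
  apply: (measurableT_comp mq); apply: (measurableT_comp m1).
  exact: measurable_fst.
apply: (measurableT_comp (ih n.+1)); apply: measurable_fun_step.
  exact: measurable_fst.
exact: measurable_snd.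
Qed.

Lemma measurable_value_upto_step m n k s :
  measurable_fun [set: R] (fun z => value_upto m n (chain_step k s z)).
Proof. exact: (measurableT_comp (measurable_value_upto m n) (measurable_step k s)). Qed.

Lemma le_value_uptoS m n s : (value_upto m n s <= value_upto m.+1 n s)%E.
Proof.
elim: m n s => [|m ih] n s; have [x0|x0] := leP s.2 0.
- by rewrite !value_upto_stop.
- by rewrite value_upto_go0// value_upto_ge0.
- by rewrite !value_upto_stop.
- by rewrite !value_upto_go//; apply: le_Ex => z _; [exact: value_upto_ge0|exact: ih].
Qed.

Lemma nd_value_upto n s : nondecreasing_seq (fun m => value_upto m n s).
Proof. by apply/nondecreasing_seqP => m; exact: le_value_uptoS. Qed.

Lemma cvg_value_upto n s : value_upto m n s @[m --> \oo] --> value n s.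
Proof. by apply: ereal_nondecreasing_is_cvgn; exact: nd_value_upto. Qed.

Lemma le_value_upto_value m n s : (value_upto m n s <= value n s)%E.
Proof.
apply: (lime_ge (cvgP _ (@cvg_value_upto n s))); near=> m'.
by apply: nd_value_upto; near: m'; exact: nbhs_infty_ge.
Unshelve. all: by end_near. Qed.

Lemma value_ge0 n s : (0 <= value n s)%E.
Proof. exact: le_trans (value_upto_ge0 0 n s) (le_value_upto_value 0 n s). Qed.

Lemma value_le n s (b : \bar R) : (forall m, value_upto m n s <= b)%E -> (value n s <= b)%E.
Proof.
by move=> h; apply: (lime_le (cvgP _ (@cvg_value_upto n s))); exact: nearW.
Qed.

Lemma value_stop n s : s.2 <= 0 -> value n s = (phi s.2)%:E.
Proof.
move=> x0; rewrite /value (_ : (fun m => _) = fun=> (phi s.2)%:E) ?lim_cst//.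
by apply/funext => m; rewrite value_upto_stop.
Qed.

Lemma measurable_value n : measurable_fun [set: R * R] (value n).
Proof.
apply: (emeasurable_fun_cvg (fun m => value_upto m n)).
  by move=> m; exact: measurable_value_upto.
by move=> s _; exact: cvg_value_upto.
Qed.

Lemma measurable_value_step n k s :
  measurable_fun [set: R] (fun z => value n (chain_step k s z)).
Proof. exact: (measurableT_comp (measurable_value n) (measurable_step k s)). Qed.

Lemma cvg_Ex_nd p (F : nat -> R -> \bar R) (G : R -> \bar R) :
  (forall m, measurable_fun [set: R] (F m)) -> (forall m z, 0 <= F m z)%E ->
  (forall z, nondecreasing_seq (F ^~ z)) ->
  (forall z, F m z @[m --> \oo] --> G z) ->
  Ex p (F m) @[m --> \oo] --> Ex p G.
Proof.
move=> mF F0 ndF FG.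
have -> : Ex p G = (\int[lebesgue_measure]_(z in `]0%R, +oo[)
    limn (fun m => (gpdf p z)%:E * F m z))%E.
  apply: eq_integral => z _; apply/esym/cvg_lim => //.
  by apply: cvgeZl => //; exact: FG.
apply: cvg_monotone_convergence => //.
- by move=> m; exact: emeasurable_gpdfM.
- by move=> m z _; rewrite mule_ge0// lee_fin gpdf_ge0.
- by move=> z _ a b ab; rewrite lee_wpmul2l ?ndF// lee_fin gpdf_ge0.
Qed.

Lemma value_go n s : 0 < s.2 ->
  value n s = Ex (q s.1) (fun z => value n.+1 (chain_step n s z)).
Proof.
move=> x0; apply: (cvg_unique _ (@cvg_value_upto n s)) => //.
rewrite /= -(cvg_shiftS (fun m => value_upto m n s)).
rewrite (_ : (fun m => _) = fun m => Ex (q s.1) (fun z => value_upto m n.+1 (chain_step n s z))).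
  apply: cvg_Ex_nd => //.
  - by move=> m; exact: measurable_value_upto_step.
  - by move=> m z; exact: value_upto_ge0.
  - by move=> z; exact: nd_value_upto.
  - by move=> z; exact: cvg_value_upto.
by apply/funext => m; rewrite value_upto_go.
Qed.

Hypothesis q_gt0 : forall th, 0 < th -> 0 < q th.
Hypothesis kap_lt1 : forall n, 0 <= kap n < 1.
Hypothesis phi_le1 : forall x, x <= 0 -> phi x <= 1.

Lemma step_gt0 n s z : 0 < s.1 -> 0 < z -> 0 < (chain_step n s z).1.
Proof.
move=> th0 z0 /=; have /andP[k0 k1] := kap_lt1 n.
rewrite (_ : _ + _ = (1 - kap n) * s.1 + kap n * z); last by ring.
by rewrite ltr_pwDl// ?mulr_gt0// ?subr_gt0// mulr_ge0// ltW.
Qed.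

Lemma value_upto_le1 m n s : 0 < s.1 -> (value_upto m n s <= 1)%E.
Proof.
elim: m n s => [|m ih] n s th0; have [x0|x0] := leP s.2 0.
- by rewrite value_upto_stop// lee_fin phi_le1.
- by rewrite value_upto_go0.
- by rewrite value_upto_stop// lee_fin phi_le1.
rewrite value_upto_go// -(Ex_cst 1 (q_gt0 th0)); apply: le_Ex => z z0.
  exact: value_upto_ge0.
by apply: ih; exact: step_gt0.
Qed.

Lemma value_le1 n s : 0 < s.1 -> (value n s <= 1)%E.
Proof. by move=> th0; apply: value_le => m; exact: value_upto_le1. Qed.

End StoppedChain.

(** * Superharmonic bounds for values and overshoots *)

Section Domination.
Context {R : realType}.
Implicit Types (p c v w x y z th : R) (f g : R -> R) (F G : R -> \bar R).

Lemma Ex_addE p F g v : measurable_fun [set: R] F ->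
  (forall z, (0 < z)%R -> 0 <= F z)%E -> (forall z, 0 < z -> 0 <= g z) ->
  isE p g v -> (Ex p (fun z => F z + (g z)%:E) = Ex p F + v%:E)%E.
Proof.
move=> mF F0 g0 [gi gv]; rewrite /Ex -gv -ge0_integralD//; first last.
- exact: measurable_int gi.
- by move=> z; rewrite posRE => zp; rewrite lee_fin mulr_ge0 ?g0 ?gpdf_ge0.
- exact: emeasurable_gpdfM.
- by move=> z; rewrite posRE => zp; rewrite mule_ge0 ?F0// lee_fin gpdf_ge0.
apply: eq_integral => z; rewrite inE posRE => zp.
by rewrite ge0_muleDr ?F0 ?lee_fin ?g0// EFinM.
Qed.

Lemma isE_dom p f g v : measurable_fun [set: R] f ->
  (forall z, 0 < z -> 0 <= f z <= g z) -> isE p g v ->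
  exists2 w, w <= v & isE p f w.
Proof.
move=> mf fg gv.
have f0 z : 0 < z -> 0 <= f z by move=> zp; have /andP[] := fg z zp.
have le : (Ex p (fun z => (f z)%:E) <= v%:E)%E.
  rewrite -(isE_Ex gv); apply: le_Ex => z zp; rewrite lee_fin ?f0//.
  by have /andP[] := fg z zp.
have ge : (0 <= Ex p (fun z => (f z)%:E))%E.
  by apply: Ex_ge0 => z zp; rewrite lee_fin f0.
have fin : Ex p (fun z => (f z)%:E) \is a fin_num.
  by rewrite ge0_fin_numE// (le_lt_trans le)// ltry.
exists (fine (Ex p (fun z => (f z)%:E))).
  by rewrite -lee_fin fineK.
by apply: Ex_isE => //; rewrite fineK.
Qed.

Lemma isE_ge0 p g v : (forall z, 0 < z -> 0 <= g z) -> isE p g v -> 0 <= v.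
Proof.
move=> g0 /isE_Ex e; rewrite -lee_fin -e.
by apply: Ex_ge0 => z zp; rewrite lee_fin g0.
Qed.

End Domination.

(* [U m n] is superharmonic on [Reg]; off [Reg] the inequality is required
   outright, so an induction on the number [m] of steps extends it everywhere. *)
Section Verification.
Context {R : realType}.
Variable theta0 : R.
Variables (q : R -> R) (kap : nat -> R) (phi : R -> R).
Hypothesis mq : measurable_fun [set: R] q.
Hypothesis mphi : measurable_fun [set: R] phi.
Hypothesis phi_ge0 : forall x, x <= 0 -> 0 <= phi x.
Hypothesis q_gt0 : forall th, 0 < th -> 0 < q th.
Hypothesis kap_lt1 : forall n, 0 <= kap n < 1.
Implicit Types (m n : nat) (s : R * R) (c x y z th : R).
Local Notation step := (chain_step theta0 kap).
Local Notation value_upto := (value_upto theta0 q kap phi).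
Local Notation value := (value theta0 q kap phi).

Variables (Reg : nat -> R * R -> Prop) (U : nat -> nat -> R * R -> R).
Hypothesis Reg_gt0 : forall n s, Reg n s -> 0 < s.2.
Hypothesis U_ge0 : forall m n s, 0 < s.1 -> 0 <= U m n s.
Hypothesis UE : forall m n s, 0 < s.1 -> Reg n s ->
  exists2 w, w <= U m.+1 n s & isE (q s.1) (fun z => U m n.+1 (step n s z)) w.

(** [U] carries a horizon m that [value] does not see. In the applications m occurs only in a term
    decaying like r^m, which [le_geom] removes at the end. *)
Lemma verif_lower c : 0 <= c ->
  (forall m n s, 0 < s.1 -> ~ Reg n s -> (c%:E <= value n s + (U m n s)%:E)%E) ->
  (forall n s, 0 < s.1 -> Reg n s -> (c%:E <= value n s + (U 0 n s)%:E)%E) ->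
  forall m n s, 0 < s.1 -> (c%:E <= value n s + (U m n s)%:E)%E.
Proof.
move=> c0 hN h0; elim=> [|m ih] n s th0.
  by have [r|r] := pselect (Reg n s); [exact: h0|exact: hN].
have [r|r] := pselect (Reg n s); last exact: hN.
have [w wU wE] := UE m th0 r; have x0 := Reg_gt0 r.
rewrite value_go//; apply: (@le_trans _ _ (Ex (q s.1) (fun z => value n.+1 (step n s z)) + w%:E)%E); last first.
  by rewrite leeD2l// lee_fin.
rewrite -(Ex_addE _ _ _ wE)//; first last.
- by move=> z zp; apply: U_ge0; exact: step_gt0.
- by move=> z _; exact: value_ge0.
- exact: measurable_value_step.
rewrite -(Ex_cst c (q_gt0 th0)); apply: le_Ex => z zp; first by rewrite lee_fin.
by apply: ih; exact: step_gt0.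
Qed.

Lemma verif_upper c : 0 <= c ->
  (forall m n s, 0 < s.1 -> ~ Reg n s -> (value n s <= (c + U m n s)%:E)%E) ->
  (forall n s, 0 < s.1 -> Reg n s -> (value n s <= (c + U 0 n s)%:E)%E) ->
  forall m n s, 0 < s.1 -> (value n s <= (c + U m n s)%:E)%E.
Proof.
move=> c0 hN h0; elim=> [|m ih] n s th0.
  by have [r|r] := pselect (Reg n s); [exact: h0|exact: hN].
have [r|r] := pselect (Reg n s); last exact: hN.
have [w wU wE] := UE m th0 r; have x0 := Reg_gt0 r.
rewrite value_go//; apply: (@le_trans _ _ (c + w)%:E); last first.
  by rewrite lee_fin lerD2l.
rewrite -(isE_Ex (isED (isE_cst c (q_gt0 th0)) wE)).
apply: le_Ex => z zp; first exact: value_ge0.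
by apply: ih; exact: step_gt0.
Qed.

(** Compares the value with its truncation after m steps: the error is the chance of still running,
    or of having left [Reg], and [U] dominates it. *)
Lemma verif_tail : (forall x, x <= 0 -> phi x <= 1) ->
  (forall m n s, 0 < s.1 -> 0 < s.2 -> ~ Reg n s -> 1 <= U m n s) ->
  (forall n s, 0 < s.1 -> Reg n s -> 1 <= U 0 n s) ->
  forall m n s, 0 < s.1 -> (value n s <= value_upto m n s + (U m n s)%:E)%E.
Proof.
move=> phi1 hN h0.
have big m n s : 0 < s.1 -> 1 <= U m n s -> (value n s <= value_upto m n s + (U m n s)%:E)%E.
  move=> th0 u1; apply: (@le_trans _ _ 1%E); first exact: value_le1.
  by rewrite -[leLHS]add0e leeD ?value_upto_ge0 ?lee_fin.
elim=> [|m ih] n s th0.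
  have [x0|x0] := leP s.2 0.
    by rewrite value_stop// value_upto_stop// leeDl// lee_fin U_ge0.
  by apply: big => //; have [r|r] := pselect (Reg n s); [exact: h0|exact: hN].
have [x0|x0] := leP s.2 0.
  by rewrite value_stop// value_upto_stop// leeDl// lee_fin U_ge0.
have [r|r] := pselect (Reg n s); last by apply: big => //; exact: hN.
have [w wU wE] := UE m th0 r.
rewrite value_go// value_upto_go//; apply: (@le_trans _ _
  (Ex (q s.1) (fun z => value_upto m n.+1 (step n s z)) + w%:E)%E); last first.
  by rewrite leeD2l// lee_fin.
rewrite -(Ex_addE _ _ _ wE)//; first last.
- by move=> z zp; apply: U_ge0; exact: step_gt0.
- by move=> z _; exact: value_upto_ge0.
- exact: measurable_value_upto_step.
apply: le_Ex => z zp; first exact: value_ge0.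
by apply: ih; exact: step_gt0.
Qed.

End Verification.

(* Superharmonic above a threshold, at least 1 below [- L], small on [0, oo[:
   it bounds the probability of jumping past 0 by more than [L]. *)
HB.lock Definition osf (R : realType) (c L x : R) : R :=
  expR (- (2 * c * L)) * (2 * expR (- (2 * c * x)) - expR (- (c * x)) + 1).

Section OvershootBound.
Context {R : realType}.
Implicit Types (c L x v B k : R).

Lemma osf_sqr c L x : osf c L x =
  expR (- (2 * c * L)) * (2 * expR (- (c * x)) ^+ 2 - expR (- (c * x)) + 1).
Proof.
rewrite osf.unlock -expRM_natl; congr (_ * (2 * expR _ - _ + _)); ring.
Qed.

Lemma osf_ge0 c L x : 0 <= osf c L x.
Proof. by rewrite osf_sqr mulr_ge0 ?expR_ge0//; nra. Qed.

Lemma osf_ge1 c L x : 0 <= c -> 0 <= L -> x <= - L -> 1 <= osf c L x.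
Proof.
move=> c0 L0 xL; have a1 : 1 <= expR (- (c * x)).
  by rewrite -[leLHS]expR0 ler_expR oppr_ge0 mulr_ge0_le0//; lra.
have h : expR (2 * c * L) <= expR (- (c * x)) ^+ 2.
  rewrite -expRM_natl ler_expR.
  by have := ler_wpM2l c0 xL; lra.
rewrite osf_sqr -[leLHS](expR0) -(subrr (2 * c * L)) addrC expRD.
by rewrite ler_wpM2l ?expR_ge0//; nra.
Qed.

Lemma osf_le c L x : 0 <= c -> 0 <= x -> osf c L x <= 2 * expR (- (2 * c * L)).
Proof.
move=> c0 x0; rewrite osf_sqr mulrC ler_wpM2r ?expR_ge0//.
have : expR (- (c * x)) <= 1 by rewrite -[leRHS]expR0 ler_expR oppr_le0 mulr_ge0.
have := expR_ge0 (- (c * x)); nra.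
Qed.

(** With a = expR (- (c x)) the claim amounts to 2 a (v2 - 1) <= v1 - 1. The gain v1 - 1 >= 2 c (1 -
    rho) of the linear term beats the quadratic one once a is small, that is, far enough from 0. *)
Lemma isE_osf theta0 th c rho B L x : 0 < th -> 0 < c ->
  (exists2 v, 1 + 2 * c * (1 - rho) <= v & isE th (fun z => expR (c * llr theta0 th z)) v) ->
  (exists2 v, v <= B & isE th (fun z => expR (2 * c * llr theta0 th z)) v) ->
  expR (- (c * x)) * B <= c * (1 - rho) ->
  exists2 w, w <= osf c L x & isE th (fun z => osf c L (x - llr theta0 th z)) w.
Proof.
move=> th0 c0 [v1 h1 e1] [v2 h2 e2] hx.
set a := expR (- (c * x)) in hx *; have a0 : 0 < a by exact: expR_gt0.
exists (expR (- (2 * c * L)) * (2 * a ^+ 2 * v2 - a * v1 + 1)).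
  by rewrite osf_sqr -/a ler_wpM2l ?expR_ge0//; nra.
have := isEZ (expR (- (2 * c * L)))
  (isED (isEB (isEZ (2 * a ^+ 2) e2) (isEZ a e1)) (isE_cst 1 th0)).
apply: isE_ext => z _; rewrite osf.unlock; congr (_ * (_ - _ + _)).
  by rewrite -mulrA /a -expRM_natl -expRD; congr (_ * expR _); ring.
by rewrite /a -expRD; congr expR; ring.
Qed.

End OvershootBound.

(** * The renewal limit of the overshoot *)

Section IidWalk.
Context {R : realType}.
Variable theta0 : R.
Implicit Types (m n : nat) (a c e k u v w x y z th B L M : R).
Local Notation llr := (llr theta0).

Lemma kap0_lt1 : forall n : nat, (0 : R) <= 0 < (1 : R).
Proof. by rewrite lexx ltr01. Qed.
Lemma expR_nonpos_le1 x : x <= 0 -> expR x <= 1.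
Proof. by move=> x0; rewrite -[leRHS]expR0 ler_expR. Qed.

Definition iid_value th x : \bar R :=
  value theta0 id (fun=> 0) (@expR R) 0 (th, x).

Lemma value_upto_kap0 q phi m n n' s :
  value_upto theta0 q (fun=> 0) phi m n s = value_upto theta0 q (fun=> 0) phi m n' s.
Proof.
elim: m n n' s => [//|m ih] n n' s /=; case: ifP => // _.
by apply: eq_Ex => z _; exact: ih.
Qed.

Lemma value_kap0 q phi n n' s :
  value theta0 q (fun=> 0) phi n s = value theta0 q (fun=> 0) phi n' s.
Proof.
rewrite /value (_ : (fun m => value_upto _ _ _ _ m n s) =
  fun m => value_upto theta0 q (fun=> 0) phi m n' s)//.
by apply/funext => m; exact: value_upto_kap0.
Qed.

Lemma iid_value_ge0 th x : (0 <= iid_value th x)%E.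
Proof. by apply: value_ge0 => x0 _; exact: expR_ge0. Qed.

Lemma iid_value_le1 th x : 0 < th -> (iid_value th x <= 1)%E.
Proof.
move=> th0; apply: value_le1 => //; [exact: kap0_lt1|exact: expR_nonpos_le1].
Qed.

Lemma iid_value_real x th : 0 < th ->
  exists t : R, [/\ 0 <= t, t <= 1 & iid_value th x = t%:E].
Proof.
move=> th0; have := iid_value_ge0 th x; have := iid_value_le1 x th0.
by case: (iid_value th x) => // t t1 t0; exists t.
Qed.

Lemma iid_value_stop th x : x <= 0 -> iid_value th x = (expR x)%:E.
Proof. by move=> x0; rewrite /iid_value value_stop. Qed.

Lemma iid_value_go th x : 0 < x ->
  iid_value th x = Ex th (fun z => iid_value th (x - llr th z)).
Proof.
move=> x0; rewrite /iid_value value_go//=; apply: eq_Ex => z _.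
by rewrite (value_kap0 _ _ 1 0) /chain_step/= mul0r addr0.
Qed.

Lemma measurable_iid_value th : measurable_fun [set: R] (iid_value th).
Proof.
have m : measurable_fun [set: R * R] (value theta0 id (fun=> 0) (@expR R) 0).
  by apply: measurable_value => // x _; exact: expR_ge0.
exact: (measurableT_comp m (measurable_pair1 th)).
Qed.

Lemma measurable_iid_value_llr th x :
  measurable_fun [set: R] (fun z => iid_value th (x - llr th z)).
Proof.
apply: (measurableT_comp (measurable_iid_value th)).
by apply: measurable_funB => //; exact: measurable_llr.
Qed.

Definition scal_ratio_mom2 th e : R := expR (th * (2 * e - ln (2 * expR e - 1))).

Lemma scal_ratio_mom2_ge1 th e : 0 < th -> 0 <= e -> 1 <= scal_ratio_mom2 th e.
Proof.
move=> th0 e0.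
have h := isEB (isEZ 2 (isE_scal_ratio e th0)) (isE_cst 1 th0).
rewrite (_ : 1 = 2 * 1 - 1); last by ring.
apply: isE_le h (isE_scal_ratio2 th0 e0) => z _.
by have := sqr_ge0 (scal_ratio th e z - 1); rewrite sqrrB1 mulr2n; lra.
Qed.

Section ShiftComparison.
Variables (th e c v M u0 a : R).
Hypotheses (th0 : 0 < th) (e0 : 0 <= e) (c0 : 0 <= c) (a0 : 0 < a).
Hypotheses (vE : isE th (fun z => expR (c * llr th z)) v).
Hypotheses (M1 : 1 <= M) (vM : expR (e * th) * v <= M).
Let d := (th - theta0) * e.
Let R2 := scal_ratio_mom2 th e.

Let M0 : 0 <= M. Proof. exact: le_trans ler01 M1. Qed.

(** With D the product of n density ratios, E (al D - be)^2 = al^2 R2^n - 2 al be + be^2; the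
    arithmetic-geometric inequality with weight [a] turns this into a bound on E |al D - be|. The
    last term is an exponential Markov bound for walks that fall below [u0] within n steps. The
    weight [al] accumulates the ratios along the induction. *)
Let err n (al be x : R) : R :=
  (al ^+ 2 * R2 ^+ n - 2 * al * be + be ^+ 2) / (2 * a) + a / 2 +
  (al + be) * M ^+ n * expR (- (c * (x - u0))).

Let err_ge n al be x : 0 <= al -> 0 <= be ->
  (al - be) ^+ 2 / (2 * a) + a / 2 + (al + be) * M ^+ n * expR (- (c * (x - u0)))
   <= err n al be x.
Proof.
move=> al0 be0; rewrite /err !lerD2r ler_wpM2r ?invr_ge0 ?mulr_ge0 ?(ltW a0)//.
have : 1 <= R2 ^+ n by rewrite exprn_ege1// scal_ratio_mom2_ge1.
by have := sqr_ge0 al; nra.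
Qed.

Let amgm x : 0 <= x ^+ 2 / (2 * a) + a / 2 - `|x|.
Proof.
rewrite -real_normK ?num_real//; set t : R := `|x|.
rewrite (_ : _ - _ = (t - a) ^+ 2 / (2 * a)); last by field; rewrite ?gt_eqF.
by rewrite mulr_ge0 ?sqr_ge0// invr_ge0 mulr_ge0// ltW.
Qed.

Let tail_ge0 n al be x : 0 <= al -> 0 <= be ->
  0 <= (al + be) * M ^+ n * expR (- (c * (x - u0))).
Proof.
by move=> *; rewrite !mulr_ge0 ?expR_ge0 ?exprn_ge0 ?addr_ge0.
Qed.

Let err_ge0 n al be x : 0 <= al -> 0 <= be -> 0 <= err n al be x.
Proof.
move=> al0 be0; apply: le_trans (err_ge _ _ al0 be0).
by have := amgm (al - be); have := normr_ge0 (al - be); have := tail_ge0 n x al0 be0; lra.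
Qed.

Let err_ge_sum n al be x : 0 <= al -> 0 <= be -> x <= u0 -> al + be <= err n al be x.
Proof.
move=> al0 be0 xu; apply: le_trans (err_ge _ _ al0 be0).
have h1 : 1 <= M ^+ n by rewrite exprn_ege1.
have h2 : 1 <= expR (- (c * (x - u0))).
  by rewrite -[leLHS]expR0 ler_expR oppr_ge0 mulr_ge0_le0//; lra.
have h3 : al + be <= (al + be) * M ^+ n * expR (- (c * (x - u0))).
  rewrite -mulrA -[leLHS]mulr1 ler_wpM2l ?addr_ge0//.
  by rewrite -[leLHS]mulr1 ler_pM.
by have := amgm (al - be); have := normr_ge0 (al - be); lra.
Qed.

Let errE n al be x : 0 <= al -> 0 <= be ->
  exists2 w, w <= err n.+1 al be x &
    isE th (fun z => err n (al * scal_ratio th e z) be (x - llr th z)) w.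
Proof.
move=> al0 be0.
have mE : measurable_fun [set: R] (fun z => expR (c * llr th z)).
  apply: measurableT_comp; first exact: measurable_expR.
  by apply: measurable_funM => //; exact: measurable_llr.
have [v1 v1M v1E] : exists2 v1, v1 <= expR (e * th) * v &
    isE th (fun z => scal_ratio th e z * expR (c * llr th z)) v1.
  apply: isE_dom (isEZ _ vE).
    by apply: measurable_funM => //; exact: measurable_scal_ratio.
  move=> z zp; rewrite mulr_ge0 ?expR_ge0//= ler_wpM2r ?expR_ge0//.
  exact: scal_ratio_le.
have v0 : 0 <= v by apply: isE_ge0 vE => z _; exact: expR_ge0.
have vM' : v <= M.
  apply: le_trans vM; rewrite ler_peMl// -[leLHS]expR0 ler_expR.
  by rewrite mulr_ge0// ltW.
pose K := M ^+ n * expR (- (c * (x - u0))).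
have K0 : 0 <= K by rewrite mulr_ge0 ?expR_ge0// exprn_ge0.
exists ((al ^+ 2 * R2 ^+ n / (2 * a)) * R2 + (- (2 * al * be / (2 * a))) * 1
   + (be ^+ 2 / (2 * a) + a / 2) + (K * al) * v1 + (K * be) * v).
  rewrite /err (exprS R2 n) (exprS M n).
  have h1 : K * al * v1 <= K * al * M.
    by rewrite (ler_wpM2l (mulr_ge0 K0 al0))// (le_trans v1M).
  have h2 : K * be * v <= K * be * M by rewrite (ler_wpM2l (mulr_ge0 K0 be0)).
  rewrite [leRHS](_ : _ = (al ^+ 2 * R2 ^+ n / (2 * a)) * R2
     + (- (2 * al * be / (2 * a))) * 1
     + (be ^+ 2 / (2 * a) + a / 2) + (K * al) * M + (K * be) * M); last first.
    by rewrite /K; field; rewrite ?gt_eqF.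
  lra.
apply: isE_ext (isED (isED (isED (isED
  (isEZ (al ^+ 2 * R2 ^+ n / (2 * a)) (isE_scal_ratio2 th0 e0))
  (isEZ (- (2 * al * be / (2 * a))) (isE_scal_ratio e th0)))
  (isE_cst (be ^+ 2 / (2 * a) + a / 2) th0)) (isEZ (K * al) v1E)) (isEZ (K * be) vE)).
move=> z zp; rewrite /err /K.
rewrite (_ : - (c * (x - llr th z - u0)) = - (c * (x - u0)) + c * llr th z); last by ring.
by rewrite expRD; field; rewrite ?gt_eqF.
Qed.

(* Each of [n] steps absorbs a shift [d] into the density ratio [scal_ratio],
   and the [L^1] cost of [n] such changes of density is controlled through
   their second moment. *)
Lemma shift_comparison n al be x : 0 <= al -> 0 <= be -> n%:R * `|d| <= u0 ->
  (al%:E * iid_value th (x + n%:R * d) <= be%:E * iid_value th x + (err n al be x)%:E)%E /\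
  (be%:E * iid_value th x <= al%:E * iid_value th (x + n%:R * d) + (err n al be x)%:E)%E.
Proof.
elim: n al be x => [|n ih] al be x al0 be0 nd.
  rewrite mul0r addr0; have [t [t0 t1 ->]] := iid_value_real x th0.
  have := err_ge 0 x al0 be0; have := amgm (al - be); have := tail_ge0 0 x al0 be0.
  have := ler_norm (al - be); have := ler_norm (- (al - be)); rewrite normrN.
  have := normr_ge0 (al - be).
  by rewrite -!EFinM -!EFinD !lee_fin; split; nra.
(* Below [u0] the last term of [err] alone covers both sides. Above [u0] the shifted and the
   unshifted start are both positive, so both walks make a step. *)
have [xu|ux] := leP x u0.
  have h (k1 k2 x1 x2 : R) : 0 <= k1 -> 0 <= k2 -> k1 <= err n.+1 al be x ->
      (k1%:E * iid_value th x1 <= k2%:E * iid_value th x2 + (err n.+1 al be x)%:E)%E.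
    move=> k10 k20 h; apply: (@le_trans _ _ (err n.+1 al be x)%:E).
      apply: (@le_trans _ _ k1%:E); last by rewrite lee_fin.
      by rewrite -[leRHS]mule1 lee_wpmul2l ?lee_fin// iid_value_le1.
    by rewrite leeDr// mule_ge0 ?lee_fin// iid_value_ge0.
  by have := err_ge_sum n.+1 al0 be0 xu; split; apply: h => //; lra.
have nd' : n%:R * `|d| <= u0.
  by apply: le_trans nd; rewrite ler_wpM2r// ler_nat.
have u00 : 0 <= u0 by apply: le_trans nd; rewrite mulr_ge0.
have x0 : 0 < x by lra.
have xd : 0 < x + n.+1%:R * d.
  have : `|n.+1%:R * d| <= u0 by rewrite normrM ger0_norm.
  by rewrite ler_norml => /andP[]; lra.
have [w wle wE] := errE n x al0 be0.
pose G z := iid_value th (x - llr th z + n%:R * d).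
have mG : measurable_fun [set: R] G.
  apply: (measurableT_comp (measurable_iid_value th)).
  by apply: measurable_funD => //; apply: measurable_funB => //; exact: measurable_llr.
have mr : measurable_fun [set: R] (fun z => (al * scal_ratio th e z)%:E).
  apply/measurable_EFinP; apply: measurable_funM => //.
  exact: measurable_scal_ratio.
have r0 z : 0 <= al * scal_ratio th e z by rewrite mulr_ge0// expR_ge0.
(* One of the n + 1 shifts is absorbed by rescaling the current observation; the weight [al] becomes
   [al * scal_ratio th e z]. *)
have e1 : (al%:E * iid_value th (x + n.+1%:R * d)
    = Ex th (fun z => (al * scal_ratio th e z)%:E * G z))%E.
  rewrite (iid_value_go _ xd) (Ex_scal th e); first last.
  - by move=> z; exact: iid_value_ge0.
  - exact: measurable_iid_value_llr.
  rewrite -ExZ//; first last.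
  - by move=> z zp; rewrite mule_ge0 ?iid_value_ge0// lee_fin expR_ge0.
  - apply: emeasurable_funM.
      by apply/measurable_EFinP; exact: measurable_scal_ratio.
    apply: (measurableT_comp (measurable_iid_value_llr th _)).
    exact: measurable_funM.
  apply: eq_Ex => z zp; rewrite muleA -EFinM; congr (_ * iid_value th _)%E.
  by rewrite llr_scal// -natr1 /d; ring.
have e2 : (be%:E * iid_value th x = Ex th (fun z => be%:E * iid_value th (x - llr th z)))%E.
  rewrite (iid_value_go _ x0) ExZ//; first exact: measurable_iid_value_llr.
  by move=> z _; exact: iid_value_ge0.
have err0 z : 0 < z -> 0 <= err n (al * scal_ratio th e z) be (x - llr th z).
  by move=> _; exact: err_ge0.
have ihz z := ih (al * scal_ratio th e z) be (x - llr th z) (r0 z) be0 nd'.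
rewrite e1 e2; split.
- apply: (@le_trans _ _ (Ex th (fun z => be%:E * iid_value th (x - llr th z)) + w%:E)%E).
    rewrite -(Ex_addE _ _ err0 wE)//; first last.
    + by move=> z _; rewrite mule_ge0 ?iid_value_ge0.
    + by apply: emeasurable_funM => //; exact: measurable_iid_value_llr.
    apply: le_Ex => z _; last by have [] := ihz z.
    by rewrite mule_ge0 ?lee_fin// iid_value_ge0.
  by rewrite leeD2l// lee_fin.
- apply: (@le_trans _ _ (Ex th (fun z => (al * scal_ratio th e z)%:E * G z) + w%:E)%E).
    rewrite -(Ex_addE _ _ err0 wE); first last.
    + by move=> z _; rewrite mule_ge0 ?lee_fin// iid_value_ge0.
    + exact: emeasurable_funM.
    apply: le_Ex => z _; last by have [] := ihz z.
    by rewrite mule_ge0 ?lee_fin// iid_value_ge0.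
  by rewrite leeD2l// lee_fin.
Qed.

End ShiftComparison.
End IidWalk.

Section RenewalLimit.
Context {R : realType}.
Variable theta0 : R.
Hypothesis theta0_gt0 : 0 < theta0.
Implicit Types (m n : nat) (a c d e k u v w x y z th B L M X : R).
Local Notation llr := (llr theta0).
Local Notation iid_value := (iid_value theta0).
Local Notation V0 := (value theta0 id (fun=> 0%R) (@expR R)).

Lemma expRN_le x : 0 < x -> expR (- x) <= x^-1.
Proof.
move=> x0; rewrite expRN lef_pV2 ?posrE ?expR_gt0//.
by have := expR_ge1Dx x; lra.
Qed.

(** Writing 2 expR e - 1 = expR (2 e) (1 - t) with t = (1 - expR (- e))^2 shows that the logarithm
    of the second moment is of order e^2. Splitting a shift of size u into n parts thus costs of
    order u^2 / n. *)
Lemma scal_ratio_mom2_le th e n : 0 < th -> 0 <= e -> e ^+ 2 <= 2^-1 ->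
  scal_ratio_mom2 th e ^+ n <= expR (n%:R * (th * (2 * e ^+ 2))).
Proof.
move=> th0 e0 e2; rewrite /scal_ratio_mom2 -expRM_natl ler_expR ler_wpM2l// ler_wpM2l ?(ltW th0)//.
pose s := expR (- e); pose t := (1 - s) ^+ 2.
have s0 : 0 < s by exact: expR_gt0.
have s1 : s <= 1 by apply: expR_nonpos_le1; lra.
have es : expR e = s^-1 by rewrite /s expRN invrK.
have s2 : 1 - s <= e by have := expR_ge1Dx (- e); rewrite -/s; lra.
have te : t <= e ^+ 2 by rewrite /t; nra.
have t1 : 0 < 1 - t by lra.
have h1 : 2 * expR e - 1 = expR (2 * e) * (1 - t).
  by rewrite expRM_natl es /t; field; rewrite ?gt_eqF.
have := ln_le_sub1 (_ : 0 < (1 - t)^-1); rewrite invr_gt0 => /(_ t1).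
rewrite lnV ?posrE// h1 lnM ?posrE ?expR_gt0// expRK => h.
have h3 : (1 - t)^-1 - 1 <= 2 * t.
  rewrite lerBlDr -[leLHS]mul1r ler_pdivrMr//.
  have t0 : 0 <= t by exact: sqr_ge0.
  nra.
lra.
Qed.

Lemma scal_ratio_mom2_small th e n s de : 0 < th -> 0 <= e -> e ^+ 2 <= 2^-1 ->
  n%:R * (th * (2 * e ^+ 2)) <= s -> s <= 2^-1 -> s <= de ^+ 2 / 8 ->
  scal_ratio_mom2 th e ^+ n - 1 <= de ^+ 2 / 4.
Proof.
move=> th0 e0 e2 h s2 s3; have h1 := scal_ratio_mom2_le n th0 e0 e2.
have {h1}h1 : scal_ratio_mom2 th e ^+ n <= expR s.
  by apply: le_trans h1 _; rewrite ler_expR.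
have s0 : 0 <= s by apply: le_trans h; rewrite !mulr_ge0 ?sqr_ge0// ltW.
have h5 : (1 - s) * expR s <= 1.
  by rewrite -ler_pdivlMr ?expR_gt0// div1r -expRN; have := expR_ge1Dx (- s); lra.
have h6 : expR s <= 1 + 2 * s by clear -h5 s0 s2; nra.
by clear -h1 h6 s3; lra.
Qed.

Let sgn_shift th n u : (0 < n)%N -> th != theta0 ->
  let e := u / (n%:R * `|th - theta0|) in
  n%:R * ((th - theta0) * e) = (if theta0 < th then u else - u).
Proof.
move=> n0 tt; have n1 : n%:R != 0 :> R by rewrite pnatr_eq0 -lt0n.
have t1 : th - theta0 != 0 by rewrite subr_eq0.
case: ltP => t /=.
  by rewrite gtr0_norm ?subr_gt0//; field; rewrite n1 t1.
by rewrite ler0_norm ?subr_le0//; field; rewrite t1 n1.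
Qed.

(** The total shift u is spread over n observations, each rescaled by e = u / (n |th - theta0|), a
    number kept nonnegative as [isE_scal_ratio2] requires. *)
Lemma slow_variation_at th c v M K de n : 0 < th -> th != theta0 -> 0 < c ->
  0 < de -> (0 < n)%N -> 0 <= K ->
  isE th (fun z => expR (c * llr th z)) v -> 1 <= M ->
  let e := K / (n%:R * `|th - theta0|) in
  expR (e * th) * v <= M -> e <= 2^-1 ->
  n%:R * (th * (2 * e ^+ 2)) <= 2^-1 ->
  n%:R * (th * (2 * e ^+ 2)) <= de ^+ 2 / 8 ->
  forall x u, K + 4 * M ^+ n / de / c <= x -> 0 <= u <= K ->
   (iid_value th (x + u) <= iid_value th x + de%:E)%E /\
   (iid_value th x <= iid_value th (x + u) + de%:E)%E.
Proof.
move=> th0 tt c0 de0 n0 K0 vE M1 E vM E1 E2 E3 x u Xx /andP[u0 uK].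
have n1 : 0 < n%:R :> R by rewrite ltr0n.
have t1 : 0 < `|th - theta0| by rewrite normr_gt0 subr_eq0.
pose e := u / (n%:R * `|th - theta0|).
have e0 : 0 <= e by rewrite divr_ge0// mulr_ge0// ltW.
have eE : e <= E by rewrite ler_wpM2r// invr_ge0 mulr_ge0// ltW.
have v0 : 0 <= v by apply: isE_ge0 vE => z _; exact: expR_ge0.
have vM' : expR (e * th) * v <= M.
  by apply: le_trans vM; rewrite ler_wpM2r// ler_expR ler_wpM2r// ltW.
have e2 : e ^+ 2 <= 2^-1 by clear -e0 eE E1; nra.
have eE2 : n%:R * (th * (2 * e ^+ 2)) <= n%:R * (th * (2 * E ^+ 2)).
  rewrite !ler_wpM2l ?(ltW th0)//.
  by rewrite ler_pXn2r ?nnegrE// (le_trans e0).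
have R2n := scal_ratio_mom2_small th0 e0 e2 eE2 E2 E3.
have shift := sgn_shift u n0 tt; rewrite /= -/e in shift.
(* Since e is nonnegative, the sign of th - theta0 fixes the direction of the shift; the comparison
   starts from x when it goes up and from x + u when it goes down. *)
have [x' [xx' h]] : exists x', x <= x' /\
    ((x' = x /\ x' + n%:R * ((th - theta0) * e) = x + u) \/
     (x' = x + u /\ x' + n%:R * ((th - theta0) * e) = x)).
  rewrite shift; case: ifP => _; first by exists x; split => //; left.
  by exists (x + u); split; [rewrite lerDl|right; rewrite addrK].
have nK : n%:R * `|(th - theta0) * e| <= K.
  by rewrite -(ger0_norm (ltW n1)) -normrM shift; case: ifP => _; rewrite ?normrN ger0_norm.
have [c1 c2] := @shift_comparison R theta0 th e c v M K (de / 2) th0 e0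
  (ltW c0) ltac:(lra) vE M1 vM' n 1 1 x' ler01 ler01 nK.
move: c1 c2; rewrite !mul1e expr1n !mul1r.
rewrite !mulr1; set err := (_ / _ + _ / _ + _) => c1 c2.
(* The three parts of [err] are at most de / 4, de / 4 and de / 2. *)
have err_le : err <= de.
  have Mn : 0 < M ^+ n by rewrite exprn_gt0// (lt_le_trans ltr01).
  pose T := 4 * M ^+ n / de.
  have T0 : 0 < T by rewrite divr_gt0// mulr_gt0.
  have h3 : 2 * M ^+ n * expR (- (c * (x' - K))) <= de / 2.
    have h4 : expR (- (c * (x' - K))) <= T^-1.
      apply: le_trans (expRN_le T0); rewrite ler_expR lerN2.
      have : T / c <= x' - K by rewrite lerBrDl; exact: le_trans xx'.
      by rewrite ler_pdivrMr// mulrC.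
    apply: (@le_trans _ _ (2 * M ^+ n * T^-1)).
      by rewrite ler_wpM2l// mulr_ge0// ltW.
    by rewrite /T le_eqVlt; apply/orP; left; apply/eqP; field; rewrite ?gt_eqF.
  have h5 : (scal_ratio_mom2 th e ^+ n - 2 + 1) / (2 * (de / 2)) <= de / 4.
    by clear -R2n de0; rewrite ler_pdivrMr; nra.
  by rewrite /err; clear -h3 h5; lra.
have {}err_le (b : \bar R) : (b + err%:E <= b + de%:E)%E by rewrite leeD2l// lee_fin.
by case: h => -[e1 e2']; move: c1 c2; rewrite e2' e1 => c1 c2; split;
  (apply: le_trans (err_le _)).
Qed.

Let choose_n y d K de : 0 < y -> 0 < d -> 0 <= K -> 0 < de ->
  exists n, [/\ (0 < n)%N, K / (n%:R * d) <= 2^-1,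
    n%:R * (2 * y * (2 * (K / (n%:R * d)) ^+ 2)) <= 2^-1 &
    n%:R * (2 * y * (2 * (K / (n%:R * d)) ^+ 2)) <= de ^+ 2 / 8].
Proof.
move=> y0 d0 K0 de0.
pose A := 4 * y * (K / d) ^+ 2.
have A0 : 0 <= A by rewrite mulr_ge0 ?sqr_ge0//; lra.
have Kd0 : 0 <= K / d by rewrite divr_ge0// ltW.
have A8 : 0 <= A * 8 / de ^+ 2 by apply: divr_ge0; [lra|exact: sqr_ge0].
have [n hn] : exists n, A * 2 + A * 8 / de ^+ 2 + 2 * (K / d) + 1 <= n%:R.
  exists (Num.bound (A * 2 + A * 8 / de ^+ 2 + 2 * (K / d) + 1)).
  by apply/ltW/archi_boundP; lra.
have n0 : 0 < n%:R :> R by lra.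
have An : n%:R * (2 * y * (2 * (K / (n%:R * d)) ^+ 2)) = A / n%:R.
  by rewrite /A; field; rewrite ?gt_eqF.
exists n; rewrite An; split.
- by rewrite -(ltr0n R).
- by rewrite invfM mulrA mulrAC ler_pdivrMr//; lra.
- by rewrite ler_pdivrMr//; lra.
- rewrite ler_pdivrMr//; have : A * 8 / de ^+ 2 <= n%:R by lra.
  by rewrite ler_pdivrMr ?exprn_gt0//; lra.
Qed.

Lemma slow_variation y K de : 0 < y -> y != theta0 -> 0 <= K -> 0 < de ->
  exists X, \forall th \near y, forall x u, X <= x -> 0 <= u <= K ->
   (iid_value th (x + u) <= iid_value th x + de%:E)%E /\
   (iid_value th x <= iid_value th (x + u) + de%:E)%E.
Proof.
move=> y0 yt K0 de0; have [c [rho [B [c0 rho0 rho1 B0 loc]]]] := llr_local theta0_gt0 y0 yt.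
pose d := `|y - theta0| / 2.
have yn : 0 < `|y - theta0| by rewrite normr_gt0 subr_eq0.
have d0 : 0 < d by rewrite divr_gt0.
have [n [n0 n1 n2 n3]] := choose_n y0 d0 K0 de0.
have nR : 0 < n%:R :> R by rewrite ltr0n.
(* One [M] for all th near y: it bounds expR (e th) v as soon as e <= 1/2, th <= 2 y and v <= B. The
   order 2 c is used because only there does [llr_local] bound the moment from above. *)
pose M := expR (2^-1 * (2 * y)) * (B + 1).
have M1 : 1 <= M.
  rewrite /M -[leLHS]mulr1 ler_pM//; last lra.
  by rewrite -[leLHS]expR0 ler_expR mulr_ge0//; lra.
exists (K + 4 * M ^+ n / de / (2 * c)); near=> th.
have hd : d <= `|th - theta0|.
  near: th; apply: (cvgr_ge `|y - theta0|); last by rewrite /d; lra.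
  apply: cvg_norm; apply: cvgB; [exact: cvg_id|exact: cvg_cst].
have hy : th <= 2 * y by near: th; apply: (cvgr_le y); [exact: cvg_id|lra].
have [th0 [v vB vE]] : 0 < th /\
     exists2 v, v <= B & isE th (fun z => expR (2 * c * llr th z)) v.
  by near: th; apply: filterS loc => th [].
have thd : 0 < `|th - theta0| by exact: lt_le_trans hd.
have tt : th != theta0 by rewrite -subr_eq0 -normr_gt0.
pose e := K / (n%:R * `|th - theta0|).
have e0 : 0 <= e by rewrite divr_ge0// mulr_ge0// ltW.
have ed : e <= K / (n%:R * d).
  rewrite ler_wpM2l// lef_pV2 ?posrE ?mulr_gt0//.
  by apply: ler_wpM2l => //; exact: ltW.
have eh : e <= 2^-1 by exact: (le_trans _ n1).
have es : n%:R * (th * (2 * e ^+ 2)) <= n%:R * (2 * y * (2 * (K / (n%:R * d)) ^+ 2)).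
  rewrite ler_wpM2l ?(ltW nR)// ler_pM ?(ltW th0)//.
    by rewrite mulr_ge0 ?sqr_ge0.
  by rewrite ler_wpM2l// ler_pXn2r ?nnegrE// (le_trans e0).
apply: (@slow_variation_at th (2 * c) v M K de n) => //.
- by rewrite mulr_gt0.
- apply: (@le_trans _ _ (expR (2^-1 * (2 * y)) * v)).
    apply: ler_wpM2r; first by apply: isE_ge0 vE => z _; exact: expR_ge0.
    by rewrite ler_expR ler_pM// ltW.
  by rewrite ler_wpM2l ?expR_ge0//; clear -vB; lra.
- exact: (le_trans _ n2).
- exact: (le_trans _ n3).
Unshelve. all: by end_near. Qed.

Lemma le_geom a b k rho : 0 < rho -> rho < 1 ->
  (forall n, a <= b + k * rho ^+ n) -> a <= b.
Proof.
move=> r0 r1 h; have c : b + k * rho ^+ n @[n --> \oo] --> b + k * 0.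
  apply: cvgD; first exact: cvg_cst.
  by apply: cvgM; [exact: cvg_cst|apply: cvg_expr; rewrite ger0_norm ?ltW].
rewrite mulr0 addr0 in c.
by apply: (cvgr_to_ge c); exact: nearW.
Qed.

Let idp th : 0 < th -> 0 < id th. Proof. by []. Qed.
Let exp0 x : x <= 0 -> 0 <= expR x. Proof. by move=> _; exact: expR_ge0. Qed.

Lemma osf_threshold c rho B x : 0 < c -> rho < 1 -> 0 < B ->
  B / (c * (c * (1 - rho))) <= x -> expR (- (c * x)) * B <= c * (1 - rho).
Proof.
move=> c0 r1 B0 h; have r0 : 0 < c * (1 - rho) by rewrite mulr_gt0// subr_gt0.
have x0 : 0 < x by apply: lt_le_trans h; rewrite divr_gt0// mulr_gt0.
apply: (@le_trans _ _ ((c * x)^-1 * B)).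
  by rewrite ler_wpM2r ?(ltW B0)// expRN_le// mulr_gt0.
rewrite mulrC ler_pdivrMr ?mulr_gt0//.
move: h; rewrite ler_pdivrMr ?mulr_gt0 ?subr_gt0//.
by rewrite (_ : x * _ = c * (1 - rho) * (c * x))//; ring.
Qed.

(** The function expR (x / 2) rho^m, with m the number of steps left, is superharmonic and at least
    1 at m = 0 when x >= 0: it bounds the chance that the walk has not crossed after m steps. *)
Lemma isE_half_geom p th rho m x : 0 < p ->
  (exists2 v, v <= rho & isE p (fun z => expR (- 2^-1 * llr th z)) v) -> 0 < rho ->
  exists2 w, w <= expR (2^-1 * x) * rho ^+ m.+1 &
    isE p (fun z => expR (2^-1 * (x - llr th z)) * rho ^+ m) w.
Proof.
move=> p0 [v vr vE] r0; exists (expR (2^-1 * x) * rho ^+ m * v).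
  by rewrite exprSr mulrA ler_wpM2l// mulr_ge0 ?expR_ge0 ?exprn_ge0// ltW.
apply: isE_ext (isEZ (expR (2^-1 * x) * rho ^+ m) vE) => z _.
by rewrite mulrBr -mulNr expRD; ring.
Qed.

(** A walk started beyond X enters the window [X - L, X + x0], unless it jumps across the whole
    window, which [osf] makes unlikely. On the window the value is almost constant by
    [slow_variation], hence the value at the start is close to the value at X. *)
Lemma iid_value_local y de : 0 < y -> y != theta0 -> 0 < de ->
  exists X, \forall th \near y, forall x, X <= x ->
   (iid_value th x <= iid_value th X + de%:E)%E /\
   (iid_value th X <= iid_value th x + de%:E)%E.
Proof.
move=> y0 yt de0.
have [c [rho [B [c0 rho0 rho1 B0 loc]]]] := llr_local theta0_gt0 y0 yt.
pose x0 := B / (c * (c * (1 - rho))).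
have x00 : 0 < x0 by rewrite divr_gt0 ?mulr_gt0 ?subr_gt0.
(* Chosen so that 2 c L = 4 / de, whence the overshoot bound 2 expR (- (2 c L)) is at most de /
   2. *)
pose L := 4 / (de * (2 * c)).
have L0 : 0 < L by rewrite divr_gt0 ?mulr_gt0.
have cL : 2 * expR (- (2 * c * L)) <= de / 2.
  have e : 2 * c * L = 4 / de by rewrite /L; field; rewrite ?gt_eqF.
  rewrite e; have := expRN_le (divr_gt0 (ltr0n _ 4) de0 : 0 < 4 / de :> R).
  by rewrite invf_div; lra.
have [X1 sv] := slow_variation y0 yt (addr_ge0 (ltW L0) (ltW x00)) (divr_gt0 de0 (ltr0n R 4)).
pose X := Num.max X1 0 + L.
have X0 : 0 < X by rewrite /X ltr_wpDl// le_max lexx orbT.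
exists X; apply: filterS2 sv loc => th sv' [th0 h1 _ h2 h3].
have [tX [tX0 tX1 tXE]] := iid_value_real theta0 X th0.
have close x : - L <= x - X -> x - X <= x0 ->
    (iid_value th x <= (tX + de / 2)%:E)%E /\ (tX%:E <= iid_value th x + (de / 2)%:E)%E.
  move=> xL xx0.
  have X1L : X1 <= X - L by rewrite /X addrK le_max lexx.
  have [a1 a2] := sv' (X - L) (x - (X - L)) X1L ltac:(clear -xL xx0; lra).
  have [b1 b2] := sv' (X - L) L X1L ltac:(clear -L0 x00; lra).
  move: a1 a2 b1 b2; rewrite subrK tXE addrC subrK.
  have [t1 [_ _ ->]] := iid_value_real theta0 x th0.
  have [t2 [_ _ ->]] := iid_value_real theta0 (X - L) th0.
  rewrite -!EFinD !lee_fin => a1 a2 b1 b2.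
  by clear -a1 a2 b1 b2; lra.
pose Reg n (s : R * R) := s.1 = th /\ x0 < s.2 - X.
(* The estimate is frozen at [th]; on other states the trivial bound 1 is used. *)
pose U m n (s : R * R) := if s.1 == th then
  de / 2 + (osf c L (s.2 - X) + expR (2^-1 * s.2) * rho ^+ m) else 1.
have U_ge0 m n s : 0 < s.1 -> 0 <= U m n s.
  move=> _; rewrite /U; case: ifP => // _.
  by rewrite !addr_ge0 ?osf_ge0 ?mulr_ge0 ?expR_ge0 ?exprn_ge0// ltW// divr_gt0.
have Reg_gt0 n s : Reg n s -> 0 < s.2.
  by move=> [_]; clear -X0 x00; lra.
have UE m n s : 0 < s.1 -> Reg n s -> exists2 w, w <= U m.+1 n s &
    isE (id s.1) (fun z => U m n.+1 (chain_step theta0 (fun=> 0) n s z)) w.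
  case: s => s1 s2 /= _ [/= -> hx].
  have [w1 w1l w1E] := isE_half_geom m s2 th0 h1 rho0.
  have [w2 w2l w2E] := isE_osf L th0 c0 h2 h3 (osf_threshold c0 rho1 B0 (ltW hx)).
  exists (de / 2 + (w2 + w1)); first by rewrite /U/= eqxx lerD2l lerD.
  apply: isE_ext (isED (isE_cst (de / 2) th0) (isED w2E w1E)) => z _.
  by rewrite /U /chain_step/= mul0r addr0 eqxx (addrAC s2).
have main m x : (iid_value th x <= (tX + U m 0%N (th, x))%:E)%E /\
    (tX%:E <= iid_value th x + (U m 0%N (th, x))%:E)%E.
  have Ubig m' n s : 0 < s.1 -> (s.1 != th \/ s.2 - X < - L) -> 1 <= U m' n s.
    move=> _; rewrite /U; case: ifP => [_ [//|h]|//].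
    have := osf_ge1 (ltW c0) (ltW L0) (ltW h).
    have : 0 <= expR (2^-1 * s.2) * rho ^+ m'.
      by rewrite mulr_ge0 ?expR_ge0// exprn_ge0// ltW.
    by clear -de0; lra.
  have tri (s : R * R) n : 0 < s.1 -> ~ Reg n s ->
      (s.1 != th \/ s.2 - X < - L) \/ [/\ s.1 = th, - L <= s.2 - X & s.2 - X <= x0].
    move=> _ nr; have [e|ne] := eqVneq s.1 th; last by left; left.
    have [hl|hl] := ltP (s.2 - X) (- L); first by left; right.
    by right; split => //; rewrite leNgt; apply/negP => hh; apply: nr.
  have small m' n (s : R * R) : s.1 = th -> de / 2 <= U m' n s.
    move=> e; rewrite /U e eqxx lerDl addr_ge0 ?osf_ge0//.
    by rewrite mulr_ge0 ?expR_ge0// exprn_ge0// ltW.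
  have base n (s : R * R) : Reg n s -> 1 <= U 0%N n s.
    move=> r; have := Reg_gt0 n s r; case: r => e _ s20.
    rewrite /U e eqxx expr0 mulr1.
    have : 1 <= expR (2^-1 * s.2) by rewrite -[leLHS]expR0 ler_expR mulr_ge0// ltW.
    by have := osf_ge0 c L (s.2 - X); clear -de0; lra.
  have iv n (s : R * R) : V0 n s = iid_value s.1 s.2.
    by rewrite (value_kap0 _ _ _ _ 0); case: s.
  have up1 m' n (s : R * R) : 0 < s.1 -> ~ Reg n s ->
      (V0 n s <= (tX + U m' n s)%:E)%E.
    move=> s0 nr; rewrite iv; have [h|[e h4 h5]] := tri s n s0 nr.
      apply: (le_trans (iid_value_le1 theta0 s.2 s0)).
      by rewrite lee_fin; have := Ubig m' n s s0 h; clear -tX0; lra.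
    rewrite e; have [h _] := close s.2 h4 h5; apply: (le_trans h).
    by rewrite lee_fin lerD2l small.
  have up0 n (s : R * R) : 0 < s.1 -> Reg n s ->
      (V0 n s <= (tX + U 0%N n s)%:E)%E.
    move=> s0 r; rewrite iv; apply: (le_trans (iid_value_le1 theta0 s.2 s0)).
    by rewrite lee_fin; have := base n s r; clear -tX0; lra.
  have lo1 m' n (s : R * R) : 0 < s.1 -> ~ Reg n s ->
      (tX%:E <= V0 n s + (U m' n s)%:E)%E.
    move=> s0 nr; rewrite iv; have [h|[e h4 h5]] := tri s n s0 nr.
      apply: (@le_trans _ _ (U m' n s)%:E).
        by rewrite lee_fin; have := Ubig m' n s s0 h; clear -tX1; lra.
      by rewrite leeDr// iid_value_ge0.
    rewrite e; have [_ h] := close s.2 h4 h5; apply: (le_trans h).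
    by rewrite leeD2l// lee_fin small.
  have lo0 n (s : R * R) : 0 < s.1 -> Reg n s ->
      (tX%:E <= V0 n s + (U 0%N n s)%:E)%E.
    move=> s0 r; rewrite iv; apply: (@le_trans _ _ (U 0%N n s)%:E).
      by rewrite lee_fin; have := base n s r; clear -tX1; lra.
    by rewrite leeDr// iid_value_ge0.
  split.
    have H := verif_upper (@measurable_id _ _ setT) (@measurable_expR R) exp0 idp (@kap0_lt1 R) Reg_gt0 UE tX0 up1 up0 m 0%N (s := (th, x)) th0.
    by rewrite iv in H.
  have H := verif_lower (@measurable_id _ _ setT) (@measurable_expR R) exp0 idp (@kap0_lt1 R) Reg_gt0 U_ge0 UE tX0 lo1 lo0 m 0%N (s := (th, x)) th0.
  by rewrite iv in H.
move=> x Xx; have [t [t0 t1 tE]] := iid_value_real theta0 x th0.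
have xX : 0 <= x - X by rewrite subr_ge0.
have ob := osf_le L (ltW c0) xX.
have k0 : 0 <= expR (2^-1 * x) by exact: expR_ge0.
have b1 : t <= tX + de.
  apply: (@le_geom _ _ (expR (2^-1 * x)) rho) => // m.
  have [+ _] := main m x; rewrite tE lee_fin /U/= eqxx.
  by clear -ob cL; lra.
have b2 : tX <= t + de.
  apply: (@le_geom _ _ (expR (2^-1 * x)) rho) => // m.
  have [_] := main m x; rewrite tE -EFinD lee_fin /U/= eqxx.
  by clear -ob cL; lra.
by rewrite tE tXE -!EFinD !lee_fin.
Qed.

End RenewalLimit.

Section EtaLimit.
Context {R : realType}.
Variable theta0 : R.
Hypothesis theta0_gt0 : 0 < theta0.
Implicit Types (m n : nat) (a c d e k u v w x y z th p B L M X : R).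
Local Notation iid_value := (iid_value theta0).

Let exp0 x : x <= 0 -> 0 <= expR x. Proof. by move=> _; exact: expR_ge0. Qed.
Let idp th : 0 < th -> 0 < id th. Proof. by []. Qed.

Definition eta_lim th : R := lim (fine (iid_value th x) @[x --> +oo]).

Lemma cvg_eta_lim y : 0 < y -> y != theta0 ->
  fine (iid_value y x) @[x --> +oo] --> eta_lim y.
Proof.
move=> y0 yt; apply: cauchy_cvg; apply: cauchy_exP => e e0.
have [X /nbhs_singleton h] := iid_value_local theta0_gt0 y0 yt (divr_gt0 e0 (ltr0n R 2)).
exists (fine (iid_value y X)); exists X; split; first exact: num_real.
move=> x /ltW Xx; have [] := h x Xx; rewrite /ball/=.
have [t1 [_ _ ->]] := iid_value_real theta0 x y0.
have [t2 [_ _ ->]] := iid_value_real theta0 X y0.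
rewrite -!EFinD !lee_fin /= => h1 h2.
by rewrite ltr_norml; apply/andP; split; lra.
Qed.

Lemma eta_lim_tail y de : 0 < y -> y != theta0 -> 0 < de ->
  exists X, forall x, X <= x -> `|fine (iid_value y x) - eta_lim y| <= de.
Proof.
move=> y0 yt de0; have /cvgrPdist_le/(_ de de0) := cvg_eta_lim y0 yt.
move=> [X [_ h]]; exists (X + 1) => x Xx; rewrite distrC; apply: h.
by lra.
Qed.

Lemma eta_lim01 y : 0 < y -> y != theta0 -> 0 <= eta_lim y <= 1.
Proof.
move=> y0 yt; have c := cvg_eta_lim y0 yt; apply/andP; split.
  apply: (cvgr_to_ge c); apply: nearW => x.
  by have [t [t0 t1 ->]] := iid_value_real theta0 x y0.
apply: (cvgr_to_le c); apply: nearW => x.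
by have [t [t0 t1 ->]] := iid_value_real theta0 x y0.
Qed.

(** The overshoot stays below x0 + L with probability at least 1/2, which gives the lower bound k /
    2. Since [osf] is superharmonic only beyond x0, it is evaluated at s.2 + x0, so that it covers
    every positive distance. Positivity is what lets the theorem divide by [gamma]. *)
Lemma eta_lim_gt0 y : 0 < y -> y != theta0 -> 0 < eta_lim y.
Proof.
move=> y0 yt.
have [c [rho [B [c0 rho0 rho1 B0 /nbhs_singleton [_ h1 _ h2 h3]]]]] :=
  llr_local theta0_gt0 y0 yt.
pose x0 := B / (c * (c * (1 - rho))).
have x00 : 0 < x0 by rewrite divr_gt0 ?mulr_gt0 ?subr_gt0.
pose L := 4 / (2 * c).
have L0 : 0 < L by rewrite divr_gt0 ?mulr_gt0.
have cL : 2 * expR (- (2 * c * L)) <= 2^-1.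
  have e : 2 * c * L = 4 by rewrite /L; field; rewrite ?gt_eqF.
  by rewrite e; have := expRN_le (ltr0n R 4); lra.
pose k := expR (- (x0 + L)).
have k0 : 0 < k by exact: expR_gt0.
have k1 : k <= 1 by apply: expR_nonpos_le1; lra.
pose Reg n (s : R * R) := s.1 = y /\ 0 < s.2.
pose U m n (s : R * R) := if s.1 == y then
  k * (osf c L (s.2 + x0) + expR (2^-1 * s.2) * rho ^+ m) else 1.
have U_ge0 m n (s : R * R) : 0 < s.1 -> 0 <= U m n s.
  move=> _; rewrite /U; case: ifP => // _.
  have h := osf_ge0 c L (s.2 + x0).
  by rewrite mulr_ge0 ?(ltW k0)// addr_ge0// mulr_ge0 ?expR_ge0 ?exprn_ge0// ltW.
have Reg_gt0 n (s : R * R) : Reg n s -> 0 < s.2 by case.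
have UE m n (s : R * R) : 0 < s.1 -> Reg n s -> exists2 w, w <= U m.+1 n s &
    isE (id s.1) (fun z => U m n.+1 (chain_step theta0 (fun=> 0) n s z)) w.
  case: s => s1 s2 /= _ [/= -> hx].
  have [w1 w1l w1E] := isE_half_geom m s2 y0 h1 rho0.
  have hh : x0 <= s2 + x0 by rewrite lerDr ltW.
  have [w2 w2l w2E] := isE_osf L y0 c0 h2 h3 (osf_threshold c0 rho1 B0 hh).
  exists (k * (w2 + w1)); first by rewrite /U/= eqxx ler_wpM2l ?lerD// ltW.
  apply: isE_ext (isEZ k (isED w2E w1E)) => z _.
  by rewrite /U /chain_step/= mul0r addr0 eqxx (addrAC s2).
have iv n (s : R * R) : value theta0 id (fun=> 0%R) (@expR R) n s = iid_value s.1 s.2.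
  by rewrite (value_kap0 _ _ _ _ 0); case: s.
have lo1 m' n (s : R * R) : 0 < s.1 -> ~ Reg n s ->
    (k%:E <= value theta0 id (fun=> 0%R) (@expR R) n s + (U m' n s)%:E)%E.
  move=> s0 nr; rewrite iv; have u0 := U_ge0 m' n s s0.
  have big : k <= U m' n s -> (k%:E <= iid_value s.1 s.2 + (U m' n s)%:E)%E.
    by move=> h; apply: (@le_trans _ _ (U m' n s)%:E);
      rewrite ?lee_fin// leeDr// iid_value_ge0.
  have [e|ne] := eqVneq s.1 y; last by apply: big; rewrite /U (negbTE ne).
  have s20 : s.2 <= 0 by rewrite leNgt; apply/negP => h; apply: nr.
  have [h|h] := leP (s.2 + x0) (- L).
    apply: big; rewrite /U e eqxx ler_peMr ?(ltW k0)//.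
    have := osf_ge1 (ltW c0) (ltW L0) h.
    have : 0 <= expR (2^-1 * s.2) * rho ^+ m'.
      by rewrite mulr_ge0 ?expR_ge0// exprn_ge0// ltW.
    by clear -k0; lra.
  rewrite iid_value_stop//; apply: (@le_trans _ _ (expR s.2)%:E).
    by rewrite lee_fin ler_expR; clear -h; lra.
  by rewrite leeDl// lee_fin.
have lo0 n (s : R * R) : 0 < s.1 -> Reg n s ->
    (k%:E <= value theta0 id (fun=> 0%R) (@expR R) n s + (U 0%N n s)%:E)%E.
  move=> s0 [e s20]; rewrite iv; apply: (@le_trans _ _ (U 0%N n s)%:E).
    rewrite lee_fin /U e eqxx ler_peMr ?(ltW k0)// expr0 mulr1.
    have : 1 <= expR (2^-1 * s.2) by rewrite -[leLHS]expR0 ler_expR mulr_ge0// ltW.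
    by have := osf_ge0 c L (s.2 + x0); clear -k0; lra.
  by rewrite leeDr// iid_value_ge0.
apply: (@lt_le_trans _ _ (k / 2)); first by rewrite divr_gt0.
apply: (cvgr_to_ge (cvg_eta_lim y0 yt)); near=> x.
have x1 : 0 <= x + x0 by rewrite addr_ge0 ?(ltW x00)//; near: x; exact: nbhs_pinfty_ge.
have ob := osf_le L (ltW c0) x1.
apply: (@le_geom _ _ _ (k * expR (2^-1 * x)) rho) => // m.
have := verif_lower (@measurable_id _ _ setT) (@measurable_expR R) exp0 idp
  (@kap0_lt1 R) Reg_gt0 U_ge0 UE (ltW k0) lo1 lo0 m 0%N (s := (y, x)) y0.
rewrite iv /=; have [t [t0 t1 ->]] := iid_value_real theta0 x y0.
rewrite -EFinD lee_fin /U/= eqxx => h.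
have h4 : k * osf c L (x + x0) <= k * 2^-1.
  by rewrite ler_wpM2l ?(ltW k0)//; exact: le_trans cL.
by clear -h h4; lra.
Unshelve. all: by end_near. Qed.

Lemma isE_step p k th : 0 < p ->
  isE p (fun z => th + k * (z - th)) (th + k * (p - th)).
Proof.
move=> p0; have := isED (isE_cst ((1 - k) * th) p0) (isEZ k (isE_X p0)).
rewrite (_ : _ + k * p = th + k * (p - th)); last by ring.
by apply: isE_ext => z _; ring.
Qed.

Lemma isE_step_sqr p k th y : 0 < p ->
  isE p (fun z => (th + k * (z - th) - y) ^+ 2) ((th + k * (p - th) - y) ^+ 2 + k ^+ 2 * p).
Proof.
move=> p0; pose a := (1 - k) * th - y.
have h2 : isE p (fun z => z ^+ 2) (p * (p + 1)).
  by have := @isE_pow R p 2 p0; rewrite big_ord_recl big_ord1 /= addr0.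
have := isED (isEZ (k ^+ 2) h2) (isED (isEZ (2 * k * a) (isE_X p0)) (isE_cst (a ^+ 2) p0)).
rewrite (_ : _ + _ = (th + k * (p - th) - y) ^+ 2 + k ^+ 2 * p); last by rewrite /a; ring.
by apply: isE_ext => z _; rewrite /a; ring.
Qed.

End EtaLimit.

(** * The value of the adaptive chain near a regular point *)

Section AdaptiveChain.
Context {R : realType}.
Variable theta0 : R.
Hypothesis theta0_gt0 : 0 < theta0.
Variables (kap rho : nat -> R).
Hypothesis kap_lt1 : forall n, 0 <= kap n < 1.
Hypothesis rho_ge0 : forall n, 0 <= rho n.
Hypothesis kap_rho : forall n, kap n ^+ 2 + rho n.+1 <= rho n.
Hypothesis cvg_kap : kap n @[n --> \oo] --> 0.
Implicit Types (m n j : nat) (a c d e k u v w x y z th p B L M X : R).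
Local Notation llr := (llr theta0).
Local Notation step := (chain_step theta0 kap).
Local Notation V_upto := (value_upto theta0 id kap (@expR R)).
Local Notation V := (value theta0 id kap (@expR R)).
Local Notation V0_upto := (value_upto theta0 id (fun=> 0) (@expR R)).

Let exp0 x : x <= 0 -> 0 <= expR x. Proof. by move=> _; exact: expR_ge0. Qed.
Let idp th : 0 < th -> 0 < id th. Proof. by []. Qed.

Lemma llr_cvg (thk : nat -> R) y z : 0 < y -> thk j @[j --> \oo] --> y ->
  llr (thk j) z @[j --> \oo] --> llr y z.
Proof.
move=> y0 cth; rewrite /llr; apply: cvgD.
  by apply: cvgM; [apply: cvgB => //; exact: cvg_cst|exact: cvg_cst].
by apply: cvgB; [exact: cvg_cst|exact: cvg_lgam].
Qed.

(** For y != theta0 the map [llr y] is injective on the positive axis, so a single observation can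
    put the walk exactly on the boundary. *)
Lemma llr_root y x z : y != theta0 -> 0 < z ->
  z != expR ((x - (lgam theta0 - lgam y)) / (y - theta0)) -> x - llr y z != 0.
Proof.
move=> yt z0; apply: contraNneq => /eqP; rewrite subr_eq0 => /eqP ->.
rewrite /llr addrK mulrAC mulfV ?subr_eq0// mul1r.
by rewrite lnK ?posrE.
Qed.

(** Over a fixed number of steps at a late clock the gains vanish and the estimate looks frozen. The
    limit x must differ from 0, where the payoff is discontinuous; in the induction this fails for
    one observation only, the exceptional point allowed by [cvg_Ex]. *)
Lemma value_upto_cvg m (nk : nat -> nat) (thk xk : nat -> R) y x :
  0 < y -> y != theta0 -> x != 0 ->
  (forall j, 0 < thk j) -> nk j @[j --> \oo] --> \oo ->
  thk j @[j --> \oo] --> y -> xk j @[j --> \oo] --> x ->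
  V_upto m (nk j) (thk j, xk j) @[j --> \oo] --> V0_upto m 0%N (y, x).
Proof.
move=> y0 yt.
have stop m' (nk' : nat -> nat) (thk' xk' : nat -> R) x' : x' < 0 ->
    xk' j @[j --> \oo] --> x' ->
    V_upto m' (nk' j) (thk' j, xk' j) @[j --> \oo] --> V0_upto m' 0%N (y, x').
  move=> x0 cx; rewrite value_upto_stop ?ltW//=.
  apply: (@cvg_trans _ ((expR (xk' j))%:E @[j --> \oo])).
    apply: near_eq_cvg; apply: filterS (cvgr_lt _ cx _ x0) => j hj.
    by rewrite [RHS]value_upto_stop ?ltW.
  apply: cvg_EFin; first exact: nearW.
  by apply: continuous_cvg => //; exact: continuous_expR.
elim: m nk thk xk x => [|m ih] nk thk xk x xn0 th0 cn cth cx;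
  (have [x0|x0] := ltP x 0; last have {x0} x0 : 0 < x by rewrite lt_neqAle eq_sym xn0).
- exact: stop.
- rewrite value_upto_go0//; apply: (@cvg_trans _ (0%E @[j --> \oo])); last exact: cvg_cst.
  apply: near_eq_cvg; apply: filterS (cvgr_gt _ cx _ x0) => j hj.
  by rewrite [RHS]value_upto_go0.
- exact: stop.
rewrite value_upto_go//; apply: (@cvg_trans _
   (Ex (thk j) (fun z => V_upto m (nk j).+1 (step (nk j) (thk j, xk j) z)) @[j --> \oo])).
  apply: near_eq_cvg; apply: filterS (cvgr_gt _ cx _ x0) => j hj.
  by rewrite [RHS]value_upto_go.
apply: (@cvg_Ex _ _ _ _ _ (expR ((x - (lgam theta0 - lgam y)) / (y - theta0)))) => //.
- by move=> j; apply: measurable_value_upto_step.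
- by apply: measurable_value_upto_step.
- move=> j z z0; rewrite value_upto_ge0//=.
  apply: value_upto_le1 => //; first by move=> x' x'0; exact: expR_nonpos_le1.
  exact: (@step_gt0 R theta0 kap kap_lt1 (nk j) (thk j, xk j) z (th0 j) z0).
- by move=> z z0; exact: value_upto_ge0.
move=> z z0 zn0; rewrite /chain_step/= mul0r addr0 (value_upto_kap0 _ _ _ _ _ 0%N).
apply: (ih (fun j => (nk j).+1) (fun j => thk j + kap (nk j) * (z - thk j))
  (fun j => xk j - llr (thk j) z)).
- exact: llr_root.
- by move=> j; exact: (@step_gt0 R theta0 kap kap_lt1 (nk j) (thk j, xk j) z (th0 j) z0).
- move=> A [N _ NA]; have hN : nbhs \oo [set n | (N <= n)%N] by exists N.
  apply: (@filterS _ \oo _ [set j | (N <= nk j)%N]); last exact: (cn _ hN).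
  by move=> j hj; apply: NA; rewrite /= leqW.
- rewrite -[X in _ --> X]addr0 -(mul0r (z - y)); apply: cvgD => //.
  apply: cvgM; first by apply: cvg_comp cn _; exact: cvg_kap.
  by apply: cvgB => //; exact: cvg_cst.
- by apply: cvgB => //; exact: llr_cvg.
Qed.

(** A step adds variance kap^2 th to (th - y)^2, and the decrease of th [rho] pays for it. The first
    error term is thus superharmonic and bounds the chance of ever leaving the d-ball around y;
    inside the ball the second one bounds the chance of running beyond m steps. *)
Lemma value_tail y : 0 < y -> y != theta0 -> exists d r, [/\ 0 < d, 0 < r, r < 1 &
  forall m n th x, 0 < th -> (V n (th, x) <= V_upto m n (th, x) +
    (((th - y) ^+ 2 + th * rho n) / d ^+ 2 + expR (2^-1 * x) * r ^+ m)%:E)%E].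
Proof.
move=> y0 yt.
have [c [r [B [c0 r0 r1 B0 loc]]]] := llr_local theta0_gt0 y0 yt.
have [d /= d0 dloc] := loc; exists d, r; split => // m n th x th0.
pose Reg n (s : R * R) := `|s.1 - y| < d /\ 0 < s.2.
pose U m n (s : R * R) :=
  ((s.1 - y) ^+ 2 + s.1 * rho n) / d ^+ 2 + expR (2^-1 * s.2) * r ^+ m.
have U1 n' (s : R * R) : 0 < s.1 -> 0 <= ((s.1 - y) ^+ 2 + s.1 * rho n') / d ^+ 2.
  by move=> s0; rewrite divr_ge0 ?sqr_ge0// addr_ge0 ?sqr_ge0// mulr_ge0// ltW.
have U2 m' (s : R * R) : 0 <= expR (2^-1 * s.2) * r ^+ m'.
  by rewrite mulr_ge0 ?expR_ge0// exprn_ge0// ltW.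
apply: (verif_tail (Reg := Reg) (U := U) _ _ exp0 idp kap_lt1) => //.
- by move=> m' n' s s0; rewrite /U addr_ge0 ?U1.
- move=> m' n' [s1 s2] /= s10 [/= h s20].
  have [|_ h1 _ _ _] := dloc s1; first by rewrite /= distrC.
  have [w1 w1l w1E] := isE_half_geom m' s2 s10 h1 r0.
  have v := isED (isEZ ((d ^+ 2)^-1) (isED (isE_step_sqr (kap n') s1 y s10)
    (isEZ (rho n'.+1) (isE_step (kap n') s1 s10)))) w1E.
  refine (ex_intro2 _ _ _ _ (isE_ext _ v)); last first.
    by move=> z _; rewrite /U /= mulrC (mulrC (rho _)).
  rewrite /U /= lerD// [leRHS]mulrC ler_wpM2l ?invr_ge0 ?sqr_ge0//.
  rewrite subrr mulr0 addr0.
  by rewrite -addrA lerD2l -mulrDl mulrC ler_wpM2l ?(ltW s10).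
- exact: expR_nonpos_le1.
- move=> m' n' s s0 s20 nr; rewrite /U.
  apply: (@le_trans _ _ (((s.1 - y) ^+ 2 + s.1 * rho n') / d ^+ 2)).
    2: by rewrite lerDl U2.
  rewrite ler_pdivlMr ?exprn_gt0// mul1r.
  have h : d <= `|s.1 - y| by rewrite leNgt; apply/negP => h; apply: nr.
  rewrite -(real_normK (num_real (s.1 - y))) -[leLHS]addr0 lerD//.
    by rewrite ler_pXn2r ?nnegrE// ltW.
  by rewrite mulr_ge0// ltW.
- move=> n' s s0 [_ s20]; rewrite /U expr0 mulr1.
  apply: le_trans (_ : 1 <= expR (2^-1 * s.2)) _.
    by rewrite -[leLHS]expR0 ler_expR mulr_ge0// ltW.
  by rewrite lerDr U1.
Qed.

Lemma real01 (t : \bar R) : (0 <= t)%E -> (t <= 1)%E ->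
  exists r : R, [/\ 0 <= r, r <= 1 & t = r%:E].
Proof. by case: t => // r; rewrite !lee_fin => r0 r1; exists r. Qed.

Lemma value_real n th x : 0 < th -> exists r : R, [/\ 0 <= r, r <= 1 & V n (th, x) = r%:E].
Proof.
move=> th0; apply: real01; first exact: value_ge0.
by apply: value_le1 => // x' x'0; exact: expR_nonpos_le1.
Qed.

Lemma value_upto_real m n th x : 0 < th ->
  exists r : R, [/\ 0 <= r, r <= 1 & V_upto m n (th, x) = r%:E].
Proof.
move=> th0; apply: real01; first exact: value_upto_ge0.
by apply: value_upto_le1 => // x' x'0; exact: expR_nonpos_le1.
Qed.

Lemma cvg_subseq0 (f : nat -> nat) (u : nat -> R) (l : R) :
  {homo f : m n / (m < n)%N} -> u n @[n --> \oo] --> l -> u (f n) @[n --> \oo] --> l.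
Proof.
move=> fi ul; have fge n : (n <= f n)%N.
  by elim: n => // n ih; apply: (leq_ltn_trans ih); exact: fi.
apply: cvg_comp ul => A [N _ NA]; exists N => // n /= Nn; apply: NA => /=.
exact: leq_trans (fge n).
Qed.

End AdaptiveChain.

Section AdaptiveLimit.
Context {R : realType}.
Variable theta0 : R.
Hypothesis theta0_gt0 : 0 < theta0.
Variables (kap rho : nat -> R).
Hypothesis kap_lt1 : forall n, 0 <= kap n < 1.
Hypothesis rho_ge0 : forall n, 0 <= rho n.
Hypothesis kap_rho : forall n, kap n ^+ 2 + rho n.+1 <= rho n.
Hypothesis cvg_kap : kap n @[n --> \oo] --> 0.
Hypothesis cvg_rho : rho n @[n --> \oo] --> 0.
Implicit Types (m n j : nat) (a b c d e k u v w x y z th p B L M X : R).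
Local Notation iid_value := (iid_value theta0).
Local Notation step := (chain_step theta0 kap).
Local Notation V := (value theta0 id kap (@expR R)).
Local Notation V0_upto := (value_upto theta0 id (fun=> 0) (@expR R)).
Local Notation eta_lim := (eta_lim theta0).

Let exp0 x : x <= 0 -> 0 <= expR x. Proof. by move=> _; exact: expR_ge0. Qed.
Let idp th : 0 < th -> 0 < id th. Proof. by []. Qed.

Lemma value_close_seq y (nk : nat -> nat) (thk xk : nat -> R) x e :
  0 < y -> y != theta0 -> 0 < x -> 0 < e ->
  (forall j, 0 < thk j) -> nk j @[j --> \oo] --> \oo ->
  thk j @[j --> \oo] --> y -> xk j @[j --> \oo] --> x ->
  \forall j \near \oo,
    `|fine (V (nk j) (thk j, xk j)) - fine (iid_value y (xk j))| <= e.
Proof.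
move=> y0 yt x0 e0 th0 cn cth cx.
have zz (n : nat) : (fun=> 0 : R) n ^+ 2 + (fun=> 0 : R) n.+1 <= (fun=> 0 : R) n.
  by rewrite expr0n addr0.
have [d1 [r1 [d10 r10 r11 tl1]]] :=
  value_tail theta0_gt0 kap_lt1 rho_ge0 kap_rho y0 yt.
have [d2 [r2 [d20 r20 r21 tl2]]] :=
  value_tail theta0_gt0 (@kap0_lt1 R) (fun n : nat => lexx (0 : R)) zz y0 yt.
have [m [m1 m2]] : exists m, expR (2^-1 * (x + 1)) * r1 ^+ m <= e / 8 /\
    expR (2^-1 * (x + 1)) * r2 ^+ m <= e / 8.
  have small r : 0 < r -> r < 1 -> \forall m \near \oo, expR (2^-1 * (x + 1)) * r ^+ m <= e / 8.
    move=> r0 rl; apply: (cvgr_le 0); last by rewrite divr_gt0.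
    rewrite -[X in _ --> X](mulr0 (expR (2^-1 * (x + 1)))).
    by apply: cvgM; [exact: cvg_cst|apply: cvg_expr; rewrite ger0_norm ?ltW].
  by have [m _ h] := filterI (small r1 r10 r11) (small r2 r20 r21); exists m; apply: (h m) => /=.
have c1 := value_upto_cvg kap_lt1 cvg_kap (m := m) y0 yt (lt0r_neq0 x0) th0 cn cth cx.
(* The same continuity lemma with zero gain: both truncated values, taken at the moving point
   [xk j], have the common limit at x. *)
have c2 : V0_upto m j (y, xk j) @[j --> \oo] --> V0_upto m 0%N (y, x).
  apply: (value_upto_cvg (@kap0_lt1 R) _ y0 yt (lt0r_neq0 x0) (fun=> y0) _ _ cx).
  - exact: cvg_cst.
  - exact: cvg_id.
  - exact: cvg_cst.
have [l [l0 l1 lE]] := value_upto_real theta0 (@kap0_lt1 R) m 0%N x y0.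
rewrite !lE in c1 c2.
move/fine_cvgP: c1 => [_ /cvgrPdist_le/(_ _ (divr_gt0 e0 (ltr0n R 8))) c1].
move/fine_cvgP: c2 => [_ /cvgrPdist_le/(_ _ (divr_gt0 e0 (ltr0n R 8))) c2].
have c3 : \forall j \near \oo,
    ((thk j - y) ^+ 2 + thk j * rho (nk j)) / d1 ^+ 2 <= e / 8.
  apply: (cvgr_le 0); last by rewrite divr_gt0.
  rewrite -[X in _ --> X](mul0r ((d1 ^+ 2)^-1)); apply: cvgM; last exact: cvg_cst.
  rewrite -[X in _ --> X]addr0; apply: cvgD.
    rewrite -[X in _ --> X](mul0r (0 : R)); under eq_fun do rewrite expr2.
    by apply: cvgM; rewrite -(subrr y); apply: cvgB => //; exact: cvg_cst.
  rewrite -[X in _ --> X](mulr0 y); apply: cvgM => //.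
  by apply: cvg_comp cn _; exact: cvg_rho.
have c4 : \forall j \near \oo, xk j <= x + 1 by apply: (cvgr_le _ cx); rewrite ltrDl.
apply: filterS2 (filterI c1 c2) (filterI c3 c4) => j [/= a1 a2] [/= a3 a4].
have [t1 [_ _ t1E]] := value_upto_real theta0 kap_lt1 m (nk j) (xk j) (th0 j).
have [t2 [_ _ t2E]] := value_upto_real theta0 (@kap0_lt1 R) m j (xk j) y0.
have [v1 [_ _ v1E]] := value_real theta0 kap_lt1 (nk j) (xk j) (th0 j).
have [v2 [_ _ v2E]] := iid_value_real theta0 (xk j) y0.
rewrite t1E in a1; rewrite t2E in a2.
have := tl1 m (nk j) _ (xk j) (th0 j); have := tl2 m j _ (xk j) y0.
have := le_value_upto_value theta0 id kap exp0 m (nk j) (thk j, xk j).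
have := le_value_upto_value theta0 id (fun=> 0) exp0 m j (y, xk j).
rewrite (value_kap0 _ _ _ j 0) -/(iid_value y (xk j)) t1E t2E v1E v2E -!EFinD !lee_fin.
rewrite mulr0 subrr expr0n addr0 mul0r add0r /= => b2 b1 b4 b3.
have ex : expR (2^-1 * xk j) <= expR (2^-1 * (x + 1)) by rewrite ler_expR ler_wpM2l.
have e1 : expR (2^-1 * xk j) * r1 ^+ m <= e / 8.
  by apply: (le_trans _ m1); rewrite ler_wpM2r// exprn_ge0// ltW.
have e2 : expR (2^-1 * xk j) * r2 ^+ m <= e / 8.
  by apply: (le_trans _ m2); rewrite ler_wpM2r// exprn_ge0// ltW.
move: a1 a2; rewrite /= !ler_norml => /andP[a11 a12] /andP[a21 a22].
by apply/andP; split; clear -a11 a12 a21 a22 a3 b1 b2 b3 b4 e1 e2 e0; lra.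
Qed.

(** Uniformity by compactness: along a sequence of counterexamples the distances have a convergent
    subsequence, against [value_close_seq]. The bound a > 0 keeps their limit off the boundary. *)
Lemma value_close y a b e : 0 < y -> y != theta0 -> 0 < a -> 0 < e ->
  exists d n1, 0 < d /\ forall n th x, (n1 <= n)%N -> 0 < th -> `|th - y| < d ->
    a <= x <= b -> `|fine (V n (th, x)) - fine (iid_value y x)| <= e.
Proof.
move=> y0 yt a0 e0; apply: contrapT => hn.
have bad j : exists p : nat * (R * R), [/\ (j <= p.1)%N, 0 < p.2.1,
    `|p.2.1 - y| < j.+1%:R^-1, a <= p.2.2 <= b &
    e < `|fine (V p.1 p.2) - fine (iid_value y p.2.2)|].
  apply: contrapT => hj; apply: hn; exists (j.+1%:R^-1), j; split=> //.
  move=> n th x nj th0 hth hx; rewrite leNgt; apply/negP => h.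
  by apply: hj; exists (n, (th, x)).
have [f fP] := choice bad.
have bx : bounded_fun (fun j => (f j).2.2).
  exists b; split; first exact: num_real.
  move=> M bM j _ /=; have [_ _ _ /andP[h1 h2] _] := fP j.
  by rewrite ger0_norm ?(le_trans (ltW a0))// ltW// (le_lt_trans h2).
have [g gi /cvg_ex[/= x cx]] := bolzano_weierstrass bx.
have gh : {homo g : m n / (m < n)%N} by move=> m n; rewrite (leqW_mono gi).
have ax : a <= x by apply: (cvgr_to_ge cx); apply: nearW => j; have [_ _ _ /andP[]] := fP (g j).
have gj j : (j <= g j)%N.
  by elim: j => // j ih; apply: (leq_ltn_trans ih); exact: gh.
have := @value_close_seq y (fun j => (f (g j)).1) (fun j => (f (g j)).2.1)
  (fun j => (f (g j)).2.2) x e y0 yt (lt_le_trans a0 ax) e0.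
case=> [j|A [N _ NA]|||N _ hN].
- by have [] := fP (g j).
- exists N => // j /= Nj; apply: NA => /=; have [h _ _ _ _] := fP (g j).
  exact: leq_trans (leq_trans (gj j) h).
- apply: (@cvg_subseq0 R g (fun j => (f j).2.1) y gh).
  apply/cvgrPdist_lt => d d0; have /cvgrPdist_lt/(_ d d0) := @cvg_harmonic R.
  apply: filterS => j /=; rewrite sub0r normrN ger0_norm ?invr_ge0// => h.
  by rewrite distrC; have [_ _ h2 _ _] := fP j; exact: lt_trans h.
- exact: cx.
have /= := hN N (leqnn N); rewrite leNgt => /negP; apply.
by have [_ _ _ _] := fP (g N); case: (f (g N)) => n [].
Qed.

(** Extends [value_close] from a bounded window to all large x. A chain started far away reaches the
    window with its estimate still near y, up to the error [W], and without jumping over it, up to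
    [osf]; in the window the value is within e / 2 of the limit. *)
Lemma value_near_eta y e : 0 < y -> y != theta0 -> 0 < e ->
  exists X d n1, 0 < d /\ forall n th x, (n1 <= n)%N -> 0 < th -> `|th - y| < d ->
    X <= x -> `|fine (V n (th, x)) - eta_lim y| <= e.
Proof.
move=> y0 yt e0.
have [c [r [B [c0 r0 r1 B0 loc]]]] := llr_local theta0_gt0 y0 yt.
have [d0 /= d00 dloc] := loc.
have e4 : 0 < e / 4 by rewrite divr_gt0.
have [X1 tl] := eta_lim_tail theta0_gt0 y0 yt e4.
have /andP[E0 E1] := eta_lim01 theta0_gt0 y0 yt.
set E := eta_lim y in tl E0 E1 *.
pose x0 := B / (c * (c * (1 - r))).
have x00 : 0 < x0 by rewrite divr_gt0 ?mulr_gt0 ?subr_gt0.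
pose L := 8 / (e * (2 * c)).
have L0 : 0 < L by rewrite divr_gt0 ?mulr_gt0.
have cL : 2 * expR (- (2 * c * L)) <= e / 4.
  have e8 : 2 * c * L = 8 / e by rewrite /L; field; rewrite ?gt_eqF.
  rewrite e8; have := expRN_le (divr_gt0 (ltr0n _ 8) e0 : 0 < 8 / e :> R).
  by rewrite invf_div; lra.
pose X := Num.max X1 1 + L.
have X1L : X1 <= X - L by rewrite /X addrK le_max lexx.
have XL0 : 0 < X - L by rewrite /X addrK lt_max ltr01 orbT.
have [d1 [n1 [d10 cl]]] := value_close (X + x0) y0 yt XL0 e4.
pose d := Num.min d0 d1; have dp : 0 < d by rewrite lt_min d00 d10.
pose Reg n (s : R * R) := [/\ (n1 <= n)%N, `|s.1 - y| < d & x0 < s.2 - X].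
pose W n (s : R * R) := ((s.1 - y) ^+ 2 + s.1 * rho n) / d ^+ 2.
pose U m n (s : R * R) := if (n1 <= n)%N then
  e / 2 + (W n s + (osf c L (s.2 - X) + expR (2^-1 * s.2) * r ^+ m)) else 1.
have W0 n (s : R * R) : 0 < s.1 -> 0 <= W n s.
  by move=> s0; rewrite divr_ge0 ?sqr_ge0// addr_ge0 ?sqr_ge0// mulr_ge0// ltW.
have G0 m (s : R * R) : 0 <= expR (2^-1 * s.2) * r ^+ m.
  by rewrite mulr_ge0 ?expR_ge0// exprn_ge0// ltW.
have U_ge0 m n (s : R * R) : 0 < s.1 -> 0 <= U m n s.
  move=> s0; rewrite /U; case: ifP => // _.
  have := W0 n s s0; have := G0 m s; have := osf_ge0 c L (s.2 - X).
  by move: e0; clear; lra.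
have Reg_gt0 n (s : R * R) : Reg n s -> 0 < s.2.
  by case=> _ _; move: XL0 L0 x00; lra.
have UE m n (s : R * R) : 0 < s.1 -> Reg n s -> exists2 w, w <= U m.+1 n s &
    isE (id s.1) (fun z => U m n.+1 (step n s z)) w.
  case: s => s1 s2 /= s10 [/= nn h hx].
  have [|_ h1 _ h2 h3] := dloc s1.
    by rewrite /= distrC; apply: lt_le_trans h _; rewrite /d ge_min lexx.
  have [w1 w1l w1E] := isE_half_geom m s2 s10 h1 r0.
  have [w2 w2l w2E] := isE_osf L s10 c0 h2 h3 (osf_threshold c0 r1 B0 (ltW hx)).
  have v := isED (isE_cst (e / 2) s10) (isED (isEZ ((d ^+ 2)^-1)
    (isED (isE_step_sqr (kap n) s1 y s10)
    (isEZ (rho n.+1) (isE_step (kap n) s1 s10)))) (isED w2E w1E)).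
  refine (ex_intro2 _ _ _ _ (isE_ext _ v)); last first.
    move=> z _; rewrite /U (leqW nn) /W/= (addrAC s2).
    by rewrite [X in e / 2 + (X + _)]mulrC (mulrC (rho _)).
  rewrite /U nn /W/= lerD2l lerD// ?lerD// [leRHS]mulrC ler_wpM2l ?invr_ge0 ?sqr_ge0//.
  rewrite subrr mulr0 addr0.
  by rewrite -addrA lerD2l -mulrDl mulrC ler_wpM2l ?(ltW s10).
have tri m n (s : R * R) : 0 < s.1 -> ~ Reg n s ->
    1 <= U m n s \/ (`|fine (V n s) - E| <= U m n s).
  move=> s0 nr; have [nn|nn] := leqP n1 n; last first.
    by left; rewrite /U leqNgt nn.
  rewrite /U nn; have w0 := W0 n s s0; have g0 := G0 m s.
  have o0 := osf_ge0 c L (s.2 - X).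
  have [h|h] := leP d `|s.1 - y|.
    left; have : 1 <= W n s.
      rewrite /W ler_pdivlMr ?exprn_gt0// mul1r.
      rewrite -(real_normK (num_real (s.1 - y))) -[leLHS]addr0 lerD//.
        by rewrite ler_pXn2r ?nnegrE// ltW.
      by rewrite mulr_ge0// ltW.
    by move: o0 g0 e0; clear; lra.
  have [hl|hl] := leP (s.2 - X) (- L).
    left; have := osf_ge1 (ltW c0) (ltW L0) hl.
    by move: w0 g0 e0; clear; lra.
  right; have hx : s.2 - X <= x0.
    by rewrite leNgt; apply/negP => hx; apply: nr; split.
  have c1 : `|fine (V n s) - fine (iid_value y s.2)| <= e / 4.
    rewrite [s in V n s]surjective_pairing; apply: cl => //.
      by apply: lt_le_trans h _; rewrite /d ge_min lexx orbT.
    by apply/andP; split; move: hl hx; lra.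
  have c2 : `|fine (iid_value y s.2) - E| <= e / 4.
    by apply: tl; move: hl X1L; lra.
  have := ler_normD (fine (V n s) - fine (iid_value y s.2)) (fine (iid_value y s.2) - E).
  by rewrite addrA subrK; move: c1 c2 w0 g0 o0; clear; lra.
have base n (s : R * R) : 0 < s.1 -> Reg n s -> 1 <= U 0%N n s.
  move=> s0 rg; have s20 := Reg_gt0 n s rg; case: rg => nn _ _.
  rewrite /U nn expr0 mulr1.
  have : 1 <= expR (2^-1 * s.2) by rewrite -[leLHS]expR0 ler_expR mulr_ge0// ltW.
  have := W0 n s s0; have := osf_ge0 c L (s.2 - X); by move: e0; clear; lra.
have Vr n (s : R * R) : 0 < s.1 ->
    exists t : R, [/\ 0 <= t, t <= 1 & V n s = t%:E].
  by case: s => s1 s2 s0; exact: value_real.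
have up1 m n (s : R * R) : 0 < s.1 -> ~ Reg n s -> (V n s <= (E + U m n s)%:E)%E.
  move=> s0 nr; have [t [t0 t1 tE]] := Vr n s s0; rewrite tE lee_fin.
  have [h|] := tri m n s s0 nr; first by move: t1 h E0; clear; lra.
  by rewrite tE /= ler_norml => /andP[_]; clear; lra.
have up0 n (s : R * R) : 0 < s.1 -> Reg n s -> (V n s <= (E + U 0%N n s)%:E)%E.
  move=> s0 rg; have [t [t0 t1 tE]] := Vr n s s0; rewrite tE lee_fin.
  by have := base n s s0 rg; move: t1 E0; clear; lra.
have lo1 m n (s : R * R) : 0 < s.1 -> ~ Reg n s -> (E%:E <= V n s + (U m n s)%:E)%E.
  move=> s0 nr; have [t [t0 t1 tE]] := Vr n s s0; rewrite tE -EFinD lee_fin.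
  have [h|] := tri m n s s0 nr; first by move: t0 h E1; clear; lra.
  by rewrite tE /= ler_norml => /andP[+ _]; clear; lra.
have lo0 n (s : R * R) : 0 < s.1 -> Reg n s -> (E%:E <= V n s + (U 0%N n s)%:E)%E.
  move=> s0 rg; have [t [t0 t1 tE]] := Vr n s s0; rewrite tE -EFinD lee_fin.
  by have := base n s s0 rg; move: t0 E1; clear; lra.
have HU := verif_upper (@measurable_id _ _ setT) (@measurable_expR R) exp0 idp
  kap_lt1 Reg_gt0 UE E0 up1 up0.
have HL := verif_lower (@measurable_id _ _ setT) (@measurable_expR R) exp0 idp
  kap_lt1 Reg_gt0 U_ge0 UE E0 lo1 lo0.
(* Each of the two terms of [W], before division by d^2, will be at most k, so that [W] is at most e
   / 8. *)
pose k := d ^+ 2 * e / 16; have k0 : 0 < k by rewrite !mulr_gt0 ?exprn_gt0.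
have [n2 hn2] : exists n2, forall n, (n2 <= n)%N -> rho n * (y + 1) <= k.
  have : \forall n \near \oo, rho n * (y + 1) <= k.
    apply: (cvgr_le 0) => //; rewrite -[X in _ --> X](mul0r (y + 1)).
    by apply: cvgM; [exact: cvg_rho|exact: cvg_cst].
  by move=> [n2 _ h]; exists n2 => n /h.
exists X, (Num.min 1 k), (maxn n1 n2); split; first by rewrite lt_min ltr01.
move=> n th x; rewrite geq_max lt_min => /andP[nn1 nn2] th0 /andP[h1 hk] Xx.
have [t [t0 t1 tE]] := value_real theta0 kap_lt1 n x th0.
have ob := osf_le L (ltW c0) (_ : 0 <= x - X); rewrite subr_ge0 in ob; have {}ob := ob Xx.
have Wb : W n (th, x) <= e / 8.
  rewrite /W /= ler_pdivrMr ?exprn_gt0//.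
  have a1 : (th - y) ^+ 2 <= k.
    rewrite -(real_normK (num_real _)) expr2.
    apply: (@le_trans _ _ (1 * k)); last by rewrite mul1r.
    by rewrite ler_pM// ltW.
  have a2 : th * rho n <= k.
    apply: le_trans (hn2 n nn2); rewrite mulrC ler_wpM2l//.
    by move: (le_lt_trans (ler_norm _) h1); lra.
  have : k + k = e / 8 * d ^+ 2 by rewrite /k; field.
  by move: a1 a2; lra.
have b1 : t <= E + e.
  apply: (@le_geom _ _ _ (expR (2^-1 * x)) r) => // m.
  have := HU m n (th, x) th0; rewrite tE lee_fin /U nn1/=.
  by move: e0 ob cL Wb; clear; lra.
have b2 : E <= t + e.
  apply: (@le_geom _ _ _ (expR (2^-1 * x)) r) => // m.
  have := HL m n (th, x) th0; rewrite tE -EFinD lee_fin /U nn1/=.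
  by move: e0 ob cL Wb; clear; lra.
by rewrite tE /= ler_norml; apply/andP; split; move: b1 b2; lra.
Qed.

End AdaptiveLimit.

Section EtaContinuous.
Context {R : realType}.
Variable theta0 : R.
Hypothesis theta0_gt0 : 0 < theta0.

Lemma continuous_eta_lim (y : R) : 0 < y -> y != theta0 ->
  {for y, continuous (eta_lim theta0)}.
Proof.
move=> y0 yt; apply/cvgrPdist_le => e e0.
have zz (n : nat) : (fun=> 0 : R) n ^+ 2 + (fun=> 0 : R) n.+1 <= (fun=> 0 : R) n.
  by rewrite expr0n addr0.
have [X [d [n1 [d0 h]]]] := value_near_eta theta0_gt0 (@kap0_lt1 R)
  (fun n : nat => lexx (0 : R)) zz (cvg_cst _) (cvg_cst _) y0 yt e0.
near=> th.
have th0 : 0 < th by near: th; exact: lt_nbhsr.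
have tt : th != theta0.
  near: th; exists `|y - theta0|; first by rewrite /= normr_gt0 subr_eq0.
  by move=> z /=; apply: contraTneq => ->; rewrite ltxx.
have thd : `|th - y| < d by near: th; exists d => //= z; rewrite /= distrC.
rewrite distrC ler_norml; apply/andP; split.
- rewrite lerBrDl; apply: (cvgr_to_ge (cvg_eta_lim theta0_gt0 th0 tt)).
  near=> x; have := h n1 th x (leqnn _) th0 thd _.
  rewrite (value_kap0 _ _ _ _ 0) ler_norml => H.
  have /H/andP[+ _] : X <= x by near: x; exact: nbhs_pinfty_ge (num_real _).
  by rewrite /iid_value; clear; lra.
- rewrite lerBlDl; apply: (cvgr_to_le (cvg_eta_lim theta0_gt0 th0 tt)).
  near=> x; have := h n1 th x (leqnn _) th0 thd _.
  rewrite (value_kap0 _ _ _ _ 0) ler_norml => H.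
  have /H/andP[_] : X <= x by near: x; exact: nbhs_pinfty_ge (num_real _).
  by rewrite /iid_value; clear; lra.
Unshelve. all: by end_near. Qed.

End EtaContinuous.

(** * Where the estimates settle *)

Section AdaptiveWeights.
Context {R : realType}.
Variable t : R.
Hypothesis t0 : 0 <= t.
Implicit Types (m n j : nat).

(** Clock n means that n + 1 observations have been used: [rho n] is the inverse of their total
    weight n + 1 + t, and [kap n] the weight of the next observation. The first estimate stays
    outside, as it does not obey the recursion when s or t vanishes. *)
Definition rho n : R := (n%:R + 1 + t)^-1.
Definition kap n : R := rho n.+1.

Lemma rho_den_gt0 n : 0 < n%:R + 1 + t.
Proof. by rewrite ltr_pwDl// ltr_wpDl. Qed.

Lemma rho_gt0 n : 0 < rho n.
Proof. by rewrite invr_gt0 rho_den_gt0. Qed.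

Lemma kap_rho_eq n : 1 - kap n = kap n / rho n.
Proof.
rewrite /kap /rho invrK -natr1; have := rho_den_gt0 n.+1; have := rho_den_gt0 n.
by rewrite -natr1 => a b; field; rewrite gt_eqF.
Qed.

Lemma kap_gt0 n : 0 < kap n. Proof. exact: rho_gt0. Qed.

Lemma kap_le_inv n : kap n <= n.+2%:R^-1.
Proof.
rewrite /kap /rho lef_pV2 ?posrE ?rho_den_gt0//.
by rewrite -natr1 lerDl.
Qed.

Lemma kap_bounds n : 0 <= kap n < 1.
Proof.
rewrite (ltW (kap_gt0 n))/=; apply: le_lt_trans (kap_le_inv n) _.
by rewrite invf_lt1// ltr1n.
Qed.

Lemma kap_rho_le n : kap n ^+ 2 + rho n.+1 <= rho n.
Proof.
have -> : kap n ^+ 2 + rho n.+1 = kap n * (1 + kap n) by rewrite /kap; ring.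
have r0 := rho_gt0 n; have k0 := kap_gt0 n; have /andP[_ k1] := kap_bounds n.
have e : kap n = (1 - kap n) * rho n by rewrite kap_rho_eq mulfVK ?gt_eqF.
rewrite {1}e mulrAC -[leRHS]mul1r ler_wpM2r ?(ltW r0)//.
by have := sqr_ge0 (kap n); lra.
Qed.

Lemma rho_ge0 n : 0 <= rho n. Proof. exact/ltW/rho_gt0. Qed.

(** With [kap_rho_le] this pins the variance still to come, a sum of squares of [kap], between
    [rho n.+1] and [rho n]. The lower bound is what keeps the estimates from settling at a given
    point. *)
Lemma rhoS_sub n : rho n.+1 - rho n.+2 <= kap n ^+ 2.
Proof.
rewrite /kap; have := rho_gt0 n.+1; have k0 := kap_gt0 n.+1.
have : rho n.+2 = (1 - rho n.+2) * rho n.+1.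
  by rewrite -/(kap n.+1) kap_rho_eq mulfVK ?gt_eqF ?rho_gt0.
have := kap_rho_le n.+1; rewrite /kap; move: (rho n.+1) (rho n.+2) => a b; nra.
Qed.

Lemma cvg_rho : rho n @[n --> \oo] --> 0.
Proof.
apply: (@squeeze_cvgr _ _ _ _ (fun=> 0) (@harmonic R)); last exact: cvg_harmonic.
  apply: nearW => n; rewrite rho_ge0/= /harmonic lef_pV2 ?posrE ?rho_den_gt0//.
  by rewrite natr1 lerDl.
exact: cvg_cst.
Qed.

Lemma cvg_kap : kap n @[n --> \oo] --> 0.
Proof. by rewrite /kap (cvg_shiftS rho); exact: cvg_rho. Qed.

Lemma sum_rho_unbounded M : exists m, M <= \sum_(j < m) rho j.
Proof.
apply: contrapT => h; have {}h m : \sum_(j < m) rho j < M.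
  by rewrite ltNge; apply/negP => hm; apply: h; exists m.
apply: (@dvg_harmonic R); apply: nondecreasing_is_cvgn.
  apply/nondecreasing_seqP => n; rewrite /series/= big_nat_recr//= lerDl.
  by rewrite /harmonic/= invr_ge0.
exists ((1 + t) * M) => _ [n _ <-] /=; rewrite /series/= big_mkord.
apply: (@le_trans _ _ ((1 + t) * \sum_(j < n) rho j)); last first.
  by rewrite ler_wpM2l ?addr_ge0// ltW.
rewrite mulr_sumr; apply: ler_sum => j _; rewrite /harmonic /rho/=.
rewrite ler_pdivlMr ?rho_den_gt0// mulrC ler_pdivrMr ?ltr0Sn//.
by rewrite -natr1; have := mulr_ge0 t0 (ler0n R j); lra.
Qed.

End AdaptiveWeights.

Section IteratedLaw.
Context {R : realType}.
Variable kap : nat -> R.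
Hypothesis kap_lt1 : forall n, 0 <= kap n < 1.
Implicit Types (m n j : nat) (th x z w : R) (F G : R -> \bar R) (U : nat -> R -> R).

(** The estimates alone under the predictable law, without boundary or stopping. *)
Fixpoint iter_law m n F (th : R) : \bar R :=
  if m is m'.+1 then
    Ex th (fun z => iter_law m' n.+1 F (th + kap n * (z - th)))
  else F th.

Lemma kap_step_gt0 n th z : 0 < th -> 0 < z -> 0 < th + kap n * (z - th).
Proof.
move=> th0 z0; have /andP[k0 k1] := kap_lt1 n.
rewrite (_ : _ + _ = (1 - kap n) * th + kap n * z); last by ring.
by rewrite ltr_pwDl// ?mulr_gt0// ?subr_gt0// mulr_ge0// ltW.
Qed.

Lemma iter_law_ge0 m n F th : (forall z, 0 <= F z)%E -> (0 <= iter_law m n F th)%E.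
Proof.
by move=> F0; elim: m n th => [//|m ih] n th /=; apply: Ex_ge0.
Qed.

Lemma le_iter_law m n F G th : (forall z, 0 <= F z)%E ->
  (forall z, (0 < z)%R -> F z <= G z)%E -> 0 < th ->
  (iter_law m n F th <= iter_law m n G th)%E.
Proof.
move=> F0 FG; elim: m n th => [|m ih] n th th0 /=; first exact: FG.
apply: le_Ex => z z0; last by apply: ih; exact: kap_step_gt0.
exact: iter_law_ge0.
Qed.

Lemma eq_iter_law m n F G th : (forall z, 0 < z -> F z = G z) -> 0 < th ->
  iter_law m n F th = iter_law m n G th.
Proof.
move=> FG; elim: m n th => [|m ih] n th th0 /=; first exact: FG.
by apply: eq_Ex => z z0; apply: ih; exact: kap_step_gt0.
Qed.

Lemma measurable_iter_law m n F : (forall z, 0 <= F z)%E ->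
  measurable_fun [set: R] F -> measurable_fun [set: R] (iter_law m n F).
Proof.
move=> F0 mF; elim: m n => [//|m ih] n.
apply: (@measurable_int_pos R _ _ (fun u : R * R =>
  (gpdf u.1 u.2)%:E * iter_law m n.+1 F (u.1 + kap n * (u.2 - u.1)))%E); last first.
  by move=> u; rewrite mule_ge0 ?iter_law_ge0// lee_fin gpdf_ge0.
apply: emeasurable_funM.
  by apply/measurable_EFinP; exact: measurable_fun_gpdf.
apply: (measurableT_comp (ih n.+1)); apply: measurable_funD => //.
by apply: measurable_funM => //; exact: measurable_funB.
Qed.

Lemma measurable_iter_law_step m n k th F : (forall z, 0 <= F z)%E ->
  measurable_fun [set: R] F ->
  measurable_fun [set: R] (fun z => iter_law m n F (th + kap k * (z - th))).
Proof.
move=> F0 mF; apply: (measurableT_comp (measurable_iter_law m n F0 mF)).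
by apply: measurable_funD => //; apply: measurable_funM => //; exact: measurable_funB.
Qed.

Lemma iter_lawZ m n F th (c : R) : 0 <= c -> (forall z, 0 <= F z)%E ->
  measurable_fun [set: R] F ->
  iter_law m n (fun z => c%:E * F z)%E th = (c%:E * iter_law m n F th)%E.
Proof.
move=> c0 F0 mF; elim: m n th => [//|m ih] n th /=.
rewrite -ExZ//; first by apply: eq_Ex => z _; rewrite ih.
  exact: measurable_iter_law_step.
by move=> z _; exact: iter_law_ge0.
Qed.

Lemma iter_lawD m n F G th : (forall z, 0 <= F z)%E -> (forall z, 0 <= G z)%E ->
  measurable_fun [set: R] F -> measurable_fun [set: R] G ->
  iter_law m n (fun z => F z + G z)%E th = (iter_law m n F th + iter_law m n G th)%E.
Proof.
move=> F0 G0 mF mG; elim: m n th => [//|m ih] n th /=.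
rewrite -ExD//; first by apply: eq_Ex => z _; rewrite ih.
- exact: measurable_iter_law_step.
- exact: measurable_iter_law_step.
- by move=> z _; exact: iter_law_ge0.
- by move=> z _; exact: iter_law_ge0.
Qed.

Lemma iter_law_add m1 m2 n F th :
  iter_law (m1 + m2) n F th = iter_law m1 n (iter_law m2 (n + m1) F) th.
Proof.
elim: m1 n th => [|m ih] n th /=; first by rewrite addn0.
by apply: eq_Ex => z _; rewrite ih addSnnS.
Qed.

Lemma iter_law_le m n F U th : (forall z, 0 <= F z)%E ->
  (forall j z, (n <= j)%N -> 0 < z -> exists2 w, w <= U j z &
     isE z (fun x => U j.+1 (z + kap j * (x - z))) w) ->
  (forall z, (0 < z)%R -> F z <= (U (n + m)%N z)%:E)%E -> 0 < th ->
  (iter_law m n F th <= (U n th)%:E)%E.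
Proof.
move=> F0; elim: m n th => [|m ih] n th UE FU th0 /=.
  by move: (FU _ th0); rewrite addn0.
have [w wU wE] := UE n th (leqnn n) th0.
apply: (@le_trans _ _ w%:E); last by rewrite lee_fin.
rewrite -(isE_Ex wE); apply: le_Ex => z z0.
  exact: iter_law_ge0.
apply: ih; [|by rewrite addSnnS|exact: kap_step_gt0].
by move=> j x nj; apply: UE; exact: ltnW.
Qed.

End IteratedLaw.

Section Indicator.
Context {R : realType}.

Definition ind (b : R -> bool) (z : R) : \bar R := if b z then 1%E else 0%E.

Lemma ind_ge0 b z : (0 <= ind b z)%E.
Proof. by rewrite /ind; case: ifP. Qed.

Lemma measurable_ind b : measurable_fun [set: R] b -> measurable_fun [set: R] (ind b).
Proof. by move=> mb; exact: measurable_fun_ifT. Qed.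

Lemma measurable_ind_near (y d : R) :
  measurable_fun [set: R] (ind (fun z => `|z - y| <= d)%R).
Proof.
apply: measurable_ind; apply: measurable_fun_ler => //.
by apply: measurableT_comp => //; exact: measurable_funB.
Qed.

End Indicator.

Section NearZero.
Context {R : realType}.
Variable t : R.
Hypothesis t0 : 0 <= t.
Local Notation rho := (rho t).
Local Notation kap := (kap t).
Local Notation iter_law := (iter_law kap).
Implicit Types (m n j N : nat) (u k l e d th y z : R).

Lemma ln1p_ge u : 0 <= u -> u / (1 + u) <= ln (1 + u).
Proof.
move=> u0; have u1 : 0 < 1 + u by lra.
have := @ln_le_sub1 R ((1 + u)^-1) ltac:(by rewrite invr_gt0).
rewrite lnV ?posrE//; have -> : u / (1 + u) = 1 - (1 + u)^-1 by field; rewrite gt_eqF.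
by lra.
Qed.

Lemma isE_step_exp k l th : 0 < th -> 0 <= k -> 0 <= l ->
  isE th (fun z => expR (- (l * (th + k * (z - th)))))
    (expR (- ((l * (1 - k) + ln (1 + l * k)) * th))).
Proof.
move=> th0 k0 l0.
have -> : - ((l * (1 - k) + ln (1 + l * k)) * th) =
  - (l * (1 - k) * th) + - (th * ln (1 + l * k)) by ring.
rewrite expRD; apply: isE_ext (isEZ _ (isE_mgf th0 (mulr_ge0 l0 k0))) => z _.
by rewrite -expRD; congr expR; ring.
Qed.

(** In terms of 1 / l a step adds at most k^2, so that [kap_rho_le] bounds the total increase from
    clock n on by [rho n]. *)
Lemma laplace_step k l : 0 <= k <= 1 -> 0 < l ->
  (l * (1 - k) + ln (1 + l * k))^-1 <= l^-1 + k ^+ 2.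
Proof.
move=> /andP[k0 k1] l0; have u0 : 0 <= l * k by rewrite mulr_ge0// ltW.
have h := ln1p_ge u0; have u1 : 0 < 1 + l * k by lra.
have s0 : 0 < l^-1 + k ^+ 2 by rewrite ltr_pwDl ?invr_gt0// sqr_ge0.
have g0 : (l^-1 + k ^+ 2)^-1 <= l * (1 - k) + ln (1 + l * k).
  apply: le_trans (_ : _ <= l * (1 - k) + l * k / (1 + l * k)) _; last by rewrite lerD2l.
  have -> : (l^-1 + k ^+ 2)^-1 = l / (1 + l * k ^+ 2).
    by field; rewrite !gt_eqF//; have := sqr_ge0 k; nra.
  have w0 : 0 < 1 + l * k ^+ 2 by have := sqr_ge0 k; nra.
  rewrite -subr_ge0; rewrite (_ : _ - _ = l * (l * k) ^+ 2 * k * (1 - k) /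
     ((1 + l * k) * (1 + l * k ^+ 2))).
    by rewrite !divr_ge0 ?mulr_ge0 ?sqr_ge0 ?subr_ge0 ?(ltW l0) ?(ltW u1) ?(ltW w0).
  by field; rewrite !gt_eqF.
rewrite -[leRHS]invrK lef_pV2// posrE ?invr_gt0//.
by apply: lt_le_trans g0; rewrite invr_gt0.
Qed.

(* Under one step [l] becomes [l (1 - k) + ln (1 + l k)], and [l rho] gains a
   fixed multiple of [rho]; as [rho] is not summable, mass at 0 is killed. *)
Lemma iter_law_exp m n l : 0 < l ->
  exists l', [/\ 0 < l', l'^-1 <= l^-1 + rho n,
   (2^-1 <= l * rho (n + m) -> 2^-1 + 3^-1 * \sum_(j < m) rho (n + j) <= l' * rho n) &
   forall th, 0 < th -> iter_law m n (fun th => (expR (- (l * th)))%:E) th =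
     (expR (- (l' * th)))%:E].
Proof.
move=> l0; elim: m n => [|m ih] n.
  exists l; split => //; first by rewrite lerDl rho_ge0.
  by rewrite big_ord0 mulr0 addr0 addn0.
have [l1 [l10 h1 h2 h3]] := ih n.+1.
have /andP[k0 k1] := kap_bounds t0 n.
have ls := laplace_step (_ : 0 <= kap n <= 1) l10; rewrite k0 (ltW k1) in ls.
have {}ls := ls isT.
have g0 : 0 < l1 * (1 - kap n) + ln (1 + l1 * kap n).
  apply: ltr_pwDl; first by rewrite mulr_gt0 ?subr_gt0.
  by rewrite ln_ge0// lerDl mulr_ge0// ltW.
exists (l1 * (1 - kap n) + ln (1 + l1 * kap n)); split => //.
- by apply: (le_trans ls); have := kap_rho_le t0 n; lra.
- rewrite -addSnnS => /h2 {}h2.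
  rewrite big_ord_recl addn0 mulrDl -mulrA kap_rho_eq// mulfVK ?gt_eqF ?rho_gt0//.
  have {}h2 : 2^-1 + 3^-1 * \sum_(j < m) rho (n + bump 0 j) <= l1 * kap n.
    by move: h2; under eq_bigr do rewrite addSnnS.
  have s0 : 0 <= \sum_(j < m) rho (n + bump 0 j) by apply: sumr_ge0 => j _; exact: rho_ge0.
  have u2 : 2^-1 <= l1 * kap n by lra.
  have u0 : 0 <= l1 * kap n by lra.
  have h4 : 3^-1 <= ln (1 + l1 * kap n).
    apply: le_trans (ln1p_ge u0); rewrite ler_pdivlMr; lra.
  have := ler_wpM2r (rho_ge0 t0 n) h4.
  by lra.
- move=> th th0 /=; rewrite -(isE_Ex (isE_step_exp th0 k0 (ltW l10))).
  by apply: eq_Ex => z z0; rewrite h3//; exact: (kap_step_gt0 (kap_bounds t0)).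
Qed.

(** Markov's inequality for expR (- z / rho m). Going back from N to m the exponent drops from 1 /
    rho m to no less than half of it, whatever N is; going back from m to 0 it grows with the
    divergent sum of [rho], so m can be chosen before N. *)
Lemma iter_law_near0 th e : 0 < th -> 0 < e -> exists d N0, 0 < d /\
  forall N, (N0 <= N)%N -> (iter_law N 0 (ind (fun y => y <= d)%R) th <= e%:E)%E.
Proof.
move=> th0 e0.
have [m hm] := sum_rho_unbounded t0 (3 * rho 0 / th * (1 - ln e)).
have r0 := rho_gt0 t0 m; have r00 := rho_gt0 t0 0.
exists (rho m), m; split=> // N mN.
have l0 : 0 < (rho m)^-1 by rewrite invr_gt0.
have [l1 [l10 a1 _ a3]] := iter_law_exp (N - m) m l0.
have [l2 [l20 _ b2 b3]] := iter_law_exp m 0 l10.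
rewrite add0n in b2.
have {}b2 : 3^-1 * \sum_(j < m) rho j <= l2 * rho 0.
  have h : 2^-1 <= l1 * rho m.
    rewrite invrK in a1; have := ler_wpM2l (ltW l10) a1.
    by rewrite mulfV ?gt_eqF//; lra.
  by apply: le_trans (b2 h); rewrite lerDr.
have e1 : expR 1 * expR (- (l2 * th)) <= e.
  rewrite -expRD -[leRHS]lnK ?posrE// ler_expR.
  have : 3^-1 * (3 * rho 0 / th * (1 - ln e)) <= l2 * rho 0.
    by apply: le_trans b2; rewrite ler_wpM2l.
  rewrite (_ : 3^-1 * _ = rho 0 * ((1 - ln e) / th)); last by field; rewrite gt_eqF.
  by rewrite (mulrC l2) ler_pM2l// ler_pdivrMr//; lra.
have {}b3 : iter_law N 0 (fun y => (expR (- ((rho m)^-1 * y)))%:E) th =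
    (expR (- (l2 * th)))%:E.
  rewrite -b3// -(subnKC mN) iter_law_add add0n; apply: (eq_iter_law (kap_bounds t0)) => //.
apply: (@le_trans _ _ (expR 1 * expR (- (l2 * th)))%:E); last by rewrite lee_fin.
rewrite EFinM -b3 -iter_lawZ ?expR_ge0//; last first.
  apply/measurable_EFinP; apply: (measurableT_comp (@measurable_expR R)).
  by apply: measurableT_comp => //; exact: measurable_funM.
apply: (le_iter_law (kap_bounds t0) _ _ (ind_ge0 _)) => // y y0.
rewrite -EFinM /ind; case: ifPn => ym; rewrite lee_fin; last by rewrite mulr_ge0 ?expR_ge0.
rewrite -expRD -[leLHS]expR0 ler_expR subr_ge0.
by rewrite mulrC ler_pdivrMr// mul1r.
Qed.

End NearZero.

Ltac nonneg := repeat first [ assumption | exact: sqr_ge0 | by apply: ltW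
  | apply: addr_ge0 | apply: divr_ge0 | apply: mulr_ge0 | apply: exprn_ge0
  | exact: ler0n ].

Section NearPoint.
Context {R : realType}.
Variables t y : R.
Hypotheses (t0 : 0 <= t) (y0 : 0 < y).
Local Notation rho := (rho t).
Local Notation kap := (kap t).
Local Notation iter_law := (iter_law kap).
Implicit Types (m n j N : nat) (c d e k l p q r th w x z W : R).

Lemma isE_pow3 p : 0 < p -> isE p (fun z => z ^+ 3) (p * (p + 1) * (p + 2)).
Proof.
by move=> p0; have := @isE_pow R p 3 p0; rewrite !big_ord_recr big_ord0 /= mul1r addr0.
Qed.

Lemma isE_pow4 p : 0 < p ->
  isE p (fun z => z ^+ 4) (p * (p + 1) * (p + 2) * (p + 3)).
Proof.
by move=> p0; have := @isE_pow R p 4 p0; rewrite !big_ord_recr big_ord0 /= mul1r addr0.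
Qed.

Lemma isE_pow2 p : 0 < p -> isE p (fun z => z ^+ 2) (p * (p + 1)).
Proof.
by move=> p0; have := @isE_pow R p 2 p0; rewrite !big_ord_recr big_ord0 /= mul1r addr0.
Qed.

(** Binomial expansion with the central moments th, 2 th and 3 th^2 + 6 th of Gamma(th, 1). *)
Lemma isE_step_pow4 th k : 0 < th ->
  isE th (fun z => (th + k * (z - th) - y) ^+ 4)
    ((th - y) ^+ 4 + 6 * k ^+ 2 * th * (th - y) ^+ 2 + 8 * k ^+ 3 * th * (th - y) +
      k ^+ 4 * (3 * th ^+ 2 + 6 * th)).
Proof.
move=> th0; pose a := (1 - k) * th - y.
have := isED (isEZ (k ^+ 4) (isE_pow4 th0))
  (isED (isEZ (4 * k ^+ 3 * a) (isE_pow3 th0))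
  (isED (isEZ (6 * k ^+ 2 * a ^+ 2) (isE_pow2 th0))
  (isED (isEZ (4 * k * a ^+ 3) (isE_X th0)) (isE_cst (a ^+ 4) th0)))).
set v := (X in isE _ _ X -> _) => h; set v' := (X in isE _ _ X).
have -> : v' = v by rewrite /v /v' /a; ring.
by apply: isE_ext h => z _; rewrite /a; ring.
Qed.

(** The coefficients are fixed in this order: [A2] and [A3] by the fourth moment bound, then [c2] so
    large that the quadratic correction pays for the [A2] term, then [C] to pay for the remaining
    terms of order k^3 and k^4. *)
Let A2 : R := 10 * y + 20.
Let A3 : R := 6 * y ^+ 2 + 10 * y + 3.
Let c2 : R := 4 * A2.
Let C : R := A3 + c2 * (y + 1).

Let A20 : 0 < A2. Proof. by rewrite /A2; move: y0; lra. Qed.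
Let A30 : 0 < A3. Proof. by rewrite /A3; move: y0 (sqr_ge0 y); lra. Qed.
Let c20 : 0 < c2. Proof. by rewrite mulr_gt0. Qed.
Let C0 : 0 < C. Proof. by rewrite addr_gt0// mulr_gt0// addr_gt0. Qed.

(** A sum of squares. The cubic term 6 k^2 W^3 is shared between W^4 and W^2 through (W - 1)^2 >= 0,
    which is the origin of the factor 3 in front of k^2. *)
Let fourth_moment_bound k W : 0 <= k <= 6^-1 ->
  W ^+ 4 + 6 * k ^+ 2 * (y + W) * W ^+ 2 + 8 * k ^+ 3 * (y + W) * W +
      k ^+ 4 * (3 * (y + W) ^+ 2 + 6 * (y + W)) <=
  W ^+ 4 * (1 + 3 * k ^+ 2) + A2 * k ^+ 2 * W ^+ 2 + A3 * k ^+ 4.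
Proof.
move=> /andP[k0 k1]; rewrite -subr_ge0.
rewrite (_ : _ - _ = 3 * k ^+ 2 * (W ^+ 2 * (W - 1) ^+ 2) + 4 * y * (k * W - k ^+ 2) ^+ 2 +
  8 * (k ^+ 2 * W ^+ 2) * (1 - k) + 3 * k ^+ 4 * (y - W) ^+ 2 + 3 * k ^+ 4 * (W - 1) ^+ 2 +
  9 * (k ^+ 2 * W ^+ 2) * (1 - k ^+ 2)); last by rewrite /A2 /A3; ring.
have h1 : 0 <= 1 - k by lra.
have h2 : 0 <= 1 - k ^+ 2 by nra.
by nonneg.
Qed.

Let quartic_bound k W : 0 <= k <= 6^-1 ->
  (1 + 6 * k) * (W ^+ 4 * (1 + 3 * k ^+ 2) + A2 * k ^+ 2 * W ^+ 2 + A3 * k ^+ 4) +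
    c2 * k * (W ^+ 2 + k ^+ 2 * (y + W)) + C * k ^+ 2 <=
  (1 + 6 * (k ^+ 2 + k)) * W ^+ 4 + c2 * (k ^+ 2 + k) * W ^+ 2 + C * (k ^+ 2 + k) ^+ 2.
Proof.
move=> /andP[k0 k1]; rewrite -subr_ge0.
rewrite (_ : _ - _ = 3 * k ^+ 2 * (1 - 6 * k) * W ^+ 4 + A2 * k ^+ 2 * (3 - 8 * k) * W ^+ 2 +
   c2 * k ^+ 3 / 2 * (W - 1) ^+ 2 +
   k ^+ 3 * (A3 * (2 - (1 + 6 * k) * k) + c2 * (y + 3 / 2) + k * C)); last first.
  by rewrite /C /c2; field.
have h1 : 0 <= 1 - 6 * k by lra.
have h2 : 0 <= 3 - 8 * k by lra.
have h3 : 0 <= 2 - (1 + 6 * k) * k by nra.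
have h4 : 0 <= y + 3 / 2 by move: y0; lra.
have h5 : 0 <= W ^+ 4 by rewrite (_ : W ^+ 4 = (W ^+ 2) ^+ 2) ?sqr_ge0//; ring.
by nonneg.
Qed.

(* The fourth power of [th - y], corrected so as to be superharmonic. *)
Definition quartic n th : R := (1 + 6 * rho n) * (th - y) ^+ 4 +
  c2 * rho n * (th - y) ^+ 2 + C * rho n ^+ 2.

Lemma quartic_ge n th : (th - y) ^+ 4 <= quartic n th.
Proof.
have r0 := rho_ge0 t0 n.
have h5 : 0 <= (th - y) ^+ 4.
  by rewrite (_ : _ ^+ 4 = ((th - y) ^+ 2) ^+ 2) ?sqr_ge0//; ring.
rewrite /quartic mulrDl mul1r -!addrA lerDl.
by nonneg.
Qed.

Lemma quartic_super n th : (4 <= n)%N -> 0 < th ->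
  exists2 w, w <= quartic n th &
    isE th (fun z => quartic n.+1 (th + kap n * (z - th))) w.
Proof.
move=> n4 th0; have k0 := ltW (kap_gt0 t0 n).
have k6 : kap n <= 6^-1.
  apply: (le_trans (kap_le_inv t0 n)); rewrite lef_pV2 ?posrE// ler_nat.
  by rewrite !ltnS in n4 *.
have kk : 0 <= kap n <= 6^-1 by rewrite k0.
have kr := kap_rho_le t0 n.
have := isED (isEZ (1 + 6 * kap n) (isE_step_pow4 (kap n) th0))
  (isED (isEZ (c2 * kap n) (isE_step_sqr (kap n) th y th0)) (isE_cst (C * kap n ^+ 2) th0)).
set v := (X in isE _ _ X -> _) => h; exists v; last first.
  by apply: isE_ext h => z _; rewrite /quartic (_ : rho n.+1 = kap n)//; ring.
have e : th = y + (th - y) by ring.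
have h1 := fourth_moment_bound (th - y) kk; rewrite -e in h1.
have h2 := quartic_bound (th - y) kk; rewrite -e in h2.
apply: (@le_trans _ _ ((1 + 6 * kap n) * ((th - y) ^+ 4 * (1 + 3 * kap n ^+ 2) +
   A2 * kap n ^+ 2 * (th - y) ^+ 2 + A3 * kap n ^+ 4) +
    c2 * kap n * ((th - y) ^+ 2 + kap n ^+ 2 * th) + C * kap n ^+ 2)).
  rewrite /v subrr mulr0 addr0 addrA !lerD2r ler_wpM2l//.
  by rewrite addr_ge0// mulr_ge0.
apply: (le_trans h2).
have kr' : kap n ^+ 2 + kap n <= rho n by [].
have h5 : 0 <= (th - y) ^+ 4.
  by rewrite (_ : _ ^+ 4 = ((th - y) ^+ 2) ^+ 2) ?sqr_ge0//; ring.
rewrite /quartic !lerD//.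
- by rewrite ler_wpM2r// lerD2l ler_wpM2l.
- by rewrite ler_wpM2r ?sqr_ge0// ler_wpM2l// ltW.
- rewrite ler_wpM2l ?(ltW C0)// ler_pXn2r ?nnegrE ?rho_ge0//.
  by rewrite addr_ge0 ?sqr_ge0.
Qed.

(** Chebyshev's inequality: to come within d / 2 of y the estimate must travel at least d / 2, while
    its variance after clock n is at most th [rho n]. *)
Lemma iter_law_move m n th d : 0 < th -> 0 < d -> d < `|th - y| ->
  (iter_law m n (ind (fun z => (`|z - y| <= d / 2)%R)) th <=
    (4 * th * rho n / d ^+ 2)%:E)%E.
Proof.
move=> th0 d0 hd.
pose U j z : R := ((z - th) ^+ 2 + z * rho j) * (4 / d ^+ 2).
have e : 4 * th * rho n / d ^+ 2 = U n th by rewrite /U subrr expr0n add0r; ring.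
have dd : 0 <= 4 / d ^+ 2 by rewrite divr_ge0 ?sqr_ge0.
rewrite e; apply: (iter_law_le (kap_bounds t0) (ind_ge0 _)) => //.
- move=> j z _ z0.
  have h := isEZ (4 / d ^+ 2) (isED (isE_step_sqr (kap j) z th z0)
    (isEZ (rho j.+1) (isE_step (kap j) z z0))).
  refine (ex_intro2 _ _ _ _ (isE_ext _ h)); last by move=> x _; rewrite /U; ring.
  rewrite /U [leRHS]mulrC ler_wpM2l// subrr mulr0 addr0.
  by rewrite -addrA lerD2l -mulrDl mulrC ler_wpM2l ?(ltW z0)// kap_rho_le.
- move=> z z0; rewrite /ind; case: ifPn; rewrite lee_fin; last first.
    by move=> _; rewrite mulr_ge0// addr_ge0 ?sqr_ge0// mulr_ge0 ?rho_ge0// ltW.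
  move=> hz; have h : d / 2 <= `|z - th|.
    have := ler_distD z th y; rewrite (distrC th z).
    by move: hd hz; lra.
  rewrite /U; apply: (@le_trans _ _ ((d / 2) ^+ 2 * (4 / d ^+ 2))).
    by rewrite le_eqVlt; apply/orP; left; apply/eqP; field; rewrite gt_eqF.
  rewrite ler_wpM2r// -[leLHS]addr0 lerD//; last by rewrite mulr_ge0 ?rho_ge0// ltW.
  by rewrite -(real_normK (num_real (z - th))) ler_pXn2r ?nnegrE ?divr_ge0// ltW.
Qed.

(* Paley-Zygmund for [zeta = (z - y) ^+ 2]: by [1 - 2 l zeta + l ^+ 2 zeta ^+ 2 >= 0]
   the indicator of [zeta <= h] is at most [1 + 2 l h - 2 l zeta + l ^+ 2 zeta ^+ 2];
   [quartic] bounds the mean of the last term from above and [G] that of [zeta]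
   from below. *)
Lemma iter_law_spread : exists c g : R, [/\ 0 < c, c < 1, 0 < g &
  forall n, (5 <= n)%N -> exists m0, forall m th, (m0 <= m)%N -> `|th - y| <= y / 2 ->
    (iter_law m n (ind (fun z => ((z - y) ^+ 2 <= g * rho n)%R)) th <=
      (1 - c)%:E)%E].
Proof.
pose g : R := Num.min 1 (y / 8); pose K := 2 + c2 + C.
have K0 : 1 < K by rewrite /K; move: c20 C0; lra.
have g0 : 0 < g by rewrite lt_min ltr01 divr_gt0.
have g1 : g <= 1 by rewrite ge_min lexx.
have gy : g <= y / 8 by rewrite ge_min lexx orbT.
have gg : 0 < g ^+ 2 <= 1 by rewrite exprn_gt0//= exprn_ile1// ltW.
exists (g ^+ 2 / (2 * K)), (g / 4); split.
- by rewrite divr_gt0 ?mulr_gt0//; lra.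
- by rewrite ltr_pdivrMr; [|lra]; move: gg => /andP[]; lra.
- by rewrite divr_gt0.
move=> n n5; have r0 := rho_gt0 t0 n.
(* After [m0] steps most of the variance available at clock n has been spent, so it contributes to
   the second moment at least a fixed multiple of [rho n]. *)
have [m0 hm0] : exists m0, forall m, (m0 <= m)%N -> rho m <= rho n / 4.
  have : \forall m \near \oo, rho m <= rho n / 4.
    by apply: (cvgr_le _ (cvg_rho t0)); rewrite divr_gt0.
  by move=> [m0 _ h]; exists m0 => m /h.
exists m0 => m th mm hth.
have th0 : y / 2 <= th.
  by move: hth; rewrite ler_norml => /andP[+ _]; lra.
have thp : 0 < th by apply: lt_le_trans th0; rewrite divr_gt0.
pose Q := (th - y) ^+ 2 + rho n.
have Q0 : 0 < Q by rewrite ltr_wpDl ?sqr_ge0.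
(* This [l] minimises l^2 K Q^2 - 2 l g Q, the bound that remains once the mean fourth power is at
   most K Q^2 and the mean square at least g Q. *)
pose l := g / (K * Q); have l0 : 0 < l by rewrite divr_gt0// mulr_gt0//; lra.
pose h := g / 4 * rho n; have h0 : 0 < h by rewrite mulr_gt0// divr_gt0.
(* Increases in mean by [rhoS_sub], and at the final clock n + m it equals (z - y)^2; its initial
   value is therefore a lower bound for the mean square. *)
pose G j z : R := (z - y) ^+ 2 + z * (rho j.+1 - rho (n + m).+1).
pose U j z : R := 1 + 2 * l * h + l ^+ 2 * quartic j z - 2 * l * G j z.
have Un : U n th <= 1 - g ^+ 2 / (2 * K).
  have hF : quartic n th <= K * Q ^+ 2.
    have r6 : 1 + 6 * rho n <= 2.
      have : rho n <= 6^-1.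
        rewrite lef_pV2 ?posrE ?rho_den_gt0//.
        rewrite -[leLHS]addr0 lerD// natr1 ler_nat; exact: n5.
      lra.
    have w0 := sqr_ge0 (th - y).
    rewrite /quartic (_ : (th - y) ^+ 4 = ((th - y) ^+ 2) ^+ 2); last by ring.
    rewrite /K /Q; set a := (th - y) ^+ 2 in w0 *; set b := rho n in r0 r6 *.
    have h6 : 0 <= 2 - (1 + 6 * b) by rewrite subr_ge0.
    have b0 := ltW r0; rewrite -subr_ge0.
    rewrite (_ : _ - _ = (2 - (1 + 6 * b)) * a ^+ 2 + c2 * (a ^+ 2 + b ^+ 2 + a * b) +
      C * (a ^+ 2 + 2 * (a * b)) + 2 * (2 * (a * b) + b ^+ 2)); last by ring.
    by nonneg.
  have hG : g * Q <= G n th.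
    have k2 : rho n / 2 <= rho n.+1.
      have e : kap n = (1 - kap n) * rho n by rewrite kap_rho_eq// mulfVK ?gt_eqF.
      have k1 : kap n <= 2^-1.
        by apply: (le_trans (kap_le_inv t0 n)); rewrite lef_pV2 ?posrE ?ler_nat.
      rewrite -/(kap n) e mulrC ler_wpM2r ?(ltW r0)//; move: k1; lra.
    have s4 : rho n / 4 <= rho n.+1 - rho (n + m).+1.
      have := hm0 (n + m).+1 (leq_trans mm (leqW (leq_addl _ _))); move: k2; lra.
    have w0 := sqr_ge0 (th - y).
    rewrite /G /Q mulrDr lerD//; first by rewrite ler_piMl.
    apply: (@le_trans _ _ (y / 2 * (rho n / 4))).
      rewrite (_ : y / 2 * (rho n / 4) = y / 8 * rho n); last by field.
      by rewrite ler_wpM2r// ltW.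
    by rewrite ler_pM// divr_ge0// ltW.
  have e1 : l ^+ 2 * quartic n th <= g ^+ 2 / K.
    apply: (@le_trans _ _ (l ^+ 2 * (K * Q ^+ 2))); first by rewrite ler_wpM2l ?sqr_ge0.
    by rewrite le_eqVlt; apply/orP; left; apply/eqP; rewrite /l; field; rewrite !gt_eqF//; lra.
  have e2 : 2 * (g ^+ 2 / K) <= 2 * l * G n th.
    apply: (@le_trans _ _ (2 * l * (g * Q))); last by rewrite ler_wpM2l// mulr_ge0// ltW.
    by rewrite le_eqVlt; apply/orP; left; apply/eqP; rewrite /l; field; rewrite !gt_eqF//; lra.
  have e3 : 2 * l * h <= g ^+ 2 / (2 * K).
    have rQ : rho n <= Q by rewrite /Q lerDr sqr_ge0.
    apply: (@le_trans _ _ (2 * l * (g / 4 * Q))).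
      rewrite ler_wpM2l//; first by rewrite mulr_ge0// ltW.
      by rewrite /h ler_wpM2l// divr_ge0// ltW.
    by rewrite le_eqVlt; apply/orP; left; apply/eqP; rewrite /l; field; rewrite !gt_eqF//; lra.
  have e4 : g ^+ 2 / K = 2 * (g ^+ 2 / (2 * K)) by field; rewrite !gt_eqF//; lra.
  by rewrite /U; move: e1 e2 e3 e4; lra.
apply: (@le_trans _ _ (U n th)%:E); last by rewrite lee_fin.
apply: (iter_law_le (kap_bounds t0) (ind_ge0 _)) => //.
- move=> j z nj z0.
  have [w wq wE] := quartic_super (leq_trans (ltnW n5) nj) z0.
  have H := isEB (isED (isE_cst (1 + 2 * l * h) z0) (isEZ (l ^+ 2) wE))
    (isEZ (2 * l) (isED (isE_step_sqr (kap j) z y z0)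
      (isEZ (rho j.+2 - rho (n + m).+1) (isE_step (kap j) z z0)))).
  refine (ex_intro2 _ _ _ _ (isE_ext _ H)); last by move=> x _; rewrite /U /G; ring.
  rewrite /U lerB//; first by rewrite lerD2l ler_wpM2l// sqr_ge0.
  rewrite ler_wpM2l//; first by rewrite mulr_ge0// ltW.
  rewrite /G subrr mulr0 addr0.
  have := ler_wpM2l (ltW z0) (rhoS_sub t0 j); move: (rho j.+1) (rho j.+2) (rho (n + m).+1).
  by move=> a b a'; lra.
- move=> z z0; rewrite /U /G subrr mulr0 addr0.
  have q4 := quartic_ge (n + m) z.
  have e1 : l ^+ 2 * (z - y) ^+ 4 <= l ^+ 2 * quartic (n + m) z.
    by rewrite ler_wpM2l ?sqr_ge0.
  have e2 : l ^+ 2 * (z - y) ^+ 4 = (l * (z - y) ^+ 2) ^+ 2 by ring.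
  have e3 : 0 <= 2 * l * h.
    by apply: mulr_ge0; [apply: mulr_ge0 => //; exact: ltW|exact: ltW].
  rewrite /ind; case: ifPn => hz; rewrite lee_fin.
    have e4 : l * (z - y) ^+ 2 <= l * h by rewrite ler_wpM2l// ltW.
    have e5 := sqr_ge0 (l * (z - y) ^+ 2); move: e1 e2 e4 e5; lra.
  have e5 := sqr_ge0 (l * (z - y) ^+ 2 - 1); rewrite sqrrB1 mulr2n in e5.
  by move: e1 e2 e3 e5; lra.
Qed.

Local Notation near_ind d := (ind (fun z => `|z - y| <= d)%R).

Lemma iter_law_mean n th c : 0 < th -> 0 <= c ->
  (iter_law n 0 (fun z => (c * `|z|)%:E) th <= (c * th)%:E)%E.
Proof.
move=> th0 c0; apply: (iter_law_le (kap_bounds t0) (U := fun _ z => c * z)) => //.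
- by move=> z; rewrite lee_fin mulr_ge0.
- move=> j z _ z0; exists (c * (z + kap j * (z - z))); first by rewrite subrr mulr0 addr0.
  exact: isEZ (isE_step _ _ z0).
- by move=> z z0; rewrite lee_fin ger0_norm// ltW.
Qed.

Lemma iter_law_ind_le1 n b th : 0 < th -> (iter_law n 0 (ind b) th <= 1)%E.
Proof.
move=> th0; apply: (iter_law_le (kap_bounds t0) (ind_ge0 _) (U := fun _ _ => 1)) => //.
- by move=> j z _ z0; exists 1 => //; exact: isE_cst.
- by move=> z z0; rewrite /ind; case: ifP.
Qed.

(** At a late clock n an estimate near y is thrown off a smaller neighbourhood with probability at
    least c, by [iter_law_spread], and an estimate away from y rarely comes back, by
    [iter_law_move]. The mass near y hence contracts by 1 - c at each round, at the price of a
    smaller radius. *)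
Lemma iter_law_away th e : 0 < th -> 0 < e -> exists d N0, 0 < d /\
  forall N, (N0 <= N)%N -> (iter_law N 0 (near_ind d) th <= e%:E)%E.
Proof.
move=> th0 e0; have [c [g [c0 c1 g0 spread]]] := iter_law_spread.
pose S q := exists d N0, 0 < d /\
  forall N, (N0 <= N)%N -> (iter_law N 0 (near_ind d) th <= q%:E)%E.
have S_step q a : 0 < a -> S q -> S ((1 - c) * q + a).
  move=> a0 [d0 [N0 [d00 hS]]]; pose d := Num.min d0 (y / 2).
  have dp : 0 < d by rewrite lt_min d00 divr_gt0.
  have dd0 : d <= d0 by rewrite ge_min lexx.
  have dy : d <= y / 2 by rewrite ge_min lexx orbT.
  have [n1 hn1] : exists n1, forall n, (n1 <= n)%N -> rho n <= a * d ^+ 2 / (4 * th).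
    have : \forall n \near \oo, rho n <= a * d ^+ 2 / (4 * th).
      apply: (cvgr_le _ (cvg_rho t0)).
      by rewrite divr_gt0// mulr_gt0// exprn_gt0.
    by move=> [n1 _ h]; exists n1 => n /h.
  pose n := maxn (maxn n1 N0) 5.
  have nn1 : (n1 <= n)%N by rewrite /n !leq_max leqnn.
  have nN0 : (N0 <= n)%N by rewrite /n !leq_max leqnn orbT.
  have n5 : (5 <= n)%N by rewrite /n leq_max leqnn orbT.
  have r0 := rho_gt0 t0 n.
  have [m0 hm0] := spread n n5.
  (* Since d' <= 1 and d' <= g rho n, |x - y| <= d' implies (x - y)^2 <= |x - y| <= g rho n, the
     event of [iter_law_spread]. *)
  pose d' := Num.min (d / 2) (Num.min 1 (g * rho n)).
  have d'0 : 0 < d' by rewrite !lt_min divr_gt0// ltr01 mulr_gt0.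
  have d'd : d' <= d / 2 by rewrite ge_min lexx.
  have d'1 : d' <= 1 by rewrite !ge_min lexx orbT.
  have d'g : d' <= g * rho n by rewrite !ge_min lexx !orbT.
  exists d', (n + m0)%N; split=> // N hN.
  have -> : N = (n + (N - n))%N by rewrite subnKC// (leq_trans _ hN)// leq_addr.
  have : (m0 <= N - n)%N by rewrite leq_subRL// (leq_trans _ hN)// leq_addr.
  move: (N - n)%N => m mm; rewrite iter_law_add add0n.
  (* The bound of [iter_law_move] is k z, linear in the estimate; by the martingale property its
     mean is at most k th, which the choice of n makes at most a. *)
  pose k := 4 * rho n / d ^+ 2.
  have k0 : 0 <= k by rewrite divr_ge0 ?sqr_ge0// mulr_ge0// ltW.
  have mz : measurable_fun [set: R] (fun z : R => (k * `|z|)%:E).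
    by apply/measurable_EFinP; apply: measurable_funM => //; exact: measurableT_comp.
  have c10 : 0 <= 1 - c by rewrite subr_ge0 ltW.
  have mni : measurable_fun [set: R] (fun z => (1 - c)%:E * near_ind d z)%E.
    by apply: emeasurable_funM => //; exact: measurable_ind_near.
  apply: (@le_trans _ _ (iter_law n 0
      (fun z => ((1 - c)%:E * near_ind d z + (k * `|z|)%:E)%E) th)).
    apply: (le_iter_law (kap_bounds t0)) => //.
      by move=> z; apply: iter_law_ge0 => x; exact: ind_ge0.
    move=> z z0; have [h|h] := leP `|z - y| d.
      apply: (@le_trans _ _ (1 - c)%:E); last first.
        by rewrite /ind h mule1 leeDl// lee_fin mulr_ge0.
      apply: (le_trans _ (hm0 m z mm (le_trans h dy))).
      apply: (le_iter_law (kap_bounds t0) _ _ (ind_ge0 _)) => //.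
      move=> x x0; rewrite /ind; case: ifPn => hx; last by case: ifP.
      rewrite ifT// -(real_normK (num_real _)) expr2.
      apply: (le_trans _ d'g); rewrite -[leRHS]mul1r ler_pM//.
      exact: le_trans hx d'1.
    have -> : near_ind d z = 0%E by rewrite /ind leNgt h.
    rewrite mule0 add0e (ger0_norm (ltW z0)).
    apply: (le_trans (y := (4 * z * rho n / d ^+ 2)%:E)); last first.
      by rewrite lee_fin /k le_eqVlt; apply/orP; left; apply/eqP; ring.
    apply: (le_trans _ (iter_law_move m n z0 dp h)).
    apply: (le_iter_law (kap_bounds t0) _ _ (ind_ge0 _)) => //.
    move=> x x0; rewrite /ind; case: ifPn => hx; last by case: ifP.
    by rewrite ifT// (le_trans hx).
  rewrite iter_lawD//; first last.
  - by move=> z; rewrite lee_fin mulr_ge0.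
  - by move=> z; rewrite mule_ge0 ?ind_ge0// lee_fin.
  rewrite iter_lawZ//; [|exact: ind_ge0|exact: measurable_ind_near].
  rewrite [leRHS]EFinD; apply: leeD.
    rewrite EFinM; apply: lee_wpmul2l; first by rewrite lee_fin.
    apply: (le_trans _ (hS n nN0)).
    apply: (le_iter_law (kap_bounds t0) _ _ (ind_ge0 _)) => //.
    move=> x x0; rewrite /ind; case: ifPn => hx; last by case: ifP.
    by rewrite ifT// (le_trans hx).
  apply: (le_trans (iter_law_mean n th0 k0)); rewrite lee_fin /k.
  have := hn1 n nn1; rewrite ler_pdivlMr ?mulr_gt0// => h.
  by rewrite mulrAC ler_pdivrMr ?exprn_gt0//; move: h; lra.
(* e / 2 is the fixed point of q -> (1 - c) q + c e / 2, so the excess over it decays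
   geometrically. *)
have Sj j : S ((1 - c) ^+ j + e / 2).
  elim: j => [|j /(S_step _ (c * (e / 2)))].
    exists 1, 0%N; split=> // N _; apply: (le_trans (iter_law_ind_le1 _ _ th0)).
    by rewrite lee_fin expr0; move: e0; lra.
  rewrite (_ : _ + c * (e / 2) = (1 - c) ^+ j.+1 + e / 2); last by rewrite exprS; ring.
  by apply; rewrite mulr_gt0// divr_gt0.
have [j hj] : exists j, (1 - c) ^+ j <= e / 2.
  have : \forall j \near \oo, (1 - c) ^+ j <= e / 2.
    apply: (cvgr_le 0); last by rewrite divr_gt0.
    by apply: cvg_expr; rewrite ger0_norm; move: c0 c1; lra.
  by move=> [j _ h]; exists j; apply: (h j) => /=.
have [d [N0 [d0 h]]] := Sj j; exists d, N0; split=> // N NN.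
by apply: (le_trans (h N NN)); rewrite lee_fin; move: hj; lra.
Qed.

End NearPoint.

(** * The limit for the adaptive chain *)

Section AsymptoticBound.
Context {R : realType}.
Implicit Types (u : nat -> \bar R) (a e : R).

Lemma cvge_squeeze01 u a : (forall k, 0 <= u k <= 1)%E -> (forall k, a%:E <= u k)%E ->
  (forall e, 0 < e -> \forall k \near \oo, (u k <= (a + e)%:E)%E) ->
  u k @[k --> \oo] --> a%:E.
Proof.
move=> u01 ua ule; apply/fine_cvgP; split.
  apply: nearW => k; have /andP[u0 u1] := u01 k.
  by rewrite ge0_fin_numE// (le_lt_trans u1)// ltry.
apply/cvgrPdist_le => e e0; apply: filterS (ule e e0) => k /=.
have /andP[u0 u1] := u01 k; have [r [_ _ rE]] := real01 u0 u1.
move: (ua k); rewrite rE !lee_fin/= => h1 h2.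
by rewrite ler_norml; apply/andP; split; lra.
Qed.

Lemma cvge_near_le u a e : 0 < e -> u k @[k --> \oo] --> a%:E ->
  \forall k \near \oo, (u k <= (a + e)%:E)%E.
Proof.
move=> e0 /fine_cvgP[h1 /cvgrPdist_le/(_ e e0) h2].
apply: filterS2 h1 h2 => k /= f; rewrite -(fineK f) lee_fin /= ler_norml.
by move=> /andP[]; lra.
Qed.

End AsymptoticBound.

Section ChainBound.
Context {R : realType}.
Variables (theta0 t : R).
Hypotheses (theta0_gt0 : 0 < theta0) (t0 : 0 <= t).
Local Notation kap := (kap t).
Local Notation iter_law := (iter_law kap).
Local Notation step := (chain_step theta0 kap).
Implicit Types (k m n j N : nat) (c d e l p q r th w x z g M : R) (W : R -> \bar R).

(** The index k moves the boundary to infinity. [H] will be an affine function of the chain value,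
    or the distance between two values with different boundaries. It is subharmonic only for large
    k, when the given state has not crossed yet. *)
Variable H : nat -> nat -> R * R -> \bar R.
Hypothesis H01 : forall k n s, 0 < s.1 -> (0 <= H k n s <= 1)%E.
Hypothesis mH : forall k n, measurable_fun [set: R * R] (H k n).
Hypothesis Hsub : forall n th x, 0 < th -> \forall k \near \oo,
  (H k n (th, x) <= Ex th (fun z => H k n.+1 (step n (th, x) z)))%E.

(** Only an asymptotic upper bound on [H] is known, not a limit. The maximum of [H] and the bound
    does converge, to the bound, and dominated convergence applies to that maximum. *)
Let asym_step1 m n W : (forall z, 0 <= W z)%E -> (forall z, W z <= 1)%E ->
  measurable_fun [set: R] W ->
  (forall th x e, 0 < th -> 0 < e ->
     \forall k \near \oo, (H k (n + m)%N (th, x) <= W th + e%:E)%E) ->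
  forall th x e, 0 < th -> 0 < e ->
    \forall k \near \oo, (H k n (th, x) <= iter_law m n W th + e%:E)%E.
Proof.
move=> W0 W1 mW; elim: m n => [|m ih] n HW th x e th0 e0.
  by have := HW th x e th0 e0; rewrite addn0.
have {}ih := ih n.+1 ltac:(by move=> *; rewrite addSnnS; exact: HW).
pose A z := iter_law m n.+1 W (th + kap n * (z - th)).
have sp z : 0 < z -> 0 < th + kap n * (z - th) by exact: (@kap_step_gt0 R kap (kap_bounds t0) n th z th0).
have A0 z : (0 <= A z)%E by exact: iter_law_ge0.
have A1 z : 0 < z -> (A z <= 1)%E.
  move=> z0; apply: (iter_law_le (kap_bounds t0) (U := fun _ _ => 1)) => //.
  - by move=> j y _ y0; exists 1 => //; exact: isE_cst.
  - exact: sp.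
have mA : measurable_fun [set: R] A by exact: measurable_iter_law_step.
pose F k z := maxe (H k n.+1 (step n (th, x) z)) (A z).
have mF k : measurable_fun [set: R] (F k).
  apply: measurable_maxe => //.
  exact: (measurableT_comp (mH k n.+1) (measurable_step theta0 kap n (th, x))).
have Ar : exists r : R, iter_law m.+1 n W th = r%:E.
  have h0 : (0 <= iter_law m.+1 n W th)%E by exact: iter_law_ge0.
  have h1 : (iter_law m.+1 n W th <= 1)%E.
    by rewrite -(Ex_cst 1 th0) /=; apply: le_Ex => z z0; [exact: A0|exact: A1].
  by have [r [_ _ ->]] := real01 h0 h1; exists r.
have cF : Ex th (F k) @[k --> \oo] --> Ex th A.
  apply: (@cvg_Ex _ _ _ _ _ 0 th0) => //; first exact: cvg_cst.
  - move=> k z z0; have /andP[h0 h1] := H01 k n.+1 (s := step n (th, x) z) (sp z z0).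
    by rewrite le_max ge_max A0 h1 A1 ?orbT.
  - move=> z z0 _; have [a [_ _ aE]] := real01 (A0 z) (A1 z z0).
    rewrite -/(A z) aE; apply: cvge_squeeze01.
    + move=> k; have /andP[h0 h1] := H01 k n.+1 (s := step n (th, x) z) (sp z z0).
      by rewrite le_max ge_max A0 h1 A1 ?orbT.
    + by move=> k; rewrite /F -aE le_max lexx orbT.
    + move=> e' e'0; have := ih _ (x - llr theta0 th z) e' (sp z z0) e'0.
      apply: filterS => k hk; rewrite /F ge_max -/(A z) aE.
      by move: hk; rewrite -/(A z) aE -EFinD => -> /=; rewrite lee_fin lerDl ltW.
have [r rE] := Ar; rewrite -/(iter_law m.+1 n W th) rE in cF *.
apply: filterS2 (Hsub n x th0) (cvge_near_le e0 cF) => k h1 h2.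
apply: (le_trans h1); rewrite -EFinD; apply: le_trans h2; apply: le_Ex => z z0.
  by have /andP[] := H01 k n.+1 (s := step n (th, x) z) (sp z z0).
by rewrite /F le_max lexx.
Qed.

Lemma asym_step m n W : (forall z, 0 <= W z)%E -> measurable_fun [set: R] W ->
  (forall th x e, 0 < th -> 0 < e ->
     \forall k \near \oo, (H k (n + m)%N (th, x) <= W th + e%:E)%E) ->
  forall th x e, 0 < th -> 0 < e ->
    \forall k \near \oo, (H k n (th, x) <= iter_law m n W th + e%:E)%E.
Proof.
move=> W0 mW HW th x e th0 e0.
pose W' z := mine (W z) 1%E.
have := @asym_step1 m n W' _ _ _ _ th x e th0 e0.
case=> [z|z||th' x' e' th'0 e'0|N _ hN].
- by rewrite /W' le_min W0 lee01.
- by rewrite /W' ge_min lexx orbT.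
- by apply: measurable_mine.
- apply: filterS (HW th' x' e' th'0 e'0) => k hk.
  rewrite /W'; case: (leP (W th') 1%E) => // _.
  have /andP[_ h1] := H01 k (n + m)%N (s := (th', x')) th'0.
  by apply: (le_trans h1); rewrite leeDl// lee_fin ltW.
exists N => // k Nk; apply: (le_trans (hN k Nk)); apply: leeD => //.
apply: (le_iter_law (kap_bounds t0)) => //.
  by move=> z; rewrite /W' le_min W0 lee01.
by move=> z z0; rewrite /W' ge_min lexx.
Qed.

Definition inside d M z : bool := [&& d <= z, z <= M & d <= `|z - theta0|].

Lemma measurable_inside d M : measurable_fun [set: R] (fun z => ~~ inside d M z).
Proof.
apply: measurable_neg; apply: measurable_and; first exact: measurable_fun_ler.
apply: measurable_and; apply: measurable_fun_ler => //.
by apply: measurableT_comp => //; exact: measurable_funB.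
Qed.

Lemma iter_law_tight th e : 0 < th -> 0 < e -> exists d M N0, [/\ 0 < d,
  forall N, (N0 <= N)%N ->
  (iter_law N 0 (ind (fun z => ~~ inside d M z)) th <= e%:E)%E &
  d <= 1].
Proof.
move=> th0 e0; have e3 : 0 < e / 3 by rewrite divr_gt0.
have [d1 [N1 [d10 h1]]] := iter_law_near0 t0 th0 e3.
have [d2 [N2 [d20 h2]]] := iter_law_away t0 theta0_gt0 th0 e3.
(* Markov's inequality: the mean of the estimate is at most th, so it exceeds 1 / c with probability
   at most c th = e / 3. *)
pose c := e / 3 / th; have c0 : 0 < c by rewrite divr_gt0.
pose d := Num.min 1 (Num.min d1 d2).
have dd1 : d <= d1 by rewrite !ge_min lexx orbT.
have dd2 : d <= d2 by rewrite !ge_min lexx !orbT.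
have d0 : 0 < d by rewrite !lt_min ltr01 d10.
exists d, (c^-1), (maxn N1 N2); split=> //; last by rewrite ge_min lexx.
move=> N; rewrite geq_max => /andP[NN1 NN2].
have m1 : measurable_fun [set: R] (ind (fun z : R => z <= d1)).
  by apply: measurable_ind; exact: measurable_fun_ler.
have m2 := measurable_ind_near theta0 d2.
have m3 : measurable_fun [set: R] (fun z : R => (c * `|z|)%:E).
  by apply/measurable_EFinP; apply: measurable_funM => //; exact: measurableT_comp.
have m12 := emeasurable_funD m1 m2.
have p3 z : (0 <= (c * `|z|)%:E)%E by rewrite lee_fin mulr_ge0// ltW.
have p12 z : (0 <= ind (fun z : R => (z <= d1)%R) z + ind (fun z => (`|z - theta0| <= d2)%R) z)%E.
  by rewrite adde_ge0 ?ind_ge0.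
apply: (@le_trans _ _ (iter_law N 0 (fun z => (ind (fun z : R => (z <= d1)%R) z +
   ind (fun z => (`|z - theta0| <= d2)%R) z) + (c * `|z|)%:E)%E th)).
  apply: (le_iter_law (kap_bounds t0) _ _ (ind_ge0 _)) => // z z0.
  have P1 : (z <= d1)%R -> (1 <= ind (fun z : R => (z <= d1)%R) z +
      ind (fun z => (`|z - theta0| <= d2)%R) z + (c * `|z|)%:E)%E.
    move=> h; rewrite {1}/ind h -addeA leeDl// adde_ge0 ?ind_ge0//.
  have P2 : (`|z - theta0| <= d2)%R -> (1 <= ind (fun z : R => (z <= d1)%R) z +
      ind (fun z => (`|z - theta0| <= d2)%R) z + (c * `|z|)%:E)%E.
    move=> h; rewrite {2}/ind h addeAC leeDr// adde_ge0 ?ind_ge0//.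
  have P3 : (c^-1 < z)%R -> (1 <= ind (fun z : R => (z <= d1)%R) z +
      ind (fun z => (`|z - theta0| <= d2)%R) z + (c * `|z|)%:E)%E.
    move=> h; apply: (@le_trans _ _ (c * `|z|)%:E); last by rewrite leeDr.
    rewrite lee_fin ger0_norm ?(ltW z0)// -(mulfV (lt0r_neq0 c0)) ler_wpM2l ?(ltW c0)//.
    exact: ltW.
  rewrite [leLHS]/ind; case: ifPn => hz; last by rewrite adde_ge0.
  have [h|h] := leP z d1; first exact: P1.
  have [h'|h'] := leP `|z - theta0| d2; first exact: P2.
  apply: P3; rewrite ltNge; apply: contraNN hz => hM.
  by rewrite /inside hM (le_trans dd1 (ltW h)) (le_trans dd2 (ltW h')).
rewrite iter_lawD// iter_lawD//; try exact: ind_ge0.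
rewrite (_ : e = e / 3 + e / 3 + e / 3); last by field.
rewrite EFinD; apply: leeD; first by rewrite EFinD; apply: leeD; [exact: h1|exact: h2].
apply: (le_trans (iter_law_mean t0 N th0 (ltW c0))).
by rewrite lee_fin /c mulfVK ?gt_eqF.
Qed.

Lemma bounded_subseq (u : nat -> R) M : (forall j, `|u j| <= M) ->
  exists f : nat -> nat, exists l : R, [/\ {homo f : m n / (m < n)%N},
    forall j, (j <= f j)%N & u (f j) @[j --> \oo] --> l].
Proof.
move=> uM; have bx : bounded_fun u.
  exists M; split; first exact: num_real.
  by move=> M' /ltW MM j _ /=; exact: le_trans MM.
have [f fi /cvg_ex[/= l cl]] := bolzano_weierstrass bx.
have fh : {homo f : m n / (m < n)%N} by move=> m n; rewrite (leqW_mono fi).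
exists f, l; split=> //; elim=> // j ih; apply: (leq_ltn_trans ih); exact: fh.
Qed.

Lemma inside_cvg d M (u : nat -> R) l : (forall j, inside d M (u j)) ->
  u j @[j --> \oo] --> l -> inside d M l.
Proof.
move=> hu cu; apply/and3P; split.
- by apply: (cvgr_to_ge cu); apply: nearW => j; have /and3P[] := hu j.
- by apply: (cvgr_to_le cu); apply: nearW => j; have /and3P[] := hu j.
- have c : `|u j - theta0| @[j --> \oo] --> `|l - theta0|.
    by apply: cvg_norm; apply: cvgB => //; exact: cvg_cst.
  by apply: (cvgr_to_ge c); apply: nearW => j; have /and3P[] := hu j.
Qed.

Variable E : R -> R.
Hypothesis E_ge0 : forall y, 0 < y -> y != theta0 -> 0 <= E y.
Hypothesis E_cont : forall y, 0 < y -> y != theta0 -> {for y, continuous E}.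
Hypothesis H_E : forall d M e, 0 < d -> 0 < e -> exists n1, forall n th x, (n1 <= n)%N ->
  inside d M th -> \forall k \near \oo, (H k n (th, x) <= (E th + e)%:E)%E.

Lemma inside_D d M y : 0 < d -> inside d M y -> 0 < y /\ y != theta0.
Proof.
move=> d0 /and3P[h1 _ h3]; split; first exact: lt_le_trans h1.
by rewrite -subr_eq0 -normr_gt0; exact: lt_le_trans h3.
Qed.

Lemma inside_bounded d M y : 0 < d -> inside d M y -> `|y| <= M.
Proof.
move=> d0 /and3P[h1 h2 _]; rewrite ger0_norm//.
exact: le_trans (ltW d0) h1.
Qed.

(** A continuous function below g on a compact set stays below it by a fixed margin. *)
Lemma inside_gap d M g : 0 < d -> (forall y, 0 < y -> y != theta0 -> E y < g) ->
  exists2 c, 0 < c & forall y, inside d M y -> E y <= g - c.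
Proof.
move=> d0 Eg; apply: contrapT => hn.
have bad j : exists y, inside d M y /\ g - j.+1%:R^-1 < E y.
  apply: contrapT => hj; apply: hn; exists (j.+1%:R^-1) => // y hy.
  by rewrite leNgt; apply/negP => h; apply: hj; exists y.
have [u uP] := choice bad.
have uM j : `|u j| <= M by have [h _] := uP j; exact: inside_bounded d0 h.
have [f [l [fh fj cl]]] := bounded_subseq uM.
have il : inside d M l by apply: inside_cvg cl => j; have [] := uP (f j).
have [l0 lt0] := inside_D d0 il.
have cE : E (u (f j)) @[j --> \oo] --> E l by exact: continuous_cvg (E_cont l0 lt0) cl.
have ch : g - (f j).+1%:R^-1 @[j --> \oo] --> g - 0.
  apply: cvgB; first exact: cvg_cst.
  exact: (@cvg_subseq0 R f (@harmonic R) 0 fh (@cvg_harmonic R)).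
have : g - 0 <= E l.
  apply: (ler_cvg_to ch cE); apply: nearW => j.
  by have [_ /ltW] := uP (f j).
by rewrite subr0 leNgt (Eg l l0 lt0).
Qed.

(* Dominated convergence carries [H_E] back through the first [N] steps, after
   which the estimate lies in a compact set away from [theta0] up to small
   probability. *)
Lemma asymptotic_lt g : 0 < g -> (forall y, 0 < y -> y != theta0 -> E y < g) ->
  forall th x, 0 < th -> exists2 g', g' < g &
    \forall k \near \oo, (H k 0%N (th, x) <= g'%:E)%E.
Proof.
move=> g0 Eg th x th0.
(* Two compact sets are needed. The first carries half of the mass and fixes the gap c; the second
   misses only e = c / 16, a number known only after c. *)
have [d0 [M0 [N0 [d00 tight0 _]]]] := iter_law_tight th0 (divr_gt0 ltr01 (ltr0n R 2)).
have [c' c'0 hc'] := inside_gap M0 d00 Eg.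
pose c := Num.min c' g.
have c0 : 0 < c by rewrite lt_min c'0.
have cg : c <= g by rewrite ge_min lexx orbT.
have hc y : inside d0 M0 y -> E y <= g - c.
  by move=> /hc' h; apply: (le_trans h); rewrite lerD2l lerN2 ge_min lexx.
pose e := c / 16; have e0 : 0 < e by rewrite divr_gt0.
have [d1 [M1 [N1 [d10 tight1 _]]]] := iter_law_tight th0 e0.
have [n0 hn0] := H_E M0 d00 e0; have [n1 hn1] := H_E M1 d10 e0.
pose N := maxn (maxn N0 N1) (maxn n0 n1).
have NN0 : (N0 <= N)%N by rewrite /N !leq_max leqnn.
have NN1 : (N1 <= N)%N by rewrite /N !leq_max leqnn !orbT.
have Nn0 : (n0 <= N)%N by rewrite /N !leq_max leqnn !orbT.
have Nn1 : (n1 <= N)%N by rewrite /N !leq_max leqnn !orbT.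
pose o0 := ind (fun z => ~~ inside d0 M0 z); pose o1 := ind (fun z => ~~ inside d1 M1 z).
have mo0 : measurable_fun [set: R] o0 by apply: measurable_ind; exact: measurable_inside.
have mo1 : measurable_fun [set: R] o1 by apply: measurable_ind; exact: measurable_inside.
(* On the first set [E] is at most g - c, elsewhere in the second at most g, and outside both the
   bound 1 is used. The mean of [W] plus e is at most g - c + e + c / 2 + 2 e, which is below g - c
   / 4. *)
pose W z := ((g - c + e)%:E + (c%:E * o0 z + o1 z))%E.
have a0 : 0 <= g - c + e by rewrite addr_ge0 ?subr_ge0// ltW.
have q0 z : (0 <= c%:E * o0 z)%E by rewrite mule_ge0 ?ind_ge0// lee_fin ltW.
have q1 z : (0 <= c%:E * o0 z + o1 z)%E by rewrite adde_ge0 ?ind_ge0.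
have W0 z : (0 <= W z)%E by rewrite adde_ge0// lee_fin.
have mc0 : measurable_fun [set: R] (fun z => c%:E * o0 z)%E by exact: emeasurable_funM.
have mc1 : measurable_fun [set: R] (fun z => c%:E * o0 z + o1 z)%E by exact: emeasurable_funD.
have mW : measurable_fun [set: R] W by exact: emeasurable_funD.
exists (g - c / 4); first by rewrite ltrBlDr ltrDl divr_gt0.
have := @asym_step N 0%N W W0 mW _ th x e th0 e0.
case=> [th' x' e' th'0 e'0|K _ hK].
  rewrite add0n; have [h1|h1] := boolP (inside d1 M1 th'); last first.
    apply: nearW => k; have /andP[_ H1] := H01 k N (s := (th', x')) th'0.
    apply: (le_trans H1); rewrite /W (_ : o1 th' = 1%E); last by rewrite /o1 /ind h1.
    rewrite -[leLHS]adde0 leeD ?lee_fin ?(ltW e'0)//.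
    by rewrite -[leLHS]add0e leeD ?lee_fin// -[leLHS]add0e leeD.
  have [h0|h0] := boolP (inside d0 M0 th').
    apply: filterS (hn0 N th' x' Nn0 h0) => k hk; apply: (le_trans hk).
    apply: (@le_trans _ _ (g - c + e)%:E); first by rewrite lee_fin lerD2r hc.
    by rewrite /W -addeA leeDl// adde_ge0// lee_fin ltW.
  apply: filterS (hn1 N th' x' Nn1 h1) => k hk; apply: (le_trans hk).
  apply: (@le_trans _ _ (W th')); last by rewrite leeDl// lee_fin ltW.
  rewrite /W /o0 /ind h0 mule1 addeA -EFinD; apply: le_trans (leeDl _ _); last first.
    by rewrite /o1 ind_ge0.
  rewrite lee_fin; have [y0 yt] := inside_D d10 h1.
  by have := Eg th' y0 yt; lra.
exists K => // k Kk; apply: (le_trans (hK k Kk)).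
apply: (@le_trans _ _ (((g - c + e)%:E + (c%:E * (1 / 2)%:E + e%:E)) + e%:E)%E); last first.
  by rewrite -EFinM -!EFinD lee_fin /e; lra.
apply: leeD => //; rewrite /W iter_lawD//.
apply: leeD.
  apply: (iter_law_le (kap_bounds t0) (U := fun _ _ => g - c + e)) => //.
  by move=> j y _ y0; exists (g - c + e) => //; exact: isE_cst.
rewrite iter_lawD//; last by move=> z; exact: ind_ge0.
apply: leeD; last exact: tight1.
rewrite iter_lawZ ?(ltW c0)//; last by move=> z; exact: ind_ge0.
by apply: lee_wpmul2l; [rewrite lee_fin ltW|exact: tight0].
Qed.

End ChainBound.

Section StrictMean.
Context {R : realType}.
Implicit Types (p v w c : R) (f g : R -> R).

(** If the mean were equal to c, every truncation to [0, 1] of k (c - f) would have mean 0, whereas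
    these truncations tend to 1. *)
Lemma isE_lt p f v c : 0 < p -> measurable_fun [set: R] f -> isE p f v ->
  (forall z, 0 < z -> f z < c) -> v < c.
Proof.
move=> p0 mf fv fc; rewrite lt_neqAle.
have -> : v <= c by apply: isE_le fv (isE_cst c p0) => z z0; exact/ltW/fc.
rewrite andbT; apply/negP => /eqP vc.
pose F (k : nat) z : \bar R := (Num.min 1 (Num.max 0 (k%:R * (c - f z))))%:E.
have F0 k z : (0 <= F k z)%E by rewrite lee_fin le_min ler01 le_max lexx.
have mF k : measurable_fun [set: R] (F k).
  apply/measurable_EFinP; apply: measurable_minr => //; apply: measurable_maxr => //.
  by apply: measurable_funM => //; exact: measurable_funB.
have cF : Ex p (F k) @[k --> \oo] --> Ex p (fun=> 1%E).
  apply: (@cvg_Ex _ _ _ _ _ 0 p0) => //; first exact: cvg_cst.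
    by move=> k z _; rewrite F0 lee_fin ge_min lexx.
  move=> z z0 _; apply: cvg_EFin; first exact: nearW.
  apply: (@cvg_trans _ ((fun=> 1 : R) k @[k --> \oo])); last exact: cvg_cst.
  apply: near_eq_cvg; near=> k; apply/esym/min_idPl.
  rewrite le_max; apply/orP; right; rewrite -ler_pdivrMr ?subr_gt0 ?fc//.
  by near: k; exact: nbhs_infty_ger.
have E0 k : Ex p (F k) = 0%E.
  apply/le_anti/andP; split; last by apply: Ex_ge0.
  have h := isEZ k%:R (isEB (isE_cst c p0) fv); rewrite vc subrr mulr0 in h.
  apply: (@le_trans _ _ (Ex p (fun z => (k%:R * (c - f z))%:E))); last by rewrite (isE_Ex h).
  apply: le_Ex => // z z0; rewrite lee_fin ge_min; apply/orP; right.
  by rewrite ge_max lexx andbT mulr_ge0// subr_ge0 ltW ?fc.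
rewrite (_ : (fun k => Ex p (F k)) = fun=> 0%E) in cF; last exact/funext.
rewrite (Ex_cst 1 p0) in cF.
have /eqP : 0%E = 1%E :> \bar R by apply: cvg_unique cF => //; exact: cvg_cst.
by rewrite eq_sym onee_eq0.
Unshelve. all: by end_near. Qed.

Lemma isE_dist p f g v w : 0 < p -> measurable_fun [set: R] f ->
  measurable_fun [set: R] g -> (forall z, 0 < z -> `|f z - g z| <= 1) ->
  isE p f v -> isE p g w ->
  (`|v - w|%:E <= Ex p (fun z => `|f z - g z|%:E))%E.
Proof.
move=> p0 mf mg fg1 fv gw.
have [d _ dE] : exists2 d, d <= 1 & isE p (fun z => `|f z - g z|) d.
  apply: isE_dom (isE_cst 1 p0).
    by apply: measurableT_comp => //; exact: measurable_funB.
  by move=> z z0; rewrite normr_ge0 fg1.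
rewrite (isE_Ex dE) lee_fin ler_norml; apply/andP; split.
  rewrite lerNl opprB; apply: isE_le (isEB gw fv) dE => z _.
  by rewrite distrC ler_norm.
by apply: isE_le (isEB fv gw) dE => z _; exact: ler_norm.
Qed.

End StrictMean.

Section AdaptiveEta.
Context {R : realType}.
Variables (theta0 t : R).
Hypotheses (theta0_gt0 : 0 < theta0) (t0 : 0 <= t).
Local Notation kap := (kap t).
Local Notation step := (chain_step theta0 kap).
Local Notation V := (value theta0 id kap (@expR R)).
Local Notation eta_lim := (eta_lim theta0).
Local Notation inside := (inside theta0).
Implicit Types (k m n j N : nat) (c d e l p q r th w x y z g M X : R).

Let exp0 x : x <= 0 -> 0 <= expR x. Proof. by move=> _; exact: expR_ge0. Qed.

Definition rV n (s : R * R) : R := fine (V n s).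

Lemma rV01 n s : 0 < s.1 -> 0 <= rV n s <= 1.
Proof.
case: s => th x th0; rewrite /rV.
by have [r [r0 r1 ->]] := value_real theta0 (kap_bounds t0) n x th0; rewrite r0.
Qed.

Lemma rVE n s : 0 < s.1 -> V n s = (rV n s)%:E.
Proof.
case: s => th x th0; rewrite /rV.
by have [r [_ _ ->]] := value_real theta0 (kap_bounds t0) n x th0.
Qed.

Lemma measurable_rV n : measurable_fun [set: R * R] (rV n).
Proof.
apply: (measurableT_comp (fine_measurable measurableT)).
by apply: measurable_value => //; exact: measurable_expR.
Qed.

Lemma rV_step_gt0 n th x z : 0 < th -> 0 < z -> 0 < (step n (th, x) z).1.
Proof. by move=> *; exact: (@step_gt0 R theta0 kap (kap_bounds t0) n (th, x)). Qed.

Lemma measurable_rV_step n m th x :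
  measurable_fun [set: R] (fun z => rV n (step m (th, x) z)).
Proof. exact: (measurableT_comp (measurable_rV n) (measurable_step theta0 kap m (th, x))). Qed.

Lemma rV_isE n th x : 0 < th -> 0 < x ->
  isE th (fun z => rV n.+1 (step n (th, x) z)) (rV n (th, x)).
Proof.
move=> th0 x0; apply: Ex_isE; first exact: measurable_rV_step.
  by move=> z z0; have /andP[] := rV01 n.+1 (rV_step_gt0 n x th0 z0).
rewrite -rVE// value_go//.
by apply: eq_Ex => z z0; rewrite rVE//; exact: rV_step_gt0.
Qed.

(** A compactness argument from [value_near_eta] and the continuity of [eta_lim]: the centre y of
    the local estimate may be replaced by th itself, uniformly over a compact set away from
    theta0. *)
Lemma uniform_eta d M e : 0 < d -> 0 < e -> exists X n1, forall n th x, (n1 <= n)%N ->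
  inside d M th -> X <= x -> `|rV n (th, x) - eta_lim th| <= e.
Proof.
move=> d0 e0; apply: contrapT => hn.
have bad j : exists p : nat * (R * R), [/\ (j <= p.1)%N, inside d M p.2.1,
    j%:R <= p.2.2 & e < `|rV p.1 p.2 - eta_lim p.2.1|].
  apply: contrapT => hj; apply: hn; exists j%:R, j => n th x nj hth hx.
  rewrite leNgt; apply/negP => h; apply: hj; exists (n, (th, x)); split=> //.
have [f fP] := choice bad.
have uM j : `|(f j).2.1| <= M by have [_ h _ _] := fP j; exact: inside_bounded d0 h.
have [g [y [gh gj cy]]] := bounded_subseq uM.
have iy : inside d M y by apply: inside_cvg cy => j; have [] := fP (g j).
have [y0 yt] := inside_D d0 iy.
have e2 : 0 < e / 2 by rewrite divr_gt0.
have [X [dl [n1 [dl0 h]]]] := value_near_eta theta0_gt0 (kap_bounds t0) (rho_ge0 t0)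
  (kap_rho_le t0) (cvg_kap t0) (cvg_rho t0) y0 yt e2.
have c1 : \forall j \near \oo, `|eta_lim y - eta_lim (f (g j)).2.1| <= e / 2.
  have c0 : eta_lim (f (g j)).2.1 @[j --> \oo] --> eta_lim y.
    by apply: continuous_cvg => //; exact: continuous_eta_lim.
  by move/cvgrPdist_le : c0; exact.
have c2 : \forall j \near \oo, `|y - (f (g j)).2.1| < dl.
  by move/cvgrPdist_lt : cy; exact.
have c3 : \forall j \near \oo, X <= j%:R /\ (n1 <= j)%N.
  near=> j; split; near: j; [exact: nbhs_infty_ger|exact: nbhs_infty_ge].
have [j _ hj] := filterI c1 (filterI c2 c3).
have [a1 [a2 [a3 a4]]] := hj j (leqnn j).
have [b1 b2 b3 b4] := fP (g j).
have [th0 _] := inside_D d0 b2.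
move: b4; rewrite ltNge => /negP; apply.
have := h (f (g j)).1 (f (g j)).2.1 (f (g j)).2.2 (leq_trans a4 (leq_trans (gj j) b1))
  th0 ltac:(by rewrite distrC) _.
rewrite -surjective_pairing -/(rV _ _) => /(_ _) H.
have {}H : `|rV (f (g j)).1 (f (g j)).2 - eta_lim y| <= e / 2.
  by apply: H; apply: (le_trans a3); apply: le_trans b3; rewrite ler_nat.
have := ler_distD (eta_lim y) (rV (f (g j)).1 (f (g j)).2) (eta_lim (f (g j)).2.1).
by move: H a1; lra.
Unshelve. all: by end_near. Qed.

(** The affine map r -> s + b r lets one statement serve for r and for 1 - r, that is, for upper and
    for lower bounds. *)
Lemma chain_lt (s b : R) (u : nat -> R) th x g :
  (forall r : R, 0 <= r <= 1 -> 0 <= s + b * r <= 1) ->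
  u k @[k --> \oo] --> +oo -> 0 < g ->
  (forall y, 0 < y -> y != theta0 -> s + b * eta_lim y < g) -> 0 < th ->
  exists2 g', g' < g & \forall k \near \oo, s + b * rV 0 (th, x + u k) <= g'.
Proof.
move=> sb cu g0 hg th0.
pose H k n (p : R * R) : \bar R := (s + b * rV n (p.1, p.2 + u k))%:E.
have [|||||g' gg hK] := @asymptotic_lt R theta0 t theta0_gt0 t0 H _ _ _
  (fun y => s + b * eta_lim y) _ _ g g0 hg th x th0.
- by move=> k n p p0; rewrite /H !lee_fin; apply: sb; exact: rV01.
- move=> k n; apply/measurable_EFinP; apply: measurable_funD => //.
  apply: measurable_funM => //; apply: (measurableT_comp (measurable_rV n)).
  apply: measurable_fun_pair => /=; first exact: measurable_fst.
  by apply: measurable_funD => //; exact: measurable_snd.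
- move=> n th' x' th'0; have : \forall k \near \oo, - x' < u k.
    by move/cvgryPgt : cu; exact.
  apply: filterS => k hk; have xu : 0 < x' + u k by rewrite -ltrBlDl sub0r.
  have := isED (isE_cst s th'0) (isEZ b (rV_isE n th'0 xu)).
  move=> h; rewrite le_eqVlt; apply/orP; left; apply/eqP; rewrite /H /= -(isE_Ex h).
  by apply: eq_Ex => z z0; rewrite /chain_step/= addrAC.
- move=> y y0 yt; apply: cvgD; first exact: cvg_cst.
  by apply: cvgM; [exact: cvg_cst|exact: continuous_eta_lim].
- move=> d M e d0 e0; have b0 : 0 < `|b| + 1 by rewrite ltr_wpDl.
  have [X [n1 h]] := uniform_eta M d0 (divr_gt0 e0 b0).
  exists n1 => n th' x' nn hth; have : \forall k \near \oo, X - x' < u k.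
    by move/cvgryPgt : cu; exact.
  apply: filterS => k hk; rewrite /H lee_fin/= -addrA lerD2l -lerBlDl -mulrBr.
  have /(h n th' _ nn hth) hX : X <= x' + u k by rewrite -lerBlDl ltW.
  apply: (le_trans (ler_norm _)); rewrite normrM.
  apply: (@le_trans _ _ (`|b| * (e / (`|b| + 1)))); first by rewrite ler_wpM2l.
  by rewrite mulrA ler_pdivrMr//; nra.
by exists g' => //; apply: filterS hK => k; rewrite /H lee_fin.
Qed.

(** Late in the chain both values are close to the same [eta_lim th], whatever the estimate th has
    become, so their distance fits [asymptotic_lt] with limit 0. The law of the late estimate does
    not have to converge. *)
Lemma chain_cauchy (u v : nat -> R) th e : 0 < th -> 0 < e ->
  u k @[k --> \oo] --> +oo -> v k @[k --> \oo] --> +oo ->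
  \forall k \near \oo, `|rV 0 (th, u k) - rV 0 (th, v k)| <= e.
Proof.
move=> th0 e0 cu cv.
pose H k n (p : R * R) : \bar R :=
  `|rV n (p.1, p.2 + u k) - rV n (p.1, p.2 + v k)|%:E.
have H1 k n (p : R * R) : 0 < p.1 -> `|rV n (p.1, p.2 + u k) - rV n (p.1, p.2 + v k)| <= 1.
  move=> p0; have /andP[a1 a2] := @rV01 n (p.1, p.2 + u k) p0.
  have /andP[b1 b2] := @rV01 n (p.1, p.2 + v k) p0.
  by rewrite ler_norml; apply/andP; split; lra.
have mr (w : nat -> R) k n : measurable_fun [set: R * R] (fun p : R * R => rV n (p.1, p.2 + w k)).
  apply: (measurableT_comp (measurable_rV n)).
  apply: measurable_fun_pair => /=; first exact: measurable_fst.
  by apply: measurable_funD => //; exact: measurable_snd.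
have [||||||g' gg hK] := @asymptotic_lt R theta0 t theta0_gt0 t0 H _ _ _
  (fun=> 0) _ _ e e0 _ th 0 th0.
- by move=> k n p p0; rewrite /H !lee_fin normr_ge0 H1.
- move=> k n; apply/measurable_EFinP; apply: measurableT_comp => //.
  by apply: measurable_funB; exact: mr.
- move=> n th' x' th'0.
  have a1 : \forall k \near \oo, - x' < u k by move/cvgryPgt : cu; exact.
  have a2 : \forall k \near \oo, - x' < v k by move/cvgryPgt : cv; exact.
  apply: filterS2 a1 a2 => k hk hk'.
  have xu : 0 < x' + u k by rewrite -ltrBlDl sub0r.
  have xv : 0 < x' + v k by rewrite -ltrBlDl sub0r.
  have := isE_dist th'0 (measurable_rV_step _ _ _ _) (measurable_rV_step _ _ _ _) _
     (rV_isE n th'0 xu) (rV_isE n th'0 xv).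
  have E z : step n (th', x' + u k) z =
     ((step n (th', x') z).1, (step n (th', x') z).2 + u k).
    by rewrite /chain_step/= addrAC.
  have E' z : step n (th', x' + v k) z =
     ((step n (th', x') z).1, (step n (th', x') z).2 + v k).
    by rewrite /chain_step/= addrAC.
  move=> h; apply: (le_trans (h _)).
    by move=> z z0; rewrite E E' H1//; exact: rV_step_gt0.
  by rewrite le_eqVlt; apply/orP; left; apply/eqP; apply: eq_Ex => z _; rewrite E E'.
- by move=> y _ _; exact: cvg_cst.
- move=> d M e' d0 e'0; have e2 : 0 < e' / 2 by rewrite divr_gt0.
  have [X [n1 h]] := uniform_eta M d0 e2.
  exists n1 => n th' x' nn hth.
  have a1 : \forall k \near \oo, X - x' < u k by move/cvgryPgt : cu; exact.
  have a2 : \forall k \near \oo, X - x' < v k by move/cvgryPgt : cv; exact.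
  apply: filterS2 a1 a2 => k hk hk'; rewrite /H lee_fin/= add0r.
  have /(h n th' _ nn hth) h1 : X <= x' + u k by rewrite -lerBlDl ltW.
  have /(h n th' _ nn hth) h2 : X <= x' + v k by rewrite -lerBlDl ltW.
  apply: (le_trans (ler_distD (eta_lim th') _ _)).
  by rewrite [`|eta_lim th' - _|]distrC; lra.
- by [].
by apply: filterS hK => k; rewrite /H lee_fin/= !add0r => h; apply: (le_trans h); exact: ltW.
Qed.

Definition chain_lim th : R := lim (rV 0 (th, x) @[x --> +oo]).

Lemma cvg_chain_lim th : 0 < th -> rV 0 (th, x) @[x --> +oo] --> chain_lim th.
Proof.
move=> th0; apply: cauchy_cvg; apply: cauchy_exP => e e0.
suff [X hX] : exists X, forall x, X <= x -> `|rV 0 (th, X) - rV 0 (th, x)| < e.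
  exists (rV 0 (th, X)); exists X; split; first exact: num_real.
  by move=> x /ltW Xx; exact: hX.
apply: contrapT => hn.
have bad (k : nat) : exists x, k%:R <= x /\ e <= `|rV 0 (th, k%:R) - rV 0 (th, x)|.
  apply: contrapT => hk; apply: hn; exists k%:R => x kx; rewrite ltNge.
  by apply/negP => h; apply: hk; exists x.
have [f fP] := choice bad.
have cu : (k%:R : R) @[k --> \oo] --> +oo by exact: cvgr_idn.
have cf : f k @[k --> \oo] --> +oo.
  by apply: (ger_cvgy _ cu); apply: nearW => k; have [] := fP k.
have [K _ hK] := chain_cauchy th0 (divr_gt0 e0 (ltr0n R 2)) cu cf.
have := hK K (leqnn K); have [_ h] := fP K => /=.
by move: h e0; lra.
Qed.

Lemma chain_lim01 th : 0 < th -> 0 <= chain_lim th <= 1.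
Proof.
move=> th0; have c := cvg_chain_lim th0; apply/andP; split.
  by apply: (cvgr_to_ge c); apply: nearW => x; have /andP[] := rV01 0 (s := (th, x)) th0.
by apply: (cvgr_to_le c); apply: nearW => x; have /andP[] := rV01 0 (s := (th, x)) th0.
Qed.

Lemma chain_lim_lt (s b : R) th g :
  (forall r : R, 0 <= r <= 1 -> 0 <= s + b * r <= 1) -> 0 < g ->
  (forall y, 0 < y -> y != theta0 -> s + b * eta_lim y < g) -> 0 < th ->
  s + b * chain_lim th < g.
Proof.
move=> sb g0 hg th0; have cu : (k%:R : R) @[k --> \oo] --> +oo by exact: cvgr_idn.
have [g' gg hK] := chain_lt 0 sb cu g0 hg th0; apply: le_lt_trans gg.
have /cvg_pinftyP/(_ _ cu) c := cvg_chain_lim th0.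
have c' : s + b * rV 0 (th, 0 + k%:R) @[k --> \oo] --> s + b * chain_lim th.
  apply: cvgD; first exact: cvg_cst.
  by apply: cvgM; [exact: cvg_cst|under eq_fun do rewrite add0r].
exact: (cvgr_to_le c').
Qed.

Variable tau : R -> R.
Hypothesis tau_gt0 : forall z, 0 < z -> 0 < tau z.
Hypothesis mtau : measurable_fun [set: R] tau.
Variable p : R.
Hypothesis p0 : 0 < p.

(** The first observation is taken apart: it follows the first estimate [p], and [tau z] is the
    estimate that it produces. Here [tau] is a section variable, not the stopping rule. *)
Definition first_mean b : R := fine (Ex p (fun z => V 0%N (tau z, b - llr theta0 p z))).

Definition first_lim : R := lim (first_mean b @[b --> +oo]).

Let mVtau b : measurable_fun [set: R] (fun z => V 0%N (tau z, b - llr theta0 p z)).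
Proof.
have mV : measurable_fun [set: R * R] (V 0%N) by exact: measurable_value.
apply: (measurableT_comp mV); apply: measurable_fun_pair => //=.
by apply: measurable_funB => //; exact: measurable_llr.
Qed.

Lemma measurable_chain_lim_tau :
  measurable_fun [set: R] (fun z => if (0 < z)%R then chain_lim (tau z) else 0).
Proof.
apply: (@measurable_fun_cvg _ _ R setT
  (fun (k : nat) z => if (0 < z)%R then rV 0 (tau z, k%:R) else 0)).
  move=> k; apply: measurable_fun_ifT => //; first exact: measurable_fun_ltr.
  by apply: (measurableT_comp (measurable_rV 0)); exact: measurable_fun_pair.
move=> z _; case: ifP => [z0|_]; last exact: cvg_cst.
have cu : (k%:R : R) @[k --> \oo] --> +oo by exact: cvgr_idn.
by have /cvg_pinftyP/(_ _ cu) := cvg_chain_lim (tau_gt0 z0).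
Qed.

Let F0 z : R := if (0 < z)%R then chain_lim (tau z) else 0.

Let F01 z : 0 <= F0 z <= 1.
Proof.
rewrite /F0; case: ifPn => [z0|_]; last by rewrite lexx ler01.
exact: chain_lim01 (tau_gt0 z0).
Qed.

Let first_lim_isE : exists v, isE p F0 v /\ first_mean b @[b --> +oo] --> v.
Proof.
have [v _ vE] : exists2 v, v <= 1 & isE p F0 v.
  apply: isE_dom (isE_cst 1 p0); first exact: measurable_chain_lim_tau.
  by move=> z _; exact: F01.
exists v; split=> //; apply/cvg_pinftyP => u cu.
have : Ex p (fun z => V 0%N (tau z, u n - llr theta0 p z)) @[n --> \oo] -->
    Ex p (fun z => (F0 z)%:E).
  apply: (@cvg_Ex _ _ _ _ _ 0 p0) => //; first exact: cvg_cst.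
  - by apply/measurable_EFinP; exact: measurable_chain_lim_tau.
  - move=> n z z0; rewrite rVE ?lee_fin; last exact: tau_gt0.
    by apply: (@rV01 0%N (tau z, _)); exact: tau_gt0.
  - by move=> z _; rewrite lee_fin; have /andP[] := F01 z.
  - move=> z z0 _; rewrite /F0 z0.
    rewrite (_ : (fun n => _) = fun n => (rV 0 (tau z, u n - llr theta0 p z))%:E); last first.
      by apply/funext => n; rewrite rVE//; exact: tau_gt0.
    apply: cvg_EFin; first exact: nearW.
    have /cvg_pinftyP := cvg_chain_lim (tau_gt0 z0); apply.
    apply/cvgryPge => A; move/cvgryPge : cu => /(_ (A + llr theta0 p z)).
    by apply: filterS => n; rewrite lerBrDr.
by rewrite (isE_Ex vE) => /fine_cvgP[].
Qed.

Lemma cvg_first_lim : first_mean b @[b --> +oo] --> first_lim.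
Proof. by have [v [_ cv]] := first_lim_isE; exact: cvgP cv. Qed.

(** If every value of [eta_lim] were below the limit, [chain_lim] would be strictly below it at
    every estimate by [chain_lim_lt], and so would its mean by [isE_lt]. Strictness matters: it
    provides attained values of [eta_lim] where bounds by a supremum or an infimum would not. *)
Lemma first_lim_between : exists y1 y2,
  [/\ 0 < y1, y1 != theta0, 0 < y2 & y2 != theta0] /\ eta_lim y1 <= first_lim <= eta_lim y2.
Proof.
have [v [vE cv]] := first_lim_isE.
have -> : first_lim = v by apply: (cvg_unique _ cvg_first_lim cv).
have v01 : 0 <= v <= 1.
  apply/andP; split; first by apply: isE_ge0 vE => z _; have /andP[] := F01 z.
  by apply: isE_le vE (isE_cst 1 p0) => z _; have /andP[] := F01 z.
have e01 := eta_lim01 theta0_gt0.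
have [y2 [y20 y2t h2]] : exists y, [/\ 0 < y, y != theta0 & v <= eta_lim y].
  apply: contrapT => hn.
  have hv y : 0 < y -> y != theta0 -> 0 + 1 * eta_lim y < v.
    move=> y0 yt; rewrite add0r mul1r ltNge; apply/negP => h.
    by apply: hn; exists y.
  (* [chain_lim_lt] asks for a positive bound; any regular point, here theta0 + 1, supplies it. *)
  have v0 : 0 < v.
    have y1t : theta0 + 1 != theta0 by rewrite -subr_eq0 addrC addKr oner_eq0.
    have y10 : 0 < theta0 + 1 by rewrite addr_gt0.
    apply: le_lt_trans (hv _ y10 y1t); rewrite add0r mul1r.
    by have /andP[] := e01 _ y10 y1t.
  suff : v < v by rewrite ltxx.
  apply: (isE_lt p0 measurable_chain_lim_tau vE) => z z0; rewrite z0.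
  have := @chain_lim_lt 0 1 (tau z) v _ v0 hv (tau_gt0 z0).
  by rewrite add0r mul1r; apply => r; rewrite add0r mul1r.
have [y1 [y10 y1t h1]] : exists y, [/\ 0 < y, y != theta0 & eta_lim y <= v].
  apply: contrapT => hn.
  have hv y : 0 < y -> y != theta0 -> 1 + -1 * eta_lim y < 1 - v.
    move=> y0 yt; rewrite mulN1r ltrD2l ltrN2 ltNge; apply/negP => h.
    by apply: hn; exists y.
  have v0 : 0 < 1 - v.
    by have := hv y2 y20 y2t; have /andP[] := e01 y2 y20 y2t; lra.
  suff : 1 - v < 1 - v by rewrite ltxx.
  have mf : measurable_fun [set: R] (fun z => 1 - F0 z).
    by apply: measurable_funB => //; exact: measurable_chain_lim_tau.
  apply: (isE_lt p0 mf (isEB (isE_cst 1 p0) vE)) => z z0; rewrite /F0 z0.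
  have := @chain_lim_lt 1 (-1) (tau z) (1 - v) _ v0 hv (tau_gt0 z0).
  by rewrite mulN1r; apply => r; rewrite mulN1r; lra.
by exists y1, y2; split; [|rewrite h1 h2].
Qed.

End AdaptiveEta.

(** * Power one and the change of measure *)

Section PowerOne.
Context {R : realType}.
Variables (theta0 t v : R).
Hypotheses (theta0_gt0 : 0 < theta0) (t0 : 0 <= t) (v0 : 0 < v) (vt : v != theta0).
Local Notation rho := (rho t).
Local Notation kap := (kap t).
Local Notation step := (chain_step theta0 kap).
Local Notation N := (value theta0 (fun=> v) kap (fun=> 1)).
Implicit Types (m n j : nat) (c d e r th w x z : R).

Let one_ge0 x : x <= 0 -> 0 <= (fun=> 1 : R) x. Proof. by []. Qed.
Let q_gt0 th : 0 < th -> 0 < (fun=> v) th. Proof. by []. Qed.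

Let N_ge0 n s : (0 <= N n s)%E. Proof. exact: value_ge0. Qed.

(** While the estimate stays in the d-ball around the true parameter v, the walk crosses up to a
    geometric error; the fraction bounds the chance of leaving the ball. The bound is informative
    only for a late start near v, a situation that [reject_lower_iter] brings about. *)
Lemma reject_lower : exists2 d, 0 < d & forall n th x, 0 < th ->
  (1 <= N n (th, x) + (((th - v) ^+ 2 + v * rho n) / d ^+ 2)%:E)%E.
Proof.
have [c [r [B [c0 r0 r1 B0 loc]]]] := llr_local theta0_gt0 v0 vt.
have [d /= d0 dloc] := loc; exists d => // n th x th0.
pose Reg n (s : R * R) := `|s.1 - v| < d /\ 0 < s.2.
pose W n (s : R * R) := ((s.1 - v) ^+ 2 + v * rho n) / d ^+ 2.
pose U m n (s : R * R) := W n s + expR (2^-1 * s.2) * r ^+ m.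
have W0 n' (s : R * R) : 0 <= W n' s.
  by rewrite divr_ge0 ?sqr_ge0// addr_ge0 ?sqr_ge0// mulr_ge0 ?rho_ge0// ltW.
have U2 m' (s : R * R) : 0 <= expR (2^-1 * s.2) * r ^+ m'.
  by rewrite mulr_ge0 ?expR_ge0// exprn_ge0// ltW.
have U_ge0 m' n' (s : R * R) : 0 < s.1 -> 0 <= U m' n' s by move=> _; rewrite addr_ge0.
have Reg_gt0 n' (s : R * R) : Reg n' s -> 0 < s.2 by case.
have UE m' n' (s : R * R) : 0 < s.1 -> Reg n' s -> exists2 w, w <= U m'.+1 n' s &
    isE v (fun z => U m' n'.+1 (step n' s z)) w.
  case: s => s1 s2 /= s10 [/= h s20].
  have [|_ _ h1 _ _] := dloc s1; first by rewrite /= distrC.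
  have [w1 w1l w1E] := isE_half_geom m' s2 v0 h1 r0.
  have H := isED (isEZ ((d ^+ 2)^-1) (isED (isE_step_sqr (kap n') s1 v v0)
    (isE_cst (v * rho n'.+1) v0))) w1E.
  refine (ex_intro2 _ _ _ _ (isE_ext _ H)); last first.
    by move=> z _; rewrite /U /W /= mulrC.
  rewrite /U /W /= lerD// [leRHS]mulrC ler_wpM2l ?invr_ge0 ?sqr_ge0//.
  rewrite -addrA lerD//.
    rewrite (_ : _ - v = (1 - kap n') * (s1 - v)); last by ring.
    have /andP[k0 k1] := kap_bounds t0 n'.
    rewrite exprMn ler_piMl ?sqr_ge0// expr_le1//; last by rewrite subr_ge0 ltW.
    by rewrite gerBl.
  by rewrite (mulrC v) -mulrDl mulrC ler_wpM2l ?(ltW v0)// kap_rho_le.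
have hN m' n' (s : R * R) : 0 < s.1 -> ~ Reg n' s -> (1 <= N n' s + (U m' n' s)%:E)%E.
  move=> s0 nr; have [h|h] := leP s.2 0.
    by rewrite value_stop// leeDl// lee_fin U_ge0.
  apply: (@le_trans _ _ (U m' n' s)%:E); last by rewrite leeDr.
  rewrite lee_fin /U; apply: (@le_trans _ _ (W n' s)); last by rewrite lerDl.
  rewrite /W ler_pdivlMr ?exprn_gt0// mul1r.
  have hd : d <= `|s.1 - v| by rewrite leNgt; apply/negP => h'; apply: nr.
  rewrite -(real_normK (num_real (s.1 - v))) -[leLHS]addr0 lerD//.
    by rewrite ler_pXn2r ?nnegrE// ltW.
  by rewrite mulr_ge0 ?rho_ge0// ltW.
have h0 n' (s : R * R) : 0 < s.1 -> Reg n' s -> (1 <= N n' s + (U 0%N n' s)%:E)%E.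
  move=> s0 [_ s20]; apply: (@le_trans _ _ (U 0%N n' s)%:E); last by rewrite leeDr.
  rewrite lee_fin /U expr0 mulr1; apply: (@le_trans _ _ (expR (2^-1 * s.2))).
    by rewrite -[leLHS]expR0 ler_expR mulr_ge0// ltW.
  by rewrite lerDr.
have main m := verif_lower (theta0 := theta0) (q := fun=> v) (kap := kap) (phi := fun=> 1)
  (measurable_cst _) (measurable_cst _) one_ge0 q_gt0 (kap_bounds t0) Reg_gt0 U_ge0 UE
  ler01 hN h0 m n (s := (th, x)) th0.
have N1 : (N n (th, x) <= 1)%E by apply: value_le1 => //; exact: kap_bounds.
have [N' [_ _ NE]] := real01 (N_ge0 n (th, x)) N1.
rewrite NE -EFinD lee_fin; apply: (@le_geom _ _ _ (expR (2^-1 * x)) r) => // m.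
by have := main m; rewrite NE -EFinD lee_fin /U addrA.
Qed.

(** After j more steps the estimate is a weighted mean of th and j observations with overall weight
    1 / rho (n + j); its mean square distance to v is exactly (rho (n + j) / rho n)^2 (th - v)^2 + v
    j rho (n + j)^2. No law of large numbers is needed. *)
Lemma reject_lower_iter : exists2 d, 0 < d & forall j n th x, 0 < th ->
  (1 <= N n (th, x) + (((rho (n + j) / rho n) ^+ 2 * (th - v) ^+ 2 +
     v * (j%:R * rho (n + j) ^+ 2 + rho (n + j))) / d ^+ 2)%:E)%E.
Proof.
have [d d0 h] := reject_lower; exists d => //; elim=> [|j ih] n th x th0.
  have := h n th x th0.
  by rewrite addn0 divff ?gt_eqF ?rho_gt0// expr1n !mul1r mul0r add0r.
have b0 (k : nat) y : 0 <= (y ^+ 2 * (th - v) ^+ 2 +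
    v * (k%:R * rho (n + j.+1) ^+ 2 + rho (n + j.+1))) / d ^+ 2.
  rewrite divr_ge0 ?sqr_ge0// addr_ge0//; first by rewrite mulr_ge0// sqr_ge0.
  rewrite mulr_ge0 ?(ltW v0)// addr_ge0 ?rho_ge0//.
  by apply: mulr_ge0; rewrite ?ler0n ?sqr_ge0.
have [x0|x0] := leP x 0; first by rewrite value_stop//= leeDl// lee_fin.
rewrite value_go//=.
set a := rho (n + j.+1) in b0 *.
have H := isEZ ((d ^+ 2)^-1) (isED (isEZ ((a / rho n.+1) ^+ 2)
  (isE_step_sqr (kap n) th v v0)) (isE_cst (v * (j%:R * a ^+ 2 + a)) v0)).
set w := (X in isE _ _ X) in H.
have -> : ((a / rho n) ^+ 2 * (th - v) ^+ 2 + v * (j.+1%:R * a ^+ 2 + a)) / d ^+ 2 = w.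
  have k0 := kap_gt0 t0 n; have r0 := rho_gt0 t0 n.
  have e : rho n = kap n / (1 - kap n).
    rewrite kap_rho_eq// invf_div mulrCA mulfV ?mulr1// gt_eqF//.
  have k1 : 0 < 1 - kap n by have /andP[_] := kap_bounds t0 n; rewrite subr_gt0.
  rewrite /w -[rho n.+1]/(kap n) e -natr1.
  by field; rewrite !gt_eqF.
rewrite -(Ex_addE _ _ _ H)//; first last.
- move=> z z0; rewrite mulr_ge0 ?invr_ge0 ?sqr_ge0// addr_ge0//.
    by rewrite mulr_ge0// sqr_ge0.
  rewrite mulr_ge0 ?(ltW v0)// addr_ge0 ?rho_ge0//.
  by apply: mulr_ge0; rewrite ?ler0n ?sqr_ge0.
- by apply: measurable_value_step.
rewrite -(Ex_cst 1 v0); apply: le_Ex => z z0 //.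
have := ih n.+1 (th + kap n * (z - th)) (x - llr theta0 th z)
  (kap_step_gt0 (kap_bounds t0) n th0 z0).
by rewrite addSnnS -/a [X in (_ + X%:E)%E]mulrC.
Qed.

Lemma power_one n th x : 0 < th -> N n (th, x) = 1%E.
Proof.
move=> th0; have [d d0 h] := reject_lower_iter.
have N1 : (N n (th, x) <= 1)%E by apply: value_le1 => //; exact: kap_bounds.
have [r [_ r1 rE]] := real01 (N_ge0 n (th, x)) N1.
rewrite rE; congr (_%:E); apply/le_anti/andP; split=> //.
have cr : rho (n + j) @[j --> \oo] --> 0.
  have := cvg_rho t0; rewrite -(cvg_shiftn n) => c.
  by under eq_fun do rewrite addnC.
have cj : \forall j \near \oo, 1 <= r + ((rho (n + j) / rho n) ^+ 2 * (th - v) ^+ 2 +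
     v * (2 * rho (n + j))) / d ^+ 2.
  (* j rho (n + j) <= 1, so the variance term is at most v rho (n + j). *)
  apply: nearW => j; have := h j n th x th0; rewrite rE -EFinD lee_fin => hj.
  apply: (le_trans hj); rewrite lerD2l ler_wpM2r ?invr_ge0 ?sqr_ge0// lerD2l.
  rewrite ler_wpM2l ?(ltW v0)// mulr2n mulrDl mul1r lerD2r.
  rewrite expr2 mulrA ler_piMl ?rho_ge0// ler_pdivrMr ?rho_den_gt0// mul1r natrD.
  by move: t0 (ler0n R n); lra.
have cl : r + ((rho (n + j) / rho n) ^+ 2 * (th - v) ^+ 2 +
     v * (2 * rho (n + j))) / d ^+ 2 @[j --> \oo] -->
   r + ((0 / rho n) ^+ 2 * (th - v) ^+ 2 + v * (2 * 0)) / d ^+ 2.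
  apply: cvgD; first exact: cvg_cst.
  apply: cvgM; last exact: cvg_cst.
  apply: cvgD; last by apply: cvgM; [exact: cvg_cst|apply: cvgM => //; exact: cvg_cst].
  apply: cvgM; last exact: cvg_cst.
  under eq_fun do rewrite expr2; rewrite expr2.
  by apply: cvgM; apply: cvgM => //; exact: cvg_cst.
apply: (@le_trans _ _ (r + ((0 / rho n) ^+ 2 * (th - v) ^+ 2 + v * (2 * 0)) / d ^+ 2)).
  exact: (cvgr_to_ge cl cj).
by rewrite mul0r expr0n/= mul0r !mulr0 add0r mul0r addr0.
Qed.

End PowerOne.

Section ChangeOfMeasure.
Context {R : realType}.
Variables (theta0 : R) (kap : nat -> R).
Hypothesis theta0_gt0 : 0 < theta0.
Hypothesis kap_lt1 : forall n, 0 <= kap n < 1.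
Implicit Types (m n : nat) (th x z : R).
Local Notation V_upto := (value_upto theta0 id kap (@expR R)).
Local Notation N_upto := (value_upto theta0 (fun=> theta0) kap (fun=> 1)).

Lemma Ex_llr th (F : R -> \bar R) :
  Ex theta0 (fun z => ((expR (llr theta0 th z))%:E * F z)%E) = Ex th F.
Proof.
apply: eq_integral => z _; rewrite muleA -EFinM -(gpdf_llr _ th).
by rewrite -mulrA -expRD addNr expR0 mulr1.
Qed.

(** Wald's likelihood ratio identity by induction on the steps: the log-likelihood accumulated up to
    the crossing is x minus the final distance, and that distance is minus the overshoot. *)
Lemma change_of_measure_upto m n th x : 0 < th ->
  N_upto m n (th, x) = ((expR (- x))%:E * V_upto m n (th, x))%E.
Proof.
elim: m n th x => [|m ih] n th x th0; have [x0|x0] := leP x 0.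
- by rewrite !value_upto_stop//= -EFinM -expRD addNr expR0.
- by rewrite !value_upto_go0// mule0.
- by rewrite !value_upto_stop//= -EFinM -expRD addNr expR0.
rewrite !value_upto_go//= -ExZ ?expR_ge0//; first last.
- by move=> z z0; apply: value_upto_ge0 => ? _; exact: expR_ge0.
- by apply: measurable_value_upto_step => // ? _; exact: expR_ge0.
rewrite -(Ex_llr th); apply: eq_Ex => z z0.
rewrite [in LHS]/chain_step [in RHS]/chain_step /= ih; last exact: kap_step_gt0.
by rewrite muleA -EFinM -expRD; congr ((expR _)%:E * _)%E; ring.
Qed.

Lemma change_of_measure n th x : 0 < th ->
  value theta0 (fun=> theta0) kap (fun=> 1) n (th, x) =
    ((expR (- x))%:E * value theta0 id kap (@expR R) n (th, x))%E.
Proof.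
move=> th0; apply: (@cvg_lim) => //.
rewrite (_ : (fun m => _) = fun m => ((expR (- x))%:E * V_upto m n (th, x))%E); last first.
  by apply/funext => m; exact: change_of_measure_upto.
by apply: cvgeZl => //; apply: cvg_value_upto => // ? _; exact: expR_ge0.
Qed.

End ChangeOfMeasure.

Section IidMean.
Context {R : realType}.
Variable theta0 : R.
Hypothesis theta0_gt0 : 0 < theta0.

(** The crossing time is at least 1, so one observation is drawn before the first test. By dominated
    convergence this extra draw does not change the limit. *)
Lemma cvg_Ex_iid_value (y : R) : 0 < y -> y != theta0 ->
  fine (Ex y (fun z => iid_value theta0 y (b - llr theta0 y z)%R)) @[b --> +oo]
    --> eta_lim theta0 y.
Proof.
move=> y0 yt; apply/cvg_pinftyP => u cu.
have : Ex y (fun z => iid_value theta0 y (u n - llr theta0 y z)%R) @[n --> \oo] -->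
    Ex y (fun=> (eta_lim theta0 y)%:E).
  apply: (@cvg_Ex _ _ _ _ _ 0 y0) => //; first exact: cvg_cst.
  - by move=> n; exact: measurable_iid_value_llr.
  - by move=> n z _; rewrite iid_value_ge0 iid_value_le1.
  - by move=> z _; rewrite lee_fin; have /andP[] := eta_lim01 theta0_gt0 y0 yt.
  - move=> z z0 _; rewrite (_ : (fun n => _) =
      fun n => (fine (iid_value theta0 y (u n - llr theta0 y z)))%:E); last first.
      apply/funext => n.
      by have [r [_ _ ->]] := iid_value_real theta0 (u n - llr theta0 y z) y0.
    apply: cvg_EFin; first exact: nearW.
    have /cvg_pinftyP := cvg_eta_lim theta0_gt0 y0 yt; apply.
    apply/cvgryPge => A; move/cvgryPge : cu => /(_ (A + llr theta0 y z)).
    by apply: filterS => n; rewrite lerBrDr.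
by rewrite Ex_cst// => /fine_cvgP[].
Qed.

Lemma Ex_iid_value_real (y b : R) : 0 < y -> exists r : R,
  [/\ 0 <= r, r <= 1 & Ex y (fun z => iid_value theta0 y (b - llr theta0 y z)%R) = r%:E].
Proof.
move=> y0; apply: real01; first by apply: Ex_ge0 => z _; exact: iid_value_ge0.
rewrite -(Ex_cst 1 y0); apply: le_Ex => z _; first exact: iid_value_ge0.
exact: iid_value_le1.
Qed.

End IidMean.

(** * From the observations to the chain *)

Section MfunOf.
Variables (d1 d2 : measure_display) (T1 : measurableType d1) (T2 : measurableType d2).
Variables (f : T1 -> T2) (mf : measurable_fun [set: T1] f).

Let mf_mixin := isMeasurableFun.Build _ _ _ _ _ mf.
Definition mfun_of : {mfun T1 >-> T2} := HB.pack f mf_mixin.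

End MfunOf.

Section GammaLaw.
Context {R : realType}.
Local Notation mu := (@lebesgue_measure R).
Local Notation pos := (`]0%R, +oo[%classic : set (measurableTypeR R)).
Variables (d : measure_display) (T : measurableType d) (P : probability T R).

Lemma gamma_pdf_patch (th z : R) : 0 < th ->
  (gamma_pdf th z)%:E = ((fun z => (gpdf th z)%:E) \_ pos) z.
Proof.
move=> th0; rewrite patchE; case: ifPn; rewrite ?inE ?posRE => z0.
  by rewrite gamma_pdfE.
have z0' : ~~ (0 < z) by apply: contra z0 => h; rewrite inE posRE.
by rewrite /gamma_pdf (negbTE z0').
Qed.

Lemma measurable_gamma_pdf (th : R) : 0 < th ->
  measurable_fun [set: measurableTypeR R] (fun z => (gamma_pdf th z)%:E).
Proof.
move=> th0; have m : measurable_fun [set: R]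
    (fun z => if (0 < z)%R then (gpdf th z)%:E else 0%E).
  apply: measurable_fun_ifT => //; first exact: measurable_fun_ltr.
  by apply/measurable_EFinP; exact: measurable_fun_gpdf.
rewrite (_ : (fun z => _) = (fun z => if (0 < z)%R then (gpdf th z)%:E else 0%E)).
  exact: m.
apply/funext => z; rewrite gamma_pdf_patch// patchE.
case: (boolP (z \in pos)) => [|/negP h]; first by rewrite inE posRE => ->.
by rewrite ifF//; apply/negP => z0; apply: h; rewrite inE posRE.
Qed.

(** The law is given on sets only. The density is identified almost everywhere with the
    Radon-Nikodym derivative, and the latter integrates all nonnegative f. *)
Lemma gamma_law_integral (th : R) (X : {mfun T >-> R}) (f : R -> \bar R) :
  0 < th -> gamma_law P th X -> measurable_fun [set: R] f -> (forall z, 0 <= f z)%E ->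
  (\int[P]_w f (X w) = Ex th f)%E.
Proof.
move=> th0 lX mf f0; have mX : measurable_fun [set: T] (X : T -> measurableTypeR R) := measurable_funPT X.
pose X' := mfun_of mX.
pose nu := distribution P X'.
have nuE A : measurable A -> nu A = (\int[mu]_(z in A) (gamma_pdf th z)%:E)%E.
  by move=> mA; exact: lX.
have dom : nu `<< mu.
  apply/null_content_dominatesP => A mA muA; rewrite nuE//.
  by apply: null_set_integral => //; apply: measurable_funTS; exact: measurable_gamma_pdf.
have -> : (\int[P]_w f (X w) = \int[nu]_z f z)%E.
  by rewrite (ge0_integral_distribution X').
rewrite -(Radon_Nikodym_SigmaFinite.change_of_variables dom)//.
transitivity (\int[mu]_z (f z * (gamma_pdf th z)%:E))%E.
  apply: ae_eq_integral => //.
  - apply: emeasurable_funM => //.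
    exact: measurable_int (Radon_Nikodym_SigmaFinite.f_integrable dom).
  - by apply: emeasurable_funM => //; exact: measurable_gamma_pdf.
  - apply: ae_eqe_mul2l; apply: integral_ae_eq => //.
    + exact: Radon_Nikodym_SigmaFinite.f_integrable.
    + exact: measurable_gamma_pdf.
    + by move=> A _ mA; rewrite -(Radon_Nikodym_SigmaFinite.f_integral dom)//; exact: nuE.
rewrite /Ex [RHS]integral_mkcond; apply: eq_integral => z _.
rewrite gamma_pdf_patch// !patchE; case: ifPn => _; first by rewrite muleC.
by rewrite mule0.
Qed.

End GammaLaw.

Section Independence.
Context {R : realType}.
Variables (d d' : measure_display) (T : measurableType d) (U : measurableType d').
Variables (P : probability T R).

Lemma measure_unique_rect (d1 d2 : measure_display) (U1 : measurableType d1)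
    (U2 : measurableType d2) (m1 m2 : {measure set (U1 * U2) -> \bar R}) :
  (m1 setT < +oo)%E ->
  (forall A B, measurable A -> measurable B -> m1 (A `*` B) = m2 (A `*` B)) ->
  forall C, measurable C -> m1 C = m2 C.
Proof.
move=> m1oo m12 C mC.
pose G : set (set (U1 * U2)) :=
  [set C | exists A, measurable A /\ exists B, measurable B /\ C = A `*` B].
apply: (measure_unique G (fun=> setT)) => //.
- rewrite measurable_prod_measurableType //; congr (<<s _ >>).
  rewrite predeqE; split => [[A mA [B mB <-]]|[A [mA [B [mB ->]]]]].
    by exists A; split => //; exists B.
  by exists A => //; exists B.
- move=> _ _ [A1 [mA1 [B1 [mB1 ->]]]] [A2 [mA2 [B2 [mB2 ->]]]].
  rewrite -setXI; exists (A1 `&` A2); split; first exact: measurableI.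
  by exists (B1 `&` B2); split => //; exact: measurableI.
- by move=> n; exists setT; split => //; exists setT; split => //; rewrite setXTT.
- by rewrite bigcup_const//; exists 0%N.
- by move=> _ [A [mA [B [mB ->]]]]; exact: m12.
Qed.

Variable X : nat -> {mfun T >-> R}.

Definition tail_event (J : seq nat) (B : nat -> set R) : set T :=
  [set w | forall i, i \in J -> B i (X i w)].

(** Independence of [Y] from the observations of index at least n, tested on finite rectangles. In
    this form it passes from [Y] to functions of [Y] and [X n], see [indep_tail_step], hence along
    the whole chain. *)
Definition indep_tail (n : nat) (Y : T -> U) : Prop :=
  forall A J B, measurable A -> uniq J -> (forall i, i \in J -> (n <= i)%N) ->
    (forall i, measurable (B i)) ->
    P (Y @^-1` A `&` tail_event J B) =
    (P (Y @^-1` A) * \prod_(i <- J) P (X i @^-1` B i))%E.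

Lemma measurable_tail_event J B : (forall i, measurable (B i)) ->
  measurable (tail_event J B).
Proof.
move=> mB; elim: J => [|i J ih].
  by rewrite (_ : tail_event _ _ = setT)//; apply/seteqP; split.
rewrite (_ : tail_event _ _ = X i @^-1` B i `&` tail_event J B).
  by apply: measurableI => //; rewrite -[_ @^-1` _]setTI; exact: measurable_funPT.
apply/seteqP; split=> w /=.
  move=> h; split; first by apply: h; rewrite mem_head.
  by move=> j jJ; apply: h; rewrite inE jJ orbT.
by move=> [h1 h2] j; rewrite inE => /predU1P[->//|]; exact: h2.
Qed.

Hypothesis indX : mutually_independent P X.

Lemma tail_event_cons n J B A0 : n \notin J ->
  tail_event (n :: J) (fun i => if i == n then A0 else B i) =
  X n @^-1` A0 `&` tail_event J B.
Proof.
move=> nJ; apply/seteqP; split=> w /=.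
  move=> h; split; first by have := h n (mem_head _ _); rewrite eqxx.
  move=> j jJ; have := h j; rewrite inE jJ orbT => /(_ isT).
  by rewrite ifF//; apply: contraNF nJ => /eqP <-.
move=> [h1 h2] j; rewrite inE; case: eqVneq => [->//|_ /=]; exact: h2.
Qed.

Lemma indep_tail_cons n Y A A0 J B : indep_tail n Y -> measurable A -> measurable A0 ->
  uniq J -> (forall i, i \in J -> (n < i)%N) -> (forall i, measurable (B i)) ->
  P (Y @^-1` A `&` (X n @^-1` A0 `&` tail_event J B)) =
  (P (Y @^-1` A) * (P (X n @^-1` A0) * \prod_(i <- J) P (X i @^-1` B i)))%E.
Proof.
move=> iY mA mA0 uJ Jn mB; have nJ : n \notin J by apply/negP => /Jn; rewrite ltnn.
rewrite -tail_event_cons// iY//; first last.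
- by move=> i; case: ifP.
- by move=> i; rewrite inE => /predU1P[->//|/Jn/ltnW].
- by rewrite /= nJ.
rewrite big_cons eqxx; congr (_ * (_ * _))%E.
apply: eq_big_seq => i iJ; rewrite ifF//.
by apply: contraNF nJ => /eqP <-.
Qed.

(** As functions of C both sides are finite measures; they agree on rectangles by [indep_tail_cons],
    hence on all measurable sets. *)
Lemma indep_tail_pair n Y C J B : measurable_fun [set: T] Y -> indep_tail n Y ->
  measurable C -> uniq J -> (forall i, i \in J -> (n < i)%N) ->
  (forall i, measurable (B i)) ->
  P ((fun w => (Y w, X n w)) @^-1` C `&` tail_event J B) =
  (P ((fun w => (Y w, X n w)) @^-1` C) * \prod_(i <- J) P (X i @^-1` B i))%E.
Proof.
move=> mY iY mC uJ Jn mB.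
have mg : measurable_fun [set: T] (fun w => (Y w, X n w)).
  by apply: measurable_fun_pair => //; exact: measurable_funPT.
have mE := measurable_tail_event J mB.
have PE : P (tail_event J B) = (\prod_(i <- J) P (X i @^-1` B i))%E by exact: indX.
have p0 : 0 <= fine (P (tail_event J B)) by apply: fine_ge0.
pose p : {nonneg R} := NngNum p0.
have pE : p%:num%:E = (\prod_(i <- J) P (X i @^-1` B i))%E.
  by rewrite /= fineK ?PE// -PE fin_num_measure.
pose m1 : {measure set (U * R) -> \bar R} := pushforward (mrestr P mE) (fun w => (Y w, X n w)).
pose m2 : {measure set (U * R) -> \bar R} :=
  mscale p (pushforward P (fun w => (Y w, X n w))).
have m1E D : m1 mg D = P ((fun w => (Y w, X n w)) @^-1` D `&` tail_event J B) by [].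
have m2E D : m2 mg D = (p%:num%:E * P ((fun w => (Y w, X n w)) @^-1` D))%E by [].
suff : m1 mg C = m2 mg C by rewrite m1E m2E pE muleC.
apply: measure_unique_rect => //.
  by rewrite m1E preimage_setT setTI (le_lt_trans (probability_le1 P mE))// ltry.
move=> A A0 mA mA0; rewrite m1E m2E pE.
have -> : (fun w => (Y w, X n w)) @^-1` (A `*` A0) = Y @^-1` A `&` X n @^-1` A0.
  by apply/seteqP; split.
rewrite -setIA indep_tail_cons//.
have := @indep_tail_cons n Y A A0 [::] B iY mA mA0.
rewrite big_nil mule1 => /(_ isT) h.
have {}h : P (Y @^-1` A `&` X n @^-1` A0) = (P (Y @^-1` A) * P (X n @^-1` A0))%E.
  rewrite -h//; congr (P (_ `&` _)); apply/esym/setIidPl.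
  by move=> w _ i.
by rewrite h muleA muleC.
Qed.

Lemma integral_indep n Y (th : R) (G : U * R -> \bar R) :
  measurable_fun [set: T] Y -> indep_tail n Y -> 0 < th -> gamma_law P th (X n) ->
  measurable_fun [set: U * R] G -> (forall u, 0 <= G u)%E ->
  (\int[P]_w G (Y w, X n w) = \int[P]_w Ex th (fun z => G (Y w, z)))%E.
Proof.
move=> mY iY th0 lX mG G0.
have mg : measurable_fun [set: T] (fun w => (Y w, X n w)).
  by apply: measurable_fun_pair => //; exact: measurable_funPT.
pose Y' := mfun_of mY; pose g' := mfun_of mg.
rewrite -(@ge0_integral_distribution _ _ _ _ _ P g' G)//.
transitivity (\int[distribution P Y' \x distribution P (X n)]_u G u)%E.
  apply: eq_measure_integral => A mA _; apply/esym.
  apply: (@product_measure_unique _ _ _ _ R (distribution P Y') (distribution P (X n))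
    (distribution P g') _ A mA) => A1 A2 mA1 mA2.
  rewrite /distribution /pushforward /=.
  have := @indep_tail_cons n Y A1 A2 [::] (fun=> setT) iY mA1 mA2.
  rewrite big_nil mule1 => /(_ isT) <-//; congr (P _).
  by apply/seteqP; split=> w /= [h1]; [move=> h2; split|move=> [h2 _]].
rewrite fubini_tonelli1// (@ge0_integral_distribution _ _ _ _ _ P Y')//.
- apply: eq_integral => w _ /=; rewrite /fubini_F.
  rewrite (@ge0_integral_distribution _ _ _ _ _ P (X n) (fun z => G (Y w, z)))//.
    apply: gamma_law_integral => //.
    exact: (measurableT_comp mG (measurable_pair1 (Y w))).
  exact: (measurableT_comp mG (measurable_pair1 (Y w))).
- exact: measurable_fun_fubini_tonelli_F.
- by move=> u; exact: integral_ge0.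
Qed.

End Independence.

Lemma indep_tail_step (R : realType) (d d1 d2 : measure_display) (T : measurableType d)
    (U1 : measurableType d1) (U2 : measurableType d2) (P : probability T R)
    (X : nat -> {mfun T >-> R}) n (Y : T -> U1) (f : U1 * R -> U2) :
  mutually_independent P X -> measurable_fun [set: T] Y ->
  measurable_fun [set: U1 * R] f -> indep_tail P X n Y ->
  indep_tail P X n.+1 (fun w => f (Y w, X n w)).
Proof.
move=> iX mY mf iY A J B mA uJ Jn mB.
have mC : measurable (f @^-1` A) by rewrite -[_ @^-1` _]setTI; exact: mf.
exact: (indep_tail_pair iX mY iY mC uJ Jn mB).
Qed.

Lemma indep_tail_cst (R : realType) (d d1 : measure_display) (T : measurableType d)
    (U : measurableType d1) (P : probability T R) (X : nat -> {mfun T >-> R}) n (u : U) :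
  mutually_independent P X -> indep_tail P X n (fun=> u).
Proof.
move=> iX A J B mA uJ Jn mB; have PE := iX J B uJ mB.
have [Au|Au] := pselect (A u).
  rewrite (_ : _ @^-1` A = setT); last by apply/seteqP; split.
  by rewrite setTI probability_setT mul1e; exact: PE.
rewrite (_ : _ @^-1` A = set0); last by apply/seteqP; split.
by rewrite set0I measure0 mul0e.
Qed.

Section MeasurableFunctions.
Context {R : realType} (d : measure_display) (T : measurableType d).
Implicit Types f g : T -> R.

Lemma measurable_inv f : measurable_fun [set: T] f ->
  measurable_fun [set: T] (fun w => (f w)^-1).
Proof.
(* The inverse of 0 is 0, hence the third case. *)
move=> mf; rewrite (_ : (fun w => _) = fun w => if (0 < f w)%R then expR (- ln (f w))
    else if (f w < 0)%R then - expR (- ln (- f w)) else 0).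
  have ml g : measurable_fun [set: T] g -> measurable_fun [set: T] (fun w => expR (- ln (g w))).
    move=> mg; apply: (measurableT_comp (@measurable_expR R)).
    apply: measurableT_comp => //; exact: (measurableT_comp (@measurable_ln R)).
  apply: measurable_fun_ifT; [exact: measurable_fun_ltr|exact: ml|].
  apply: measurable_fun_ifT => //; first exact: measurable_fun_ltr.
  by apply: measurableT_comp => //; apply: ml; exact: measurableT_comp.
apply/funext => w; case: (ltgtP 0 (f w)) => [h|h|<-]; last by rewrite invr0.
  by rewrite -lnV ?posrE// lnK// posrE invr_gt0.
have h' : 0 < - f w by rewrite oppr_gt0.
by rewrite -lnV ?posrE// lnK ?posrE ?invr_gt0// invrN opprK.
Qed.

Lemma measurable_powR2 f g : measurable_fun [set: T] f -> measurable_fun [set: T] g ->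
  measurable_fun [set: T] (fun w => f w `^ g w).
Proof.
move=> mf mg; apply: measurable_fun_ifT; first exact: measurable_fun_eqr.
  rewrite (_ : (fun w => _) = fun w => if g w == 0 then 1 else 0).
    by apply: measurable_fun_ifT => //; exact: measurable_fun_eqr.
  by apply/funext => w; case: eqP.
apply: (measurableT_comp (@measurable_expR R)); apply: measurable_funM => //.
exact: (measurableT_comp (@measurable_ln R)).
Qed.

End MeasurableFunctions.

Section FirstTime.
Implicit Types (p q : pred nat).

Variant first_time_spec p : option nat -> Prop :=
| FirstTimeSome m of (0 < m)%N & p m & (forall n, (0 < n < m)%N -> ~~ p n) :
    first_time_spec p (Some m)
| FirstTimeNone of (forall n, (0 < n)%N -> ~~ p n) : first_time_spec p None.

Lemma first_timeP p : first_time_spec p (first_time p).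
Proof.
rewrite /first_time; case: pselect => [h|h].
  case: ex_minnP => m /andP[m0 pm] hm; constructor => // n /andP[n0 nm].
  apply/negP => pn; have := hm n; rewrite n0 pn => /(_ isT).
  by rewrite leqNgt nm.
by constructor => n n0; apply/negP => pn; apply: h; exists n; rewrite n0.
Qed.

Lemma eq_first_time p q : (forall n, (0 < n)%N -> p n = q n) -> first_time p = first_time q.
Proof.
move=> pq; case: first_timeP => [m m0 pm hm|h]; case: first_timeP => [m' m'0 pm' hm'|h'] //.
- case: (ltngtP m m') => [mm|mm|->//].
    by have := hm' m; rewrite m0 mm -pq// pm => /(_ isT).
  by have := hm m'; rewrite m'0 mm pq// pm' => /(_ isT).
- by have := h' m m0; rewrite -pq// pm.
- by have := h m' m'0; rewrite pq// pm'.
Qed.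

End FirstTime.

Section StopValue.
Context {R : realType}.
Variable phi : R -> R.
Implicit Types (u : nat -> R) (m j : nat).

(** [first_time] ranges over n >= 1 while [u j] is the distance left after j + 1 observations, hence
    the predecessors. *)
Definition stop_val u : R :=
  if first_time (fun n => u n.-1 <= 0) is Some m then phi (u m.-1) else 0.

Fixpoint stopped u m : R :=
  if m is m'.+1 then (if stopped u m' <= 0 then stopped u m' else u m) else u 0%N.

Definition stop_term (x : R) : R := if x <= 0 then phi x else 0.

Lemma stopped_go u m : (forall j, (j < m)%N -> 0 < u j) -> stopped u m = u m.
Proof.
elim: m => [//|m ih] h /=; rewrite ih ?leNgt ?h// => j jm.
by apply: h; exact: ltnW.
Qed.

Lemma stopped_stay u m j : stopped u m <= 0 -> stopped u (m + j) = stopped u m.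
Proof.
by move=> h; elim: j => [|j ih]; rewrite ?addn0// addnS /= ih h.
Qed.

Lemma near_stop_val u : \forall m \near \oo, stop_term (stopped u m) = stop_val u.
Proof.
rewrite /stop_val; case: first_timeP => [m m0 pm hm|h].
  have e : stopped u m.-1 = u m.-1.
    apply: stopped_go => j jm; rewrite ltNge; apply: (hm j.+1).
    by rewrite /= -(prednK m0).
  exists m.-1 => // n /= mn; rewrite -(subnKC mn) stopped_stay e//.
  by rewrite /stop_term pm.
apply: nearW => m; have h' j : 0 < u j by rewrite ltNge; apply: (h j.+1).
by rewrite stopped_go// /stop_term leNgt h'.
Qed.

Hypothesis phi_ge0 : forall x, x <= 0 -> 0 <= phi x.

Lemma stop_term_ge0 x : 0 <= stop_term x.
Proof. by rewrite /stop_term; case: ifP => // /phi_ge0. Qed.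

Lemma stop_val_ge0 u : 0 <= stop_val u.
Proof. by rewrite /stop_val; case: first_timeP => // m _ /phi_ge0. Qed.

Lemma nd_stop_term u : nondecreasing_seq (fun m => stop_term (stopped u m)).
Proof.
apply/nondecreasing_seqP => m /=; case: ifP => // h.
by rewrite {1}/stop_term h stop_term_ge0.
Qed.

Hypothesis mphi : measurable_fun [set: R] phi.
Variables (d : measure_display) (T : measurableType d) (U : nat -> T -> R).
Hypothesis mU : forall j, measurable_fun [set: T] (U j).

Lemma measurable_stop_term m :
  measurable_fun [set: T] (fun w => stop_term (stopped (U ^~ w) m)).
Proof.
have ms : measurable_fun [set: T] (fun w => stopped (U ^~ w) m).
  elim: m => [|m ih]; first exact: mU.
  rewrite (_ : (fun w => _) = fun w => if stopped (U ^~ w) m <= 0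
    then stopped (U ^~ w) m else U m.+1 w)//.
  by apply: measurable_fun_ifT => //; exact: measurable_fun_ler.
apply: measurable_fun_ifT => //; first exact: measurable_fun_ler.
exact: measurableT_comp.
Qed.

Lemma measurable_stop_val : measurable_fun [set: T] (fun w => stop_val (U ^~ w)).
Proof.
apply: (@measurable_fun_cvg _ _ R setT (fun m w => stop_term (stopped (U ^~ w) m))).
  by move=> m; exact: measurable_stop_term.
move=> w _; apply: (@cvg_trans _ ((fun=> stop_val (U ^~ w)) m @[m --> \oo])).
  apply: near_eq_cvg; apply: filterS (near_stop_val (U ^~ w)) => m /= ->.
  by [].
exact: cvg_cst.
Qed.

End StopValue.

Section ChainLaw.
Context {R : realType}.
Variables (theta0 v : R) (kap : nat -> R) (phi : R -> R).
Hypothesis v0 : 0 < v.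
Hypothesis mphi : measurable_fun [set: R] phi.
Hypothesis phi_ge0 : forall x, x <= 0 -> 0 <= phi x.
Variables (d : measure_display) (T : measurableType d) (P : probability T R).
Variable X : nat -> {mfun T >-> R}.
Hypothesis iX : iid_gamma P v X.
Local Notation step := (chain_step theta0 kap).
Local Notation N_upto := (value_upto theta0 (fun=> v) kap phi).
Local Notation N := (value theta0 (fun=> v) kap phi).
Implicit Types (m k n j : nat) (s : R * R) (x : nat -> R) (Y : T -> R * R).

Definition astep k (u : (R * R) * R) : R * R :=
  if u.1.2 <= 0 then u.1 else step k u.1 u.2.

(** The clock k of the gains and the index n of the observations are separate: the first observation
    is spent on the initial state, so the chain starts with k = 0 and n = 1. The recursion peels
    steps off the front, as [value_upto] does; [chainS] peels them off the back. *)
Fixpoint chain m k n s x : R * R :=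
  if m is m'.+1 then chain m' k.+1 n.+1 (astep k (s, x n)) x else s.

Fixpoint free_path k n s x m : R * R :=
  if m is m'.+1 then step (k + m')%N (free_path k n s x m') (x (n + m')%N) else s.

Lemma chainS m k n s x :
  chain m.+1 k n s x = astep (k + m)%N (chain m k n s x, x (n + m)%N).
Proof.
elim: m k n s => [|m ih] k n s; first by rewrite /= !addn0.
by rewrite [LHS]/= -[LHS]/(chain m.+1 _ _ _ _) ih !addSnnS.
Qed.

Lemma chain_stopped m k n s x :
  (chain m k n s x).2 = stopped (fun j => (free_path k n s x j).2) m /\
  (0 < (chain m k n s x).2 -> chain m k n s x = free_path k n s x m).
Proof.
elim: m => [//|m [h1 h2]]; rewrite chainS /astep [stopped _ _]/= -h1.
case: ifPn => [h|]; first by split=> //; rewrite ltNge h.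
by rewrite -ltNge => /h2 ->.
Qed.

Lemma measurable_astep k : measurable_fun [set: (R * R) * R] (astep k).
Proof.
have m1 : measurable_fun [set: (R * R) * R] (fun u : (R * R) * R => u.1) by exact: measurable_fst.
apply: measurable_fun_ifT => //.
  by apply: measurable_fun_ler => //; exact: (measurableT_comp measurable_snd m1).
by apply: measurable_fun_step => //; exact: measurable_snd.
Qed.

Lemma measurable_free Y k n j : measurable_fun [set: T] Y ->
  measurable_fun [set: T] (fun w => free_path k n (Y w) (fun i => X i w) j).
Proof.
by move=> mY; elim: j => [//|j ih] /=; apply: measurable_fun_step.
Qed.

(** Each step integrates out [X n] by independence and continues with [astep k (Y, X n)], which is
    independent of the later observations. Because [astep] fixes stopped states, both cases of
    [value_upto] have the same form. *)
Lemma integral_chain m k n Y : measurable_fun [set: T] Y -> indep_tail P X n Y ->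
  (\int[P]_w N_upto m k (Y w) =
   \int[P]_w (stop_term phi (chain m k n (Y w) (fun i => X i w)).2)%:E)%E.
Proof.
elim: m k n Y => [|m ih] k n Y mY iY.
  apply: eq_integral => w _ /=; rewrite /stop_term; case: ifP => //.
have [indX lawX] := iX.
rewrite (_ : (fun w => N_upto m.+1 k (Y w)) =
  fun w => Ex v (fun z => N_upto m k.+1 (astep k (Y w, z)))); last first.
  apply/funext => w; have [h|h] := leP (Y w).2 0.
    rewrite value_upto_stop// -(Ex_cst _ v0); apply: eq_Ex => z _.
    by rewrite /astep /= h value_upto_stop.
  by rewrite value_upto_go//; apply: eq_Ex => z _; rewrite /astep /= leNgt h.
rewrite -(@integral_indep _ _ _ _ _ P X n Y v (fun u => N_upto m k.+1 (astep k u)))//.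
- rewrite (ih k.+1 n.+1 (fun w => astep k (Y w, X n w)))//.
    apply: (measurableT_comp (measurable_astep k)).
    by apply: measurable_fun_pair => //; exact: measurable_funPT.
  exact: (indep_tail_step indX mY (measurable_astep k) iY).
- apply: measurableT_comp (measurable_astep k).
  by apply: measurable_value_upto => //; exact: measurable_cst.
- by move=> u; exact: value_upto_ge0.
Qed.

Lemma integral_stop_val k n Y : measurable_fun [set: T] Y -> indep_tail P X n Y ->
  (\int[P]_w N k (Y w) = \int[P]_w
     (stop_val phi (fun j => (free_path k n (Y w) (fun i => X i w) j).2))%:E)%E.
Proof.
move=> mY iY.
pose U j w := (free_path k n (Y w) (fun i => X i w) j).2.
have mU j : measurable_fun [set: T] (U j).
  exact: (measurableT_comp measurable_snd (measurable_free k n j mY)).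
have c1 : (\int[P]_w N_upto m k (Y w))%E @[m --> \oo] --> (\int[P]_w N k (Y w))%E.
  have -> : (\int[P]_w N k (Y w) = \int[P]_w limn (fun m => N_upto m k (Y w)))%E by [].
  apply: cvg_monotone_convergence => //.
  - by move=> m; apply: (measurableT_comp _ mY); exact: measurable_value_upto.
  - by move=> m w _; exact: value_upto_ge0.
  - by move=> w _; exact: nd_value_upto.
have c2 : (\int[P]_w (stop_term phi (stopped (U ^~ w) m))%:E)%E @[m --> \oo] -->
    (\int[P]_w (stop_val phi (U ^~ w))%:E)%E.
  have -> : (\int[P]_w (stop_val phi (U ^~ w))%:E =
      \int[P]_w limn (fun m => (stop_term phi (stopped (U ^~ w) m))%:E))%E.
    apply: eq_integral => w _; apply/esym/cvg_lim => //; apply: cvg_EFin.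
      exact: nearW.
    apply: (@cvg_trans _ ((fun=> stop_val phi (U ^~ w)) m @[m --> \oo])).
      by apply: near_eq_cvg; apply: filterS (near_stop_val phi (U ^~ w)) => m /= ->.
    exact: cvg_cst.
  apply: cvg_monotone_convergence => //.
  - by move=> m; apply/measurable_EFinP; exact: measurable_stop_term.
  - by move=> m w _; rewrite lee_fin stop_term_ge0.
  - by move=> w _ m m' mm; rewrite lee_fin; exact: nd_stop_term.
apply: (cvg_unique _ c1) => //.
rewrite (_ : (fun m => _) = fun m => (\int[P]_w (stop_term phi (stopped (U ^~ w) m))%:E)%E)//.
apply/funext => m; rewrite (integral_chain m k mY iY); apply: eq_integral => w _.
by have [-> _] := chain_stopped m k n (Y w) (fun i => X i w).
Qed.

Lemma iid_gamma_pos_ae : exists NN : set T, [/\ measurable NN, P NN = 0%E &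
  forall w, ~ NN w -> forall i, 0 < X i w].
Proof.
pose A i := X i @^-1` `]-oo, 0%R]%classic.
have mA i : measurable (A i).
  by rewrite /A -[_ @^-1` _]setTI; apply: measurable_funPT.
have A0 i : P (A i) = 0%E.
  have [_ lawX] := iX; rewrite /A lawX//; apply: integral0_eq => z /=.
  by rewrite in_itv/= => z0; rewrite /gamma_pdf ltNge z0.
exists (\bigcup_i A i); split.
- exact: bigcupT_measurable.
- apply/eqP; rewrite eq_le measure_ge0 andbT.
  apply: (le_trans (measure_sigma_subadditive P mA (bigcupT_measurable _ mA) (@subset_refl _ _))).
  by rewrite eseries0// => i _ _; exact: A0.
- by move=> w h i; rewrite ltNge; apply/negP => Xi; apply: h; exists i => //=; rewrite in_itv.
Qed.

(** [Lambda] and [log_lr] agree with their forms in terms of [llr] only where all observations are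
    positive, which is almost sure. *)
Lemma integral_eq_pos (f g : T -> R) : measurable_fun [set: T] f -> measurable_fun [set: T] g ->
  (forall w, 0 <= f w) -> (forall w, 0 <= g w) ->
  (forall w, (forall i, 0 < X i w) -> f w = g w) ->
  (\int[P]_w (f w)%:E = \int[P]_w (g w)%:E)%E.
Proof.
move=> mf mg f0 g0 fg; have [NN [mN PN hN]] := iid_gamma_pos_ae.
rewrite (ge0_negligible_integral mN)//; last 2 first.
- by apply/measurable_EFinP.
- by move=> w _; rewrite lee_fin.
rewrite [RHS](ge0_negligible_integral mN)//; last 2 first.
- by apply/measurable_EFinP.
- by move=> w _; rewrite lee_fin.
apply: eq_integral => w; rewrite inE => -[_ /hN h].
by rewrite fg.
Qed.

End ChainLaw.

Section RejectProbability.
Context {R : realType}.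
Variables (theta0 s t v : R).
Hypotheses (theta0_gt0 : 0 < theta0) (s0 : 0 <= s) (t0 : 0 <= t) (v0 : 0 < v).
Variables (d : measure_display) (T : measurableType d) (P : probability T R).
Variable X : nat -> {mfun T >-> R}.
Hypothesis iX : iid_gamma P v X.
Implicit Types (n i j : nat) (x : nat -> R) (b z : R).
Local Notation theta_hat := (theta_hat theta0 s t).
Local Notation Lambda := (Lambda theta0 s t).

Definition theta1 : R := if Num.min s t == 0 then theta0 else s / t.
Definition theta2 z : R := (z + s) / (1 + t).

Lemma theta1_gt0 : 0 < theta1.
Proof.
rewrite /theta1; case: eqP => // /eqP st; have m0 : 0 < Num.min s t.
  by rewrite lt_neqAle eq_sym st le_min s0.
by move: m0; rewrite lt_min => /andP[a b]; rewrite divr_gt0.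
Qed.

Lemma theta2_gt0 z : 0 < z -> 0 < theta2 z.
Proof. by move=> z0; rewrite divr_gt0 ?ltr_pwDl. Qed.

Lemma measurable_theta2 : measurable_fun [set: R] theta2.
Proof. by apply: measurable_funM => //; exact: measurable_funD. Qed.

Lemma theta_hat0 x : theta_hat x 0 = theta1. Proof. by []. Qed.

Lemma theta_hatS x n : theta_hat x n.+1 = (\sum_(i < n.+1) x i + s) / (n.+1%:R + t).
Proof. by rewrite /theta_hat/= mulrA mulfV ?mul1r// pnatr_eq0. Qed.

Lemma theta_hat_gt0 x n : (forall i, 0 < x i) -> 0 < theta_hat x n.
Proof.
move=> x0; case: n => [|n]; first by rewrite theta_hat0 theta1_gt0.
rewrite theta_hatS divr_gt0//; last by rewrite ltr_pwDl// ltr0Sn.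
by rewrite ltr_pwDl// big_ord_recl ltr_pwDl// sumr_ge0// => i _; exact: ltW.
Qed.

Lemma theta_hat_step x n : theta_hat x n.+2 =
  theta_hat x n.+1 + kap t n * (x n.+1 - theta_hat x n.+1).
Proof.
rewrite !theta_hatS big_ord_recr /= /kap /rho -!natr1.
by field; rewrite !gt_eqF//; have := ler0n R n; move: t0; lra.
Qed.

Lemma LambdaE x n : (forall i, 0 < x i) ->
  Lambda x n = expR (\sum_(i < n) llr theta0 (theta_hat x i) (x i)).
Proof.
move=> x0; rewrite expR_sum; apply: eq_bigr => i _.
rewrite /powR gt_eqF// /llr expRD; congr (_ * _).
by rewrite expRD expRN !lgamK//; exact: theta_hat_gt0.
Qed.

Let Y b w : R * R := (theta2 (X 0%N w), b - llr theta0 theta1 (X 0%N w)).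

(** State j of the path has seen j + 1 observations: the first one is already contained in [Y]. *)
Let freeE b w j : free_path theta0 (kap t) 0 1 (Y b w) (fun i => X i w) j =
  (theta_hat (fun i => X i w) j.+1,
   b - \sum_(i < j.+1) llr theta0 (theta_hat (fun i => X i w) i) (X i w)).
Proof.
elim: j => [|j ih] /=; first by rewrite big_ord1 theta_hatS big_ord1.
rewrite ih /chain_step /= add0n add1n -theta_hat_step; congr pair.
by rewrite -addrA -opprD; congr (b - _); rewrite [RHS]big_ord_recr.
Qed.

Let mX i : measurable_fun [set: T] (X i). Proof. exact: measurable_funPT. Qed.

Lemma measurable_theta_hat n : measurable_fun [set: T] (fun w => theta_hat (fun i => X i w) n).
Proof.
case: n => [|n]; first exact: measurable_cst.
under eq_fun do rewrite theta_hatS.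
by apply: measurable_funM => //; apply: measurable_funD => //; exact: measurable_sum.
Qed.

Lemma measurable_Lambda n : measurable_fun [set: T] (fun w => Lambda (fun i => X i w) n).
Proof.
apply: measurable_prod => i _; apply: measurable_funM.
  apply: measurable_powR2 => //; apply: measurable_funB => //.
  exact: measurable_theta_hat.
apply: measurable_funM => //; apply: measurable_inv.
apply: (measurableT_comp (@measurable_Gamma R)); exact: measurable_theta_hat.
Qed.

Lemma rejectsE b w : rejects theta0 s t X b w <->
  exists n, (0 < n)%N /\ expR b <= Lambda (fun i => X i w) n.
Proof.
rewrite /rejects/= /tau; case: first_timeP => [m m0 pm _|h].
  by split=> // _; exists m.
by split=> // -[n [n0 hn]]; have := h n n0; rewrite hn.
Qed.

Lemma measurable_rejects b : measurable (rejects theta0 s t X b).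
Proof.
rewrite (_ : rejects _ _ _ _ _ = \bigcup_n
    ((fun w => Lambda (fun i => X i w) n.+1) @^-1` `[expR b, +oo[%classic)).
  apply: bigcupT_measurable => n; rewrite -[_ @^-1` _]setTI.
  by apply: measurable_Lambda.
apply/seteqP; split=> w.
  move=> /rejectsE[[|n] [//]] h1; exists n => //=.
  by rewrite in_itv/= andbT.
move=> [n _] /=; rewrite in_itv/= andbT => h; apply/rejectsE.
by exists n.+1.
Qed.

Lemma reject_prob b : P (rejects theta0 s t X b) =
  Ex v (fun z => value theta0 (fun=> v) (kap t) (fun=> 1) 0
    (theta2 z, b - llr theta0 theta1 z)%R).
Proof.
have [indX lawX] := iX.
pose f (u : R * R) : R * R := (theta2 u.2, b - llr theta0 theta1 u.2).
have mf : measurable_fun [set: R * R] f.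
  apply: measurable_fun_pair => /=.
    exact: (measurableT_comp measurable_theta2 measurable_snd).
  apply: measurable_funB => //.
  exact: (measurableT_comp (measurable_llr theta0 theta1) measurable_snd).
have mY : measurable_fun [set: T] (Y b).
  apply: measurable_fun_pair => /=; first exact: measurableT_comp measurable_theta2 (mX 0).
  by apply: measurable_funB => //; exact: measurableT_comp (measurable_llr _ _) (mX 0).
have iY : indep_tail P X 1 (Y b).
  exact: (@indep_tail_step R d _ _ T R (R * R)%type P X 0%N (fun=> 0) f indX
    (measurable_cst _) mf (indep_tail_cst (0 : R) indX)).
pose F (u : R * R) := value theta0 (fun=> v) (kap t) (fun=> 1) 0 u.
have mF : measurable_fun [set: R * R] F by apply: measurable_value.
rewrite -(@gamma_law_integral R d T P v (X 0%N)
  (fun z => F (theta2 z, b - llr theta0 theta1 z)))//; last 2 first.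
- apply: (measurableT_comp mF); apply: measurable_fun_pair => //.
    exact: measurable_theta2.
  by apply: measurable_funB => //; exact: measurable_llr.
- by move=> z; exact: value_ge0.
rewrite (@integral_stop_val R theta0 v (kap t) (fun=> 1) v0 _ _ d T P X iX 0%N 1%N (Y b))//.
have mrej := measurable_rejects b.
have -> : P (rejects theta0 s t X b) =
    (\int[P]_w (\1_(rejects theta0 s t X b) w)%:E)%E by rewrite integral_indic ?setIT.
apply: (integral_eq_pos iX) => //.
- apply: (@measurable_stop_val R (fun=> 1) _ _ T
    (fun j w => (free_path theta0 (kap t) 0 1 (Y b w) (fun i => X i w) j).2)) => //.
  move=> j; apply: (measurableT_comp measurable_snd).
  exact: measurable_free.
- by move=> w; exact: stop_val_ge0.
move=> w xw; rewrite /stop_val indicE.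
case: first_timeP => [m m0 pm hm|h].
  rewrite mem_set//; apply/rejectsE; exists m; split=> //.
  rewrite LambdaE// ler_expR; move: pm; rewrite freeE/= prednK//.
  by rewrite subr_le0.
rewrite memNset// => /rejectsE[n [n0]]; rewrite LambdaE// ler_expR => hb.
by have := h n n0; rewrite freeE/= prednK// subr_le0 hb.
Qed.

End RejectProbability.

Section OvershootMean.
Context {R : realType}.
Variables (theta0 v : R).
Hypotheses (theta0_gt0 : 0 < theta0) (v0 : 0 < v).
Variables (d : measure_display) (T : measurableType d) (P : probability T R).
Variable Z : nat -> {mfun T >-> R}.
Hypothesis iZ : iid_gamma P v Z.
Implicit Types (n i j m : nat) (x : nat -> R) (b z : R).

(** With zero gain the estimate never leaves v, so sampling at the current estimate and sampling at
    v coincide. *)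
Lemma value_upto_cst_iid m n (x : R) : value_upto theta0 (fun=> v) (fun=> 0) (@expR R) m n (v, x) =
  value_upto theta0 id (fun=> 0) (@expR R) m n (v, x).
Proof.
elim: m n x => [|m ih] n x; have [x0|x0] := leP x 0.
- by rewrite !value_upto_stop.
- by rewrite !value_upto_go0.
- by rewrite !value_upto_stop.
have go q := @value_upto_go R theta0 q (fun=> 0) (@expR R) m n (v, x) x0.
rewrite !go [(v, x).1]/= [id v]/=; apply: eq_Ex => z _.
have -> : chain_step theta0 (fun=> 0) n (v, x) z = (v, x - llr theta0 v z).
  by rewrite /chain_step/= mul0r addr0.
exact: ih.
Qed.

Lemma value_cst_iid (x : R) : value theta0 (fun=> v) (fun=> 0) (@expR R) 0 (v, x) =
  iid_value theta0 v x.
Proof.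
rewrite /iid_value /value.
have e : (fun m => value_upto theta0 (fun=> v) (fun=> 0) (@expR R) m 0 (v, x)) =
    fun m => value_upto theta0 id (fun=> 0) (@expR R) m 0 (v, x).
  by apply/funext => m; rewrite value_upto_cst_iid.
by rewrite e.
Qed.

Let mZ i : measurable_fun [set: T] (Z i). Proof. exact: measurable_funPT. Qed.

Lemma log_lrE x n : (forall i, 0 < x i) ->
  log_lr theta0 v x n = \sum_(i < n) llr theta0 v (x i).
Proof.
move=> x0; apply: eq_bigr => i _; rewrite !gamma_pdfE//.
rewrite -(gpdf_llr theta0 v) invfM mulrA mulfV ?gt_eqF ?gpdf_gt0// mul1r.
by rewrite -expRN opprK expRK.
Qed.

Lemma measurable_log_lr n : measurable_fun [set: T] (fun w => log_lr theta0 v (fun i => Z i w) n).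
Proof.
have mg p : 0 < p -> measurable_fun [set: R] (@gamma_pdf R p).
  by move=> p0; apply/measurable_EFinP; exact: measurable_gamma_pdf.
apply: measurable_sum => i; apply: (measurableT_comp (@measurable_ln R)).
apply: measurable_funM; first exact: measurableT_comp (mg v v0) (mZ i).
by apply: measurable_inv; exact: measurableT_comp (mg theta0 theta0_gt0) (mZ i).
Qed.

Lemma exp_overshootE b x : exp_overshoot theta0 v b x =
  stop_val (@expR R) (fun j => b - log_lr theta0 v x j.+1).
Proof.
rewrite /exp_overshoot /crossing_time /stop_val.
rewrite (@eq_first_time _ (fun n => b - log_lr theta0 v x n.-1.+1 <= 0)); last first.
  by move=> n n0; rewrite prednK// subr_le0.
by case: first_timeP => // m m0 _ _; rewrite prednK// opprB.
Qed.

Lemma mean_exp_overshootE b : mean_exp_overshoot theta0 v P Z b =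
  Ex v (fun z => iid_value theta0 v (b - llr theta0 v z)%R).
Proof.
have [indZ lawZ] := iZ.
pose f (u : R * R) : R * R := (v, b - llr theta0 v u.2).
have mf : measurable_fun [set: R * R] f.
  apply: measurable_fun_pair => //=; apply: measurable_funB => //.
  exact: (measurableT_comp (measurable_llr theta0 v) measurable_snd).
pose Y w : R * R := (v, b - llr theta0 v (Z 0%N w)).
have mY : measurable_fun [set: T] Y.
  apply: measurable_fun_pair => //=.
  by apply: measurable_funB => //; exact: measurableT_comp (measurable_llr _ _) (mZ 0).
have iY : indep_tail P Z 1 Y.
  exact: (@indep_tail_step R d _ _ T R (R * R)%type P Z 0%N (fun=> 0) f indZ
    (measurable_cst _) mf (indep_tail_cst (0 : R) indZ)).
have e0 (x : R) : x <= 0 -> 0 <= expR x by move=> _; exact: expR_ge0.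
rewrite -(@gamma_law_integral R d T P v (Z 0%N)
  (fun z => iid_value theta0 v (b - llr theta0 v z)))//; last 2 first.
- exact: measurable_iid_value_llr.
- by move=> z; exact: iid_value_ge0.
under [RHS]eq_integral do rewrite -value_cst_iid.
rewrite (@integral_stop_val R theta0 v (fun=> 0) (@expR R) v0 _ e0 d T P Z iZ 0%N 1%N Y)//.
rewrite /mean_exp_overshoot expectation.unlock.
have fE w j : free_path theta0 (fun=> 0) 0 1 (Y w) (fun i => Z i w) j =
    (v, b - \sum_(i < j.+1) llr theta0 v (Z i w)).
  elim: j => [|j ih] /=; first by rewrite big_ord1.
  rewrite ih /chain_step /= mul0r addr0 add1n; congr pair.
  by rewrite -addrA -opprD; congr (b - _); rewrite [RHS]big_ord_recr.
apply: (integral_eq_pos iZ).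
- under eq_fun do rewrite exp_overshootE.
  apply: (@measurable_stop_val R (@expR R) _ _ T (fun j w => b - log_lr theta0 v (fun i => Z i w) j.+1)) => //.
  by move=> j; apply: measurable_funB => //; exact: measurable_log_lr.
- apply: (@measurable_stop_val R (@expR R) _ _ T
    (fun j w => (free_path theta0 (fun=> 0) 0 1 (Y w) (fun i => Z i w) j).2)) => //.
  by move=> j; apply: (measurableT_comp measurable_snd); exact: measurable_free.
- by move=> w; rewrite exp_overshootE; exact: stop_val_ge0.
- by move=> w; exact: stop_val_ge0.
move=> w zw; rewrite exp_overshootE; congr stop_val; apply/funext => j.
by rewrite fE/= log_lrE.
Qed.

End OvershootMean.

(* [G] enters the theorem only through the integral of [eta]: once [gamma] is
   known to lie between two values of [eta], a law carried by these two points
   has the required integral. *)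
Section TwoPointMixture.
Context {R : realType}.
Implicit Types (p y : R) (D : set (measurableTypeR R)).

Definition two_valued y1 y2 (b : bool) : measurableTypeR R := if b then y1 else y2.

Lemma measurable_two_valued y1 y2 : measurable_fun [set: bool] (two_valued y1 y2).
Proof. by move=> _ A _. Qed.

Definition two_point p y1 y2 : probability (measurableTypeR R) R :=
  distribution (bernoulli_prob p) (mfun_of (@measurable_two_valued y1 y2)).

Lemma two_point_in p y1 y2 D : measurable D -> D y1 -> D y2 -> two_point p y1 y2 D = 1%E.
Proof.
move=> mD D1 D2; rewrite /two_point /distribution /pushforward.
rewrite /= (_ : _ @^-1` D = setT) ?probability_setT//.
by apply/seteqP; split => // -[].
Qed.

Lemma two_point_out p y1 y2 D : ~ D y1 -> ~ D y2 -> two_point p y1 y2 D = 0%E.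
Proof.
move=> D1 D2; rewrite /two_point /distribution /pushforward.
rewrite /= (_ : _ @^-1` D = set0) ?measure0//.
by apply/seteqP; split => // -[].
Qed.

Lemma integral_two_point p y1 y2 D (f : measurableTypeR R -> \bar R) : 0 <= p <= 1 ->
  measurable D -> D y1 -> D y2 -> measurable_fun D f -> (forall y, D y -> 0 <= f y)%E ->
  (\int[two_point p y1 y2]_(y in D) f y = p%:E * f y1 + (1 - p)%:E * f y2)%E.
Proof.
move=> p01 mD D1 D2 mf f0.
rewrite (ge0_integral_pushforward (@measurable_two_valued y1 y2))//; last first.
  by move=> y; rewrite inE => /f0.
rewrite (_ : _ @^-1` D = setT); last by apply/seteqP; split => // -[].
rewrite (integral_bernoulli_prob p01)//.
by case=> /=; exact: f0.
Qed.

End TwoPointMixture.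

(** * Significance level, power and the theorem *)

Section EtaValue.
Context {R : realType}.
Variable theta0 : R.
Hypothesis theta0_gt0 : 0 < theta0.
Variables (d : measure_display) (T : measurableType d) (P : R -> probability T R).
Variable Z : nat -> {mfun T >-> R}.
Hypothesis iZ : forall th : R, 0 < th -> iid_gamma (P th) th Z.
Implicit Types th y : R.

Lemma cvg_mean_exp_overshoot th : 0 < th -> th != theta0 ->
  mean_exp_overshoot theta0 th (P th) Z b @[b --> +oo%R] --> (eta_lim theta0 th)%:E.
Proof.
move=> th0 tt; apply/fine_cvgP; split.
  apply: nearW => b; rewrite mean_exp_overshootE//; last exact: iZ.
  by have [r [_ _ ->]] := Ex_iid_value_real theta0 b th0.
rewrite (_ : fine \o _ = fun b =>
  fine (Ex th (fun z => iid_value theta0 th (b - llr theta0 th z)%R))).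
  exact: cvg_Ex_iid_value.
by apply/funext => b /=; rewrite mean_exp_overshootE//; exact: iZ.
Qed.

Lemma etaE th : 0 < th -> th != theta0 -> eta theta0 P Z th = (eta_lim theta0 th)%:E.
Proof. by move=> th0 tt; apply/cvg_lim => //; exact: cvg_mean_exp_overshoot. Qed.

End EtaValue.

Section SignificanceLevel.
Context {R : realType}.
Variables (theta0 s t : R).
Hypotheses (theta0_gt0 : 0 < theta0) (s0 : 0 <= s) (t0 : 0 <= t).

Lemma reject_prob_null (d : measure_display) (T : measurableType d) (P : probability T R)
    (X : nat -> {mfun T >-> R}) (b : R) : iid_gamma P theta0 X ->
  P (rejects theta0 s t X b) =
    (expR (- b) * first_mean theta0 t (theta2 s t) (theta1 theta0 s t) b)%:E.
Proof.
move=> iX; rewrite (reject_prob theta0_gt0 s0 t0 theta0_gt0 iX).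
have p0 := theta1_gt0 theta0_gt0 s0 t0; set p := theta1 theta0 s t in p0 *.
have tau0 z : 0 < z -> 0 < theta2 s t z by exact: theta2_gt0.
pose F z := value theta0 id (kap t) (@expR R) 0 (theta2 s t z, b - llr theta0 p z).
have F0 z : (0 <= F z)%E by apply: value_ge0 => x _; exact: expR_ge0.
have mF : measurable_fun [set: R] F.
  have mV : measurable_fun [set: R * R] (value theta0 id (kap t) (@expR R) 0).
    by apply: measurable_value => // x _; exact: expR_ge0.
  apply: (measurableT_comp mV); apply: measurable_fun_pair => //.
    exact: measurable_theta2.
  by apply: measurable_funB => //; exact: measurable_llr.
transitivity (Ex theta0 (fun z => (expR (llr theta0 p z))%:E * ((expR (- b))%:E * F z))%E).
  apply: eq_Ex => z z0; rewrite change_of_measure ?tau0//; last exact: kap_bounds.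
  by rewrite muleA -EFinM -expRD; congr ((expR _)%:E * _)%E; ring.
rewrite Ex_llr ExZ ?expR_ge0// EFinM; congr (_ * _)%E.
have h0 : (0 <= Ex p F)%E by apply: Ex_ge0 => z _; exact: F0.
have h1 : (Ex p F <= 1)%E.
  rewrite -(Ex_cst 1 p0); apply: le_Ex => z z0; first exact: F0.
  apply: value_le1 => //; [exact: kap_bounds|exact: expR_nonpos_le1|exact: tau0].
by have [r [_ _ e]] := real01 h0 h1; rewrite /first_mean -/F e.
Qed.

Lemma reject_prob_alt (d : measure_display) (T : measurableType d) (P : probability T R)
    (X : nat -> {mfun T >-> R}) (th b : R) : 0 < th -> th != theta0 -> iid_gamma P th X ->
  P (rejects theta0 s t X b) = 1%E.
Proof.
move=> th0 tt iX; rewrite (reject_prob theta0_gt0 s0 t0 th0 iX) -(Ex_cst 1 th0).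
by apply: eq_Ex => z z0; apply: power_one => //; exact: theta2_gt0.
Qed.

End SignificanceLevel.

Theorem theorem2 (R : realType) (theta0 s t : R)
    (htheta0 : 0 < theta0) (hs : 0 <= s) (ht : 0 <= t) :
  exists G : probability (measurableTypeR R) R,
    [/\ G (`]0, +oo[%classic : set R) = 1%E,
        G [set theta0] = 0%E &
        forall (d : measure_display) (T : measurableType d)
               (P : R -> probability T R) (X Z : nat -> {mfun T >-> R}),
          (forall theta : R, 0 < theta ->
             iid_gamma (P theta) theta X /\ iid_gamma (P theta) theta Z) ->
          let D := (`]0, +oo[%classic : set R) `\ theta0 in
          let gamma := (\int[G]_(y in D) eta theta0 P Z y)%E in
          [/\ (forall theta : R, 0 < theta -> theta != theta0 ->
                 cvg (mean_exp_overshoot theta0 theta (P theta) Z b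
                        @[b --> +oo%R])),
              G.-integrable D (eta theta0 P Z),
              (exists o1 : R -> R,
                 o1 b @[b --> +oo%R] --> (0 : R) /\
                 forall b : R,
                   P theta0 (rejects theta0 s t X b) =
                   ((1 + o1 b)%:E * gamma * (expR (- b))%:E)%E) &
              (forall (theta b : R), 0 < theta -> theta != theta0 ->
                 P theta (rejects theta0 s t X b) = 1%E)]].
Proof.
have p0 := theta1_gt0 htheta0 hs ht.
have tau0 z : 0 < z -> 0 < theta2 s t z by exact: theta2_gt0.
pose g := first_lim theta0 t (theta2 s t) (theta1 theta0 s t).
have cg := cvg_first_lim htheta0 ht tau0 (measurable_theta2 s t) p0.
(* The two points, and with them [G], are fixed before any probability space: [eta_lim] and the
   limit [g] are computed from the Gamma densities alone. *)
have [y1 [y2 [[y10 y1t y20 y2t]]]] :=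
  first_lim_between htheta0 ht tau0 (measurable_theta2 s t) p0.
rewrite -/g in cg * => /andP[g1 g2].
set e1 := eta_lim theta0 y1 in g1; set e2 := eta_lim theta0 y2 in g2.
have [p p01 pg] : exists2 p : R, 0 <= p <= 1 & p * e1 + (1 - p) * e2 = g.
  have [e12|ne] := eqVneq e1 e2.
    exists 1; first by rewrite ler01 lexx.
    by rewrite mul1r subrr mul0r addr0; apply/le_anti; rewrite g1 e12 g2.
  have e0 : 0 < e2 - e1 by rewrite subr_gt0 lt_neqAle ne (le_trans g1).
  exists ((e2 - g) / (e2 - e1)); last by field; rewrite gt_eqF.
  apply/andP; split; first by rewrite divr_ge0 ?(ltW e0)// subr_ge0.
  by rewrite ler_pdivrMr// mul1r lerD2l lerN2.
(* Positivity of the limit allows the relative error [o1] to be defined as a quotient by [g]. *)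
have gpos : 0 < g by apply: lt_le_trans g1; exact: eta_lim_gt0.
pose D : set (measurableTypeR R) := (`]0, +oo[%classic : set R) `\ theta0.
have DE y : D y <-> 0 < y /\ y != theta0.
  rewrite /D/= in_itv/= andbT; split=> -[a b]; split=> //; exact/eqP.
have mD : measurable D by apply: measurableD => //; exact: measurable_itv.
have D1 : D y1 by apply/DE.
have D2 : D y2 by apply/DE.
exists (two_point p y1 y2); split.
- by apply: two_point_in; rewrite ?measurable_itv//= in_itv/= andbT.
- by apply: two_point_out => /= h; [move: y1t|move: y2t]; rewrite h eqxx.
move=> d T P X Z iXZ D' gamma.
have iX th : 0 < th -> iid_gamma (P th) th X by move=> /iXZ[].
have iZ th : 0 < th -> iid_gamma (P th) th Z by move=> /iXZ[].
have eE y : D y -> eta theta0 P Z y = (eta_lim theta0 y)%:E.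
  by move=> /DE[y0 yt]; apply: etaE.
have mlim : measurable_fun D (fun y => (eta_lim theta0 y)%:E).
  apply/measurable_EFinP.
  have : measurable_fun (D : set R) (eta_lim theta0).
    apply: open_continuous_measurable_fun.
      rewrite /D setDE; apply: openI; first exact: interval_open.
      by apply: closed_openC; apply/accessible_closed_set1/hausdorff_accessible/Rhausdorff.
    by move=> y; rewrite inE => /DE[y0 yt]; exact: continuous_eta_lim.
  by [].
have meta : measurable_fun D (eta theta0 P Z).
  by apply: eq_measurable_fun mlim => y; rewrite inE => /eE.
have eta0 y : D y -> (0 <= eta theta0 P Z y)%E.
  move=> Dy; rewrite eE// lee_fin; move/DE : Dy => [y0 yt].
  by have /andP[] := eta_lim01 htheta0 y0 yt.
have gE : gamma = g%:E.
  by rewrite /gamma integral_two_point// !eE// -!EFinM -EFinD pg.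
split.
- move=> th th0 tt; apply/cvg_ex; exists (eta_lim theta0 th)%:E.
  exact: cvg_mean_exp_overshoot.
- apply/integrableP; split=> //; under eq_integral.
    by move=> y; rewrite inE => /eta0 h; rewrite gee0_abs//; over.
  by rewrite -/gamma gE ltry.
- exists (fun b => first_mean theta0 t (theta2 s t) (theta1 theta0 s t) b / g - 1); split.
    rewrite -[X in _ --> X](subrr (g / g)) {2}mulfV ?gt_eqF//.
    by apply: cvgB; [apply: cvgM => //; exact: cvg_cst|exact: cvg_cst].
  move=> b; rewrite reject_prob_null//; last exact: iX.
  rewrite gE -!EFinM; congr (_%:E); rewrite addrC subrK mulfVK ?gt_eqF//.
  exact: mulrC.
- by move=> th b th0 tt; apply: (reject_prob_alt htheta0 hs ht b th0 tt); exact: iX.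
Qed.
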